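(* There are constants $M>0$ and $\omega>0$, independent of the initial conditions, such that for every solution $(V,V_t,\phi_1,P,P_t,\phi_2,\theta)$ of the thermoelastic piezoelectric system stated in the context, the energy $E$ defined there satisfies $$E(t)\le M\,E(0)\,e^{-\omega t}\qquad\text{for all } t\ge 0 .$$
   Context: Let $\rho,\alpha,\beta,\gamma,\mu,L,l_1,l_2,\eta,\delta,c,k>0$ and $0<a<1$ be constants with $\alpha=\alpha_1+\gamma^2\beta$, where $\alpha_1>0$. Put $\varpi(\xi)=|\xi|^{(2a-1)/2}$. The system is, for $x\in(0,L)$, $\xi\in\mathbb{R}$, $t>0$, $$\rho V_{tt}-\alpha V_{xx}+\gamma\beta P_{xx}+\delta\theta_x=0,\qquad \mu P_{tt}-\beta P_{xx}+\gamma\beta V_{xx}=0,\qquad c\theta_t-k\theta_{xx}+\delta V_{xt}=0,$$ $$\partial_t\phi_1+(\xi^2+\eta)\phi_1-V_t(L,t)\varpi(\xi)=0,\qquad \partial_t\phi_2+(\xi^2+\eta)\phi_2-P_t(L,t)\varpi(\xi)=0,$$ with boundary conditions $V(0,t)=P(0,t)=\theta_x(0,t)=\theta(L,t)=0$, $$\alpha V_x(L,t)-\gamma\beta P_x(L,t)=-l_1\frac{\sin(a\pi)}{\pi}\int_{-\infty}^{\infty}\varpi(\xi)\phi_1(\xi,t)\,d\xi,\qquad \beta P_x(L,t)-\gamma\beta V_x(L,t)=-l_2\frac{\sin(a\pi)}{\pi}\int_{-\infty}^{\infty}\varpi(\xi)\phi_2(\xi,t)\,d\xi,$$ and prescribed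 initial data $(V,V_t,\phi_1,P,P_t,\phi_2,\theta)|_{t=0}=U_0$. Let $H^1_*(0,L)=\{f\in H^1(0,L):f(0)=0\}$ and $$\mathcal{H}_1=H^1_*(0,L)\times L^2(0,L)\times L^2(\mathbb{R})\times H^1_*(0,L)\times L^2(0,L)\times L^2(\mathbb{R})\times L^2(0,L).$$ Let $\mathcal{D}$ be the set of $(V,f,\phi_1,P,g,\phi_2,\theta)\in\mathcal{H}_1$ with $V,P\in H^2(0,L)\cap H^1_*(0,L)$, $f,g\in H^1_*(0,L)$, $\theta\in H^2(0,L)$, $\theta_x(0)=\theta(L)=0$, $|\xi|\phi_1,|\xi|\phi_2,\,-(\xi^2+\eta)\phi_1+f(L)\varpi,\,-(\xi^2+\eta)\phi_2+g(L)\varpi\in L^2(\mathbb{R})$, and satisfying the two boundary conditions at $x=L$. A solution is the solution $U=(V,V_t,\phi_1,P,P_t,\phi_2,\theta)\in C([0,\infty);\mathcal{D})\cap C^1([0,\infty);\mathcal{H}_1)$ with initial datum $U_0\in\mathcal{D}$. The energy is $$E(t)=\frac12\int_0^L\left[\rho|V_t|^2+\alpha_1|V_x|^2+\mu|P_t|^2+\beta|\gamma V_x-P_x|^2+c|\theta|^2\right]dx+\frac{\sin(a\pi)}{2\pi}\int_{-\infty}^{\infty}\left(l_1|\phi_1|^2+l_2|\phi_2|^2\right)d\xi .$$ *)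

(* Defs.v *)
From HB Require Import structures.
From mathcomp Require Import all_boot all_order all_algebra.
From mathcomp Require Import all_classical all_reals all_analysis.
From mathcomp Require Export complex.
Set Implicit Arguments.
Unset Strict Implicit.
Unset Printing Implicit Defensive.
Import Order.TTheory GRing.Theory Num.Theory.
Import numFieldNormedType.Exports.
Local Open Scope classical_set_scope.
Local Open Scope ring_scope.

Record params (R : realType) := Params {
  rho : R; alpha : R; alpha1 : R; beta : R; gamma : R; mu : R; len : R;
  l1 : R; l2 : R; eta : R; delta : R; c : R; k : R; a : R }.

Definition admissible (R : realType) (p : params R) : Prop :=
  [/\ 0 < rho p, 0 < alpha p, 0 < alpha1 p, 0 < beta p & 0 < gamma p] /\
  [/\ 0 < mu p, 0 < len p, 0 < l1 p & 0 < l2 p] /\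
  [/\ 0 < eta p, 0 < delta p, 0 < c p & 0 < k p] /\
  0 < a p < 1 /\
  alpha p = alpha1 p + gamma p ^+ 2 * beta p.

(* Fields are complex valued; Rcomplex R is R[i] seen as a real vector space. *)
Notation field R := (R -> Rcomplex R).

Section FunctionSpaces.
Context {R : realType}.
Implicit Types (D : set R) (f g h : field R) (L : R).

Local Notation leb := (@lebesgue_measure R).

Definition abs2 (z : Rcomplex R) : R := complex.Re z ^+ 2 + complex.Im z ^+ 2.

Definition cintegral D f : Rcomplex R :=
  Complex (\int[leb]_(x in D) complex.Re (f x))
          (\int[leb]_(x in D) complex.Im (f x)).

Definition L2sq D f : \bar R := (\int[leb]_(x in D) (abs2 (f x))%:E)%E.

Definition L2 D f : Prop :=
  [/\ measurable_fun D (fun x => complex.Re (f x)),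
      measurable_fun D (fun x => complex.Im (f x)) &
      (L2sq D f < +oo)%E].

Definition dom L : set R := `]0, L[.

(* phi is C^1 with compact support in (0, L) *)
Definition test_function L (phi : R -> R) : Prop :=
  [/\ forall x, derivable phi x 1,
      continuous (derive1 phi) &
      exists u v : R, [/\ 0 < u, v < L &
        forall x, phi x != 0 -> u <= x <= v]].

Definition is_wderiv L f g : Prop :=
  L2 (dom L) g /\
  forall phi : R -> R, test_function L phi ->
    cintegral (dom L) (fun x => derive1 phi x *: f x) =
    - cintegral (dom L) (fun x => phi x *: g x).

(* the weak derivative on (0, L), unique almost everywhere; 0 if there is none *)
Definition wderiv L f : field R := xget 0 [set g | is_wderiv L f g].

Definition H1 L f : Prop := L2 (dom L) f /\ exists g, is_wderiv L f g.

Definition H2 L f : Prop := H1 L f /\ H1 L (wderiv L f).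

Definition is_crep L f h : Prop :=
  [/\ {within `[0, L], continuous (fun x => complex.Re (h x))},
      {within `[0, L], continuous (fun x => complex.Im (h x))} &
      h = f %[ae leb in dom L]].

(* value at x in [0, L] of the continuous representative of f in H^1(0, L) *)
Definition trace L f (x : R) : Rcomplex R := xget 0 [set h | is_crep L f h] x.

Definition H1star L f : Prop := H1 L f /\ trace L f 0 = 0.

Definition H1sq L f : \bar R :=
  (L2sq (dom L) f + L2sq (dom L) (wderiv L f))%E.

Definition H2sq L f : \bar R :=
  (H1sq L f + L2sq (dom L) (wderiv L (wderiv L f)))%E.

End FunctionSpaces.

(* (V, f, phi1, P, g, phi2, theta); elements are representatives, the fields
   other than phi1 and phi2 being relevant on (0, L) only *)
Notation state R :=
  (field R * field R * field R * field R * field R * field R * field R)%type.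


Section System.
Context {R : realType}.
Implicit Types (p : params R) (u w : state R) (phi : field R).

Local Notation leb := (@lebesgue_measure R).

Definition varpi p (xi : R) : R := `|xi| `^ ((2 * a p - 1) / 2).

(* the space H_1 and the square of its product norm *)
Definition inH p u : Prop :=
  let L := len p in
  let: (V, f, phi1, P, g, phi2, theta) := u in
  [/\ H1star L V, L2 (dom L) f & L2 setT phi1] /\
  [/\ H1star L P, L2 (dom L) g & L2 setT phi2] /\
  L2 (dom L) theta.

Definition Hsq p u : \bar R :=
  let L := len p in
  let: (V, f, phi1, P, g, phi2, theta) := u in
  (H1sq L V + L2sq (dom L) f + L2sq setT phi1 +
   H1sq L P + L2sq (dom L) g + L2sq setT phi2 + L2sq (dom L) theta)%E.

Definition xi_phi phi : field R := fun xi => `|xi| *: phi xi.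

(* - (xi^2 + eta) phi + f(L) varpi *)
Definition relax p phi (f : field R) : field R := fun xi =>
  - ((xi ^+ 2 + eta p) *: phi xi) + varpi p xi *: trace (len p) f (len p).

Definition memory p phi : Rcomplex R :=
  (sin (a p * pi) / pi) *: cintegral setT (fun xi => varpi p xi *: phi xi).

Definition inD p u : Prop :=
  let L := len p in
  let: (V, f, phi1, P, g, phi2, theta) := u in
  let Vx := wderiv L V in let Px := wderiv L P in
  inH p u /\
  [/\ H2 L V, H2 L P, H1star L f & H1star L g] /\
  [/\ H2 L theta, trace L (wderiv L theta) 0 = 0 & trace L theta L = 0] /\
  [/\ L2 setT (xi_phi phi1), L2 setT (xi_phi phi2),
      L2 setT (relax p phi1 f) & L2 setT (relax p phi2 g)] /\
  alpha p *: trace L Vx L - (gamma p * beta p) *: trace L Px L =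
    - (l1 p *: memory p phi1) /\
  beta p *: trace L Px L - (gamma p * beta p) *: trace L Vx L =
    - (l2 p *: memory p phi2).

(* square of the natural norm of D (equivalent to the graph norm) *)
Definition Dsq p u : \bar R :=
  let L := len p in
  let: (V, f, phi1, P, g, phi2, theta) := u in
  (H2sq L V + H1sq L f + L2sq setT phi1 +
   H2sq L P + H1sq L g + L2sq setT phi2 + H2sq L theta +
   L2sq setT (xi_phi phi1) + L2sq setT (xi_phi phi2) +
   L2sq setT (relax p phi1 f) + L2sq setT (relax p phi2 g))%E.

(* U in C([0, oo); D) *)
Definition continuous_in_D p (U : R -> state R) : Prop :=
  forall t, 0 <= t -> inD p (U t) /\
    Dsq p (U s - U t) @[s --> within [set s | 0 <= s] (nbhs t)] --> 0%E.

(* U in C^1([0, oo); H_1) with derivative W *)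
Definition C1_in_H p (U W : R -> state R) : Prop :=
  forall t, 0 <= t ->
    [/\ inH p (U t), inH p (W t),
        Hsq p (W s - W t) @[s --> within [set s | 0 <= s] (nbhs t)] --> 0%E &
        Hsq p (h^-1 *: (U (t + h) - U t) - W t)
          @[h --> within [set h | 0 <= t + h] (0 : R)^'] --> 0%E].

(* u is the state and w its time derivative: the second and fifth components
   of u are V_t and P_t *)
Definition velocities p u w : Prop :=
  let: (V, f, phi1, P, g, phi2, theta) := u in
  let: (Vt, ft, phi1t, Pt, gt, phi2t, thetat) := w in
  Vt = f %[ae leb in dom (len p)] /\ Pt = g %[ae leb in dom (len p)].

Definition equations p u w : Prop :=
  let L := len p in
  let: (V, Vt, phi1, P, Pt, phi2, theta) := u in
  let: (_, Vtt, phi1t, _, Ptt, phi2t, thetat) := w in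
  let Vxx := wderiv L (wderiv L V) in
  let Pxx := wderiv L (wderiv L P) in
  let thetax := wderiv L theta in
  let thetaxx := wderiv L thetax in
  let Vxt := wderiv L Vt in
  [/\ rho p *: Vtt - alpha p *: Vxx + (gamma p * beta p) *: Pxx
        + delta p *: thetax = 0 %[ae leb in dom L],
      mu p *: Ptt - beta p *: Pxx + (gamma p * beta p) *: Vxx
        = 0 %[ae leb in dom L] &
      c p *: thetat - k p *: thetaxx + delta p *: Vxt
        = 0 %[ae leb in dom L]] /\
  [/\ (fun xi => phi1t xi + (xi ^+ 2 + eta p) *: phi1 xi
        - varpi p xi *: trace L Vt L) = 0 %[ae leb] &
      (fun xi => phi2t xi + (xi ^+ 2 + eta p) *: phi2 xi
        - varpi p xi *: trace L Pt L) = 0 %[ae leb]].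

Definition is_solution p (U : R -> state R) : Prop :=
  continuous_in_D p U /\
  exists W : R -> state R,
    [/\ C1_in_H p U W,
        forall t, 0 <= t -> velocities p (U t) (W t) &
        forall t, 0 < t -> equations p (U t) (W t)].

Definition energy p u : R :=
  let L := len p in
  let: (V, Vt, phi1, P, Pt, phi2, theta) := u in
  let Vx := wderiv L V in let Px := wderiv L P in
  2^-1 * (\int[leb]_(x in dom L)
    (rho p * abs2 (Vt x) + alpha1 p * abs2 (Vx x) + mu p * abs2 (Pt x)
     + beta p * abs2 (gamma p *: Vx x - Px x) + c p * abs2 (theta x))) +
  sin (a p * pi) / (2 * pi) *
    (\int[leb]_xi (l1 p * abs2 (phi1 xi) + l2 p * abs2 (phi2 xi))).

End System.

(* Main.v *)
From HB Require Import structures.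
Require Import Defs.
From mathcomp Require Import all_boot all_order all_algebra.
From mathcomp Require Import all_classical all_reals all_analysis.
From mathcomp Require Import measurable_realfun ring lra.
Set Implicit Arguments.
Unset Strict Implicit.
Unset Printing Implicit Defensive.
Import Order.TTheory GRing.Theory Num.Theory.
Import numFieldNormedType.Exports.
Local Open Scope classical_set_scope.
Local Open Scope ring_scope.

(** The proof is by the energy method. The system is linear with real
    coefficients, so the real and the imaginary parts of a solution solve the
    same system, and the energy is the sum of their energies ([energy_snap]);
    it suffices to treat real functions.

    Testing the equations for V, P, theta and phi_1, phi_2 against V_t, P_t,
    theta and phi_1, phi_2 gives the energy identity ([energy_identity])

      E' = - k |theta_x|^2 - (sin(a pi)/pi) sum_i l_i int (xi^2 + eta) |phi_i|^2,

    so E' is at most a negative multiple of the dissipation D, the sum of these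
    norms without their coefficients. D bounds |theta|^2 by the Poincare
    inequality, and the squares of the stresses at x = L ([stress_dissip]),
    because varpi^2/(xi^2 + eta) is integrable for 0 < a < 1
    ([integrable_weight_sq]) and the memory integrals are therefore controlled
    by Cauchy-Schwarz. Four multiplier functionals recover the other terms of
    E: the derivative of each yields a negative multiple of one of them, up to
    a small multiple of terms recovered later and a large multiple of D and of
    the terms recovered before:

    - F1 = c rho <int_0^x theta, V_t> yields - |V_t|^2: integrating the heat
      equation over (0, x), with theta_x(0) = V_t(0) = 0, shows that
      d/dt int_0^x c theta = k theta_x - delta V_t ([dF1_le]);
    - F2 = rho <V_t, V> + gamma mu <P_t, V> yields - |V_x|^2: the combination
      rho V_tt + gamma mu P_tt contains alpha_1 V_xx and no P_xx ([dF2_le]);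
    - F3 = - rho <V_t, P> yields - |P_x|^2, by the coupling term
      gamma beta P_xx in the equation for V ([dF3_le]);
    - F4 = - mu <P_t, P> yields - |P_t|^2 ([dF4_le]).

    With N3, N2, N1 and N chosen in this order, each large enough,
    F = N E + N1 F1 + N2 F2 + N3 F3 + F4 is equivalent to E and satisfies
    F' <= - w F, whence F and E decay exponentially ([snapshot_decay]). The
    constants depend on the parameters of the system only.

    Regularity enters in three places. An element of H^1(0, L) has an
    absolutely continuous representative ([wd_representative], from the lemma
    of du Bois-Reymond), which gives the traces their meaning and justifies
    the integrations by parts ([ac_by_parts], by Fubini). Along a trajectory,
    differentiability in H_1 makes the inner products in E and F1, ..., F4
    differentiable in time ([tdiff_ip], [evolves_snap]). Finally F' <= - w F
    is integrated by monotonicity of F exp(w t) ([tdiff_exp_decay]); the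
    equations are needed for t > 0 only. *)

(** * Square integrable real functions *)

Section SquareIntegrable.
Context {R : realType}.
Local Notation leb := (@lebesgue_measure R).
Variable D : set R.
Hypothesis mD : measurable D.
Implicit Types f g h : R -> R.

(** Square integrability of a real function on [D]. *)
Definition sqi (D : set R) f : Prop :=
  measurable_fun D f /\ leb.-integrable D (EFin \o (fun x => f x ^+ 2)).

(** The (real) inner product of L^2(D). *)
Definition ip (D : set R) f g : R := \int[leb]_(x in D) (f x * g x).

Lemma sqiP f : measurable_fun D f ->
  (\int[leb]_(x in D) ((f x) ^+ 2)%:E < +oo)%E -> sqi D f.
Proof.
move=> mf fi; split => //; apply/integrableP; split.
  by apply/measurable_EFinP; exact: measurable_funX.
by under eq_integral do rewrite /= ger0_norm ?sqr_ge0//.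
Qed.

Lemma sqi_intM f g : sqi D f -> sqi D g ->
  leb.-integrable D (EFin \o (fun x => f x * g x)).
Proof.
move=> [mf fi] [mg gi].
apply: (@le_integrable _ _ R leb D mD _
  (EFin \o (fun x => f x ^+ 2 + g x ^+ 2))).
- by apply/measurable_EFinP; exact: measurable_funM.
- move=> x _ /=; rewrite lee_fin [leRHS]ger0_norm; last by rewrite addr_ge0 ?sqr_ge0.
  rewrite ler_norml; have := sqr_ge0 (f x - g x); have := sqr_ge0 (f x + g x).
  have := sqr_ge0 (f x); have := sqr_ge0 (g x).
  by rewrite sqrrD sqrrB; set u := f x; set v := g x; move=> ? ? ? ?; lra.
- rewrite (_ : _ \o _ = (EFin \o (fun x => f x ^+ 2)) \+
                        (EFin \o (fun x => g x ^+ 2))); last by apply/funext.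
  exact: integrableD.
Qed.

Lemma sqiZ (r : R) f : sqi D f -> sqi D (fun x => r * f x).
Proof.
move=> [mf fi]; split; first exact: measurable_funM.
rewrite (_ : _ \o _ = fun x => (r ^+ 2)%:E * (EFin \o (fun x => f x ^+ 2)%R) x)%E.
  exact: integrableZl.
by apply/funext => x /=; rewrite exprMn EFinM.
Qed.

Lemma sqiD f g : sqi D f -> sqi D g -> sqi D (fun x => f x + g x).
Proof.
move=> hf hg; have fg := sqi_intM hf hg.
move: hf hg => [mf fi] [mg gi]; split; first exact: measurable_funD.
rewrite (_ : _ \o _ = ((EFin \o (fun x => f x ^+ 2)%R) \+
  (fun x => 2%:E * (EFin \o (fun x => f x * g x)%R) x))
  \+ (EFin \o (fun x => g x ^+ 2)%R))%E; last first.
  by apply/funext => x /=; rewrite sqrrD -!EFinM -!EFinD -mulr_natl.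
by apply: integrableD => //; apply: integrableD => //; exact: integrableZl.
Qed.

Lemma sqiN f : sqi D f -> sqi D (fun x => - f x).
Proof.
by move=> /(sqiZ (-1)); under eq_fun do rewrite mulN1r.
Qed.

Lemma sqiB f g : sqi D f -> sqi D g -> sqi D (fun x => f x - g x).
Proof. by move=> hf hg; apply: sqiD => //; exact: sqiN. Qed.

Lemma sqi_lin2 (a b : R) f g : sqi D f -> sqi D g ->
  sqi D (fun x => a * f x + b * g x).
Proof. by move=> hf hg; apply: sqiD; exact: sqiZ. Qed.

(** A measurable function dominated by a square integrable one. *)
Lemma sqi_le f g : measurable_fun D f -> sqi D g ->
  (forall x, D x -> f x ^+ 2 <= g x ^+ 2) -> sqi D f.
Proof.
move=> mf [mg gi] fg; split => //.
apply: (@le_integrable _ _ R leb D mD _ (EFin \o (fun x => g x ^+ 2))) => //.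
  by apply/measurable_EFinP; exact: measurable_funX.
by move=> x Dx /=; rewrite lee_fin !ger0_norm ?sqr_ge0//; exact: fg.
Qed.

Lemma ip_ae f f' g g' : measurable_fun D f -> measurable_fun D f' ->
  measurable_fun D g -> measurable_fun D g' ->
  ae_eq leb D f f' -> ae_eq leb D g g' -> ip D f g = ip D f' g'.
Proof.
move=> mf mf' mg mg' ff' gg'; rewrite /ip /Rintegral; congr fine.
apply: ae_eq_integral => //.
- by apply/measurable_EFinP; exact: measurable_funM.
- by apply/measurable_EFinP; exact: measurable_funM.
- by apply: filterS2 ff' gg' => x h1 h2 Dx; rewrite h1 // h2.
Qed.

Lemma ipC f g : ip D f g = ip D g f.
Proof. by rewrite /ip; apply: eq_Rintegral => x _; rewrite mulrC. Qed.

Lemma ip_lin2 (a b : R) f g h : sqi D f -> sqi D g -> sqi D h ->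
  ip D (fun x => a * f x + b * g x) h = a * ip D f h + b * ip D g h.
Proof.
move=> hf hg hh; rewrite /ip -!RintegralZl//; try exact: sqi_intM.
rewrite -RintegralD//.
- by apply: eq_Rintegral => x _; rewrite mulrDl !mulrA.
- by have := sqi_intM (sqiZ a hf) hh; under eq_fun do rewrite -mulrA.
- by have := sqi_intM (sqiZ b hg) hh; under eq_fun do rewrite -mulrA.
Qed.

Lemma ip_lin2r (a b : R) f g h : sqi D f -> sqi D g -> sqi D h ->
  ip D h (fun x => a * f x + b * g x) = a * ip D h f + b * ip D h g.
Proof. by move=> *; rewrite ipC ip_lin2// !(ipC h). Qed.

Lemma ipZ (a : R) f h : sqi D f -> sqi D h ->
  ip D (fun x => a * f x) h = a * ip D f h.
Proof.
move=> hf hh; rewrite /ip -RintegralZl//; last exact: sqi_intM.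
by apply: eq_Rintegral => x _; rewrite mulrA.
Qed.

Lemma ipD f g h : sqi D f -> sqi D g -> sqi D h ->
  ip D (fun x => f x + g x) h = ip D f h + ip D g h.
Proof.
move=> hf hg hh; have := ip_lin2 1 1 hf hg hh.
by rewrite !mul1r => <-; congr (ip D _ h); apply/funext => x; rewrite !mul1r.
Qed.

Lemma ip_ge0 f : 0 <= ip D f f.
Proof. by apply: Rintegral_ge0 => x _; rewrite -expr2 sqr_ge0. Qed.

Lemma ip_sq_lin2 (a b : R) f g : sqi D f -> sqi D g ->
  ip D (fun x => a * f x + b * g x) (fun x => a * f x + b * g x) =
  a ^+ 2 * ip D f f + 2 * a * b * ip D f g + b ^+ 2 * ip D g g.
Proof.
move=> hf hg; have hh := sqi_lin2 a b hf hg.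
rewrite ip_lin2// !ip_lin2r// (ipC g f); ring.
Qed.

(** Young's inequality with a parameter. *)
Lemma young (e : R) f g : 0 < e -> sqi D f -> sqi D g ->
  ip D f g <= e * ip D f f + (4 * e)^-1 * ip D g g.
Proof.
move=> e0 hf hg.
have h0 := ip_ge0 (fun x => (2 * e) * f x + (-1) * g x).
rewrite ip_sq_lin2// in h0.
have h1 : (4 * e) * (e * ip D f f + (4 * e)^-1 * ip D g g - ip D f g) =
 (2 * e) ^+ 2 * ip D f f + 2 * (2 * e) * -1 * ip D f g + (-1) ^+ 2 * ip D g g.
  by field; rewrite ?gt_eqF//.
rewrite -subr_ge0 -(pmulr_rge0 _ (_ : 0 < 4 * e)) ?h1//.
by rewrite mulr_gt0.
Qed.

Lemma young_norm (e : R) f g : 0 < e -> sqi D f -> sqi D g ->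
  `|ip D f g| <= e * ip D f f + (4 * e)^-1 * ip D g g.
Proof.
move=> e0 hf hg; rewrite ler_norml young// andbT.
have := young e0 (sqiN hf) hg.
have -> : ip D (fun x => - f x) g = - ip D f g.
  rewrite -mulN1r -ipZ//; congr (ip D _ g).
  by apply/funext => x; rewrite mulN1r.
have -> : ip D (fun x => - f x) (fun x => - f x) = ip D f f.
  by apply: eq_Rintegral => x _; rewrite mulrNN.
by rewrite lerNl.
Qed.

Lemma cauchy_schwarz f g : sqi D f -> sqi D g ->
  ip D f g ^+ 2 <= ip D f f * ip D g g.
Proof.
move=> hf hg; have a0 := ip_ge0 f; have b0 := ip_ge0 g.
have H a b : 0 <= a ^+ 2 * ip D f f + 2 * a * b * ip D f g + b ^+ 2 * ip D g g.
  by rewrite -ip_sq_lin2//; exact: ip_ge0.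
have [f0|fN0] := eqVneq (ip D f f) 0; last first.
  have fp : 0 < ip D f f by rewrite lt_neqAle eq_sym fN0.
  have := H (- ip D f g) (ip D f f).
  have -> : (- ip D f g) ^+ 2 * ip D f f +
     2 * - ip D f g * ip D f f * ip D f g +
     ip D f f ^+ 2 * ip D g g =
     ip D f f * (ip D f f * ip D g g - ip D f g ^+ 2) by ring.
  by rewrite pmulr_rge0// subr_ge0.
rewrite f0 mul0r; have := sqr_ge0 (ip D f g).
rewrite le_eqVlt => /orP[/eqP <-//|p0].
exfalso.
have := H (- (ip D g g + 1)/ (ip D f g)) 1.
rewrite f0 mulr0 add0r.
have n0 : ip D f g != 0 by apply: contraTneq p0 => ->; rewrite expr0n ltxx.
have -> : 2 * (- (ip D g g + 1) / ip D f g) * 1 * ip D f g = - 2 * (ip D g g + 1).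
  by field.
by rewrite expr1n mul1r; lra.
Qed.

End SquareIntegrable.

(** * Differentiation in time of inner products *)

Section TimeDerivatives.
Context {R : realType}.
Local Notation leb := (@lebesgue_measure R).
Implicit Types (t s h : R) (D : set R).

(** Increments [h != 0] that keep the time [t + h] nonnegative. *)
Definition increments (t : R) := within [set h | 0 <= t + h] (0 : R)^'.

#[local] Instance increments_filter t : Filter (increments t).
Proof. exact: within_filter. Qed.

(** [d] is the derivative at [t] of [F], regarded as a function on [0, oo);
    at [t = 0] it is one-sided. *)
Definition tdiff (F : R -> R) (d t : R) : Prop :=
  h^-1 * (F (t + h) - F t) @[h --> increments t] --> d.

(** The error in the first order expansion at [t] of a curve of functions. *)
Definition dq_err (U : R -> R -> R) (U' : R -> R) (t h x : R) : R :=
  h^-1 * (U (t + h) x - U t x) - U' x.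

(** [U'] is the derivative at [t] of [U] as a curve in L^2(D). *)
Definition l2diff (D : set R) (U : R -> R -> R) (U' : R -> R) (t : R) : Prop :=
  ip D (dq_err U U' t h) (dq_err U U' t h) @[h --> increments t] --> 0.

Lemma near_increments t : \forall h \near increments t, h != 0 /\ 0 <= t + h.
Proof.
rewrite /increments near_withinE; near=> h => /= th; split => //.
by near: h; exact: nbhs_dnbhs_neq.
Unshelve. all: by end_near. Qed.

Lemma increments_cvg0 t : h @[h --> increments t] --> 0.
Proof.
apply: (@cvg_trans _ (h @[h --> (0 : R)^'])).
  exact: cvg_within.
exact: cvg_within.
Qed.

Lemma tdiffD F G a b t : tdiff F a t -> tdiff G b t ->
  tdiff (fun s => F s + G s) (a + b) t.
Proof.
rewrite /tdiff => hF hG; apply: cvg_trans (cvgD hF hG); apply: near_eq_cvg.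
by near=> h; rewrite !fctE /=; ring.
Unshelve. all: by end_near. Qed.

Lemma tdiffZ r F a t : tdiff F a t -> tdiff (fun s => r * F s) (r * a) t.
Proof.
rewrite /tdiff => hF; apply: cvg_trans (@cvgMl_tmp _ _ _ _ _ r _ hF); apply: near_eq_cvg.
by near=> h; rewrite /=; ring.
Unshelve. all: by end_near. Qed.

Lemma sqi_dq_err D (mD : measurable D) U U' t h :
  0 <= t -> 0 <= t + h -> (forall s, 0 <= s -> sqi D (U s)) -> sqi D U' ->
  sqi D (dq_err U U' t h).
Proof.
move=> t0 th hU hU'; apply: sqiB => //; apply: sqiZ => //.
by apply: sqiB => //; exact: hU.
Qed.

Lemma ip_dq_err_cvg0 D (mD : measurable D) U U' w t :
  0 <= t -> (forall s, 0 <= s -> sqi D (U s)) -> sqi D U' -> sqi D w ->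
  l2diff D U U' t ->
  ip D (dq_err U U' t h) w @[h --> increments t] --> 0.
Proof.
move=> t0 hU hU' hw hd.
apply: norm_cvg0.
have sq : Num.sqrt (ip D (dq_err U U' t h) (dq_err U U' t h) * ip D w w)
  @[h --> increments t] --> 0.
  have pr : ip D (dq_err U U' t h) (dq_err U U' t h) * ip D w w
      @[h --> increments t] --> 0.
    by rewrite -[X in _ --> X](mul0r (ip D w w)); exact: cvgMr_tmp.
  rewrite -[X in _ --> X]sqrtr0.
  exact: (cvg_comp _ _ pr (@sqrt_continuous R 0)).
apply: (@squeeze_cvgr _ _ _ _ (fun=> 0) _ _) sq; last exact: cvg_cst.
near=> h; rewrite normr_ge0/=.
have [_ th] : h != 0 /\ 0 <= t + h by near: h; exact: near_increments.
rewrite -sqrtr_sqr ler_wsqrtr//; apply: cauchy_schwarz => //.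
exact: sqi_dq_err.
Unshelve. all: by end_near. Qed.

(** The product rule for the inner product of two differentiable curves. *)
Lemma tdiff_ip D (mD : measurable D) U U' V V' t :
  0 <= t -> (forall s, 0 <= s -> sqi D (U s)) -> sqi D U' ->
  (forall s, 0 <= s -> sqi D (V s)) -> sqi D V' ->
  l2diff D U U' t -> l2diff D V V' t ->
  tdiff (fun s => ip D (U s) (V s)) (ip D U' (V t) + ip D (U t) V') t.
Proof.
move=> t0 hU hU' hV hV' dU dV; rewrite /tdiff.
pose eu := dq_err U U' t; pose ev := dq_err V V' t.
have euVt : ip D (eu h) (V t) @[h --> increments t] --> 0.
  by apply: ip_dq_err_cvg0 => //; exact: hV.
have euV' : ip D (eu h) V' @[h --> increments t] --> 0.
  exact: ip_dq_err_cvg0.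
have evUt : ip D (ev h) (U t) @[h --> increments t] --> 0.
  by apply: ip_dq_err_cvg0 => //; exact: hU.
have evU' : ip D (ev h) U' @[h --> increments t] --> 0.
  exact: ip_dq_err_cvg0.
have euev : ip D (eu h) (ev h) @[h --> increments t] --> 0.
  apply: norm_cvg0.
  have sq : ip D (eu h) (eu h) + 4^-1 * ip D (ev h) (ev h)
      @[h --> increments t] --> 0.
    rewrite -[X in _ --> X]addr0; apply: cvgD => //.
    by rewrite -[X in _ --> X](mulr0 4^-1); exact: cvgMl_tmp.
  apply: (@squeeze_cvgr _ _ _ _ (fun=> 0) _ _) sq; last exact: cvg_cst.
  near=> h; rewrite normr_ge0/=.
  have [_ th] : h != 0 /\ 0 <= t + h by near: h; exact: near_increments.
  have := @young_norm _ _ mD 1 _ _ ltr01 (sqi_dq_err mD t0 th hU hU')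
    (sqi_dq_err mD t0 th hV hV').
  by rewrite mul1r mulr1.
have lim : ip D U' (V t) + ip D (U t) V' + (ip D (eu h) (V t) + ip D (ev h) (U t)
   + h * (ip D U' V' + ip D (eu h) V' + ip D (ev h) U' + ip D (eu h) (ev h)))
   @[h --> increments t] -->
   ip D U' (V t) + ip D (U t) V' + (0 + 0
   + 0 * (ip D U' V' + 0 + 0 + 0)).
  apply: cvgD; first exact: cvg_cst.
  apply: cvgD; first exact: cvgD.
  apply: cvgM; first exact: increments_cvg0.
  apply: cvgD => //; apply: cvgD => //; apply: cvgD => //; exact: cvg_cst.
rewrite mul0r !addr0 in lim.
apply: cvg_trans lim; apply: near_eq_cvg; near=> h.
have [h0 th] : h != 0 /\ 0 <= t + h by near: h; exact: near_increments.
have seu : sqi D (eu h) by exact: sqi_dq_err.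
have sev : sqi D (ev h) by exact: sqi_dq_err.
have sU := hU _ t0; have sV := hV _ t0.
have EU : U (t + h) = fun x => 1 * U t x + h * (1 * U' x + 1 * eu h x).
  by apply/funext => x; rewrite /eu /dq_err; field.
have EV : V (t + h) = fun x => 1 * V t x + h * (1 * V' x + 1 * ev h x).
  by apply/funext => x; rewrite /ev /dq_err; field.
have sqU := sqi_lin2 mD 1 1 hU' seu.
have sqV := sqi_lin2 mD 1 1 hV' sev.
rewrite EU EV !(ip_lin2, ip_lin2r) //; try exact: sqi_lin2.
rewrite (ipC D (ev h) (U t)) (ipC D (ev h) U').
by field.
Unshelve. all: by end_near. Qed.

Lemma tdiff_continuous F d t : tdiff F d t ->
  F (t + h) @[h --> increments t] --> F t.
Proof.
move=> hF.
have : F t + h * (h^-1 * (F (t + h) - F t)) @[h --> increments t] --> F t + 0 * d.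
  apply: cvgD; first exact: cvg_cst.
  by apply: cvgM => //; exact: increments_cvg0.
rewrite mul0r addr0 => lim; apply: cvg_trans lim; apply: near_eq_cvg; near=> h.
have [h0 th] : h != 0 /\ 0 <= t + h by near: h; exact: near_increments.
by field.
Unshelve. all: by end_near. Qed.

Lemma tdiff_is_derive F d t : 0 < t -> tdiff F d t -> is_derive t 1 F d.
Proof.
move=> t0 hF.
have H : h^-1 *: (F (h *: 1 + t) - F t) @[h --> (0:R)^'] --> d.
  move=> A /hF; rewrite /increments /= /nbhs /= /within /= => HA.
  have B : \forall h \near (0:R)^', `|h| < t by exact: dnbhs0_lt.
  apply: filterS2 HA B => h HA B; rewrite /= [h%:A]mulr1 (addrC h t); apply: HA.
  by rewrite /=; move: B; rewrite ltr_norml => /andP[+ _]; lra.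
by apply: DeriveDef; [apply/cvg_ex; exists d|exact/cvg_lim].
Qed.

(** Gronwall: a function with F' <= - w F decays exponentially. *)
Lemma tdiff_exp_decay (F F' : R -> R) (w : R) :
  (forall t, 0 <= t -> tdiff F (F' t) t) ->
  (forall t, 0 < t -> F' t <= - w * F t) ->
  forall t, 0 <= t -> F t <= F 0 * expR (- w * t).
Proof.
move=> dF leF t; rewrite le_eqVlt => /predU1P[<-|t0].
  by rewrite mulr0 expR0 mulr1.
pose G s := F s * expR (w * s).
have dG s : 0 < s -> is_derive s 1 G (F s * (expR (w * s) * w) + expR (w * s) * F' s).
  move=> s0; have ds := tdiff_is_derive s0 (dF _ (ltW s0)).
  have dw : is_derive s 1 (fun s => w * s) w.
    by have := is_deriveZ w (is_derive_id s (1 : R)); rewrite [w *: 1]mulr1; exact.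
  have de : is_derive s 1 (fun s => expR (w * s)) (expR (w * s) * w).
    exact: (@is_derive1_comp _ expR).
  exact: (is_deriveM ds de).
have derG s : 0 < s -> derivable G s 1 by move=> /dG [].
have cF0 : F s @[s --> 0^'+] --> F 0.
  move=> A /(tdiff_continuous (dF 0 (lexx 0))) HA.
  have {}HA : \forall s \near (0 : R), s != 0 -> 0 <= 0 + s -> A (F (0 + s)).
    exact: HA.
  suff : \forall s \near (0 : R), 0 < s -> A (F s) by [].
  apply: filterS HA => s HA s0; rewrite -(add0r s); apply: HA.
    by rewrite gt_eqF.
  by rewrite add0r ltW.
have cG : {within `[0, t], continuous G}.
  apply/(continuous_within_itvP _ t0); split.
  - move=> s; rewrite in_itv /= => /andP[s0 _].
    apply: differentiable_continuous; apply/derivable1_diffP.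
    exact: derG.
  - apply: cvgM => //; apply: cvg_at_right_filter.
    apply: (continuous_comp (f := fun s => w * s)).
      exact: mulrl_continuous.
    exact: continuous_expR.
  - apply: cvg_at_left_filter.
    apply: differentiable_continuous; apply/derivable1_diffP.
    exact: derG.
(* G = F exp(w s) is nonincreasing *)
suff : G t <= G 0.
  rewrite /G mulr0 expR0 mulr1 => GG.
  by rewrite mulNr expRN ler_pdivlMr// expR_gt0.
apply: (@ler0_derive1_le_cc R G 0 t _ _ cG); rewrite ?in_itv/= ?lexx ?ltW//.
- move=> s; rewrite in_itv /= => /andP[s0 _].
  exact: derG.
- move=> s; rewrite in_itv /= => /andP[s0 _].
  rewrite derive1E; case: (dG _ s0) => _ ->.
  rewrite [X in X + _](_ : _ = expR (w * s) * (w * F s)); last by ring.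
  rewrite -mulrDr mulr_ge0_le0 ?expR_ge0//.
  by have := leF _ s0; lra.
Qed.

End TimeDerivatives.

(** * Primitives and integration by parts *)

Section Primitives.
Context {R : realType}.
Local Notation leb := (@lebesgue_measure R).
Implicit Types f g h u v : R -> R.

(** u(x) v(y) on the half plane {y < x}, extended by zero. *)
Definition half_plane_fun u v (z : R * R) : R :=
  if z.2 < z.1 then u z.1 * v z.2 else 0.

Lemma integrable_half_plane u v :
  leb.-integrable setT (EFin \o u) -> leb.-integrable setT (EFin \o v) ->
  (leb \x leb)%E.-integrable setT (EFin \o half_plane_fun u v).
Proof.
move=> iu iv.
pose f := half_plane_fun u v.
have mu : measurable_fun setT u by apply/measurable_EFinP; exact: measurable_int iu.
have mv : measurable_fun setT v by apply/measurable_EFinP; exact: measurable_int iv.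
have muv : measurable_fun setT (fun z : R * R => u z.1 * v z.2).
  apply: measurable_funM; first exact: measurableT_comp.
  exact: measurableT_comp.
have mf : measurable_fun setT f.
  apply: measurable_fun_ifT => //.
  by apply: measurable_fun_ltr; [exact: measurable_snd|exact: measurable_fst].
have ivD A : measurable A -> leb.-integrable A (EFin \o v).
  by move=> mA; exact: integrableS iv.
have iuD A : measurable A -> leb.-integrable A (EFin \o u).
  by move=> mA; exact: integrableS iu.
apply: (@le_integrable _ _ R (leb \x leb)%E setT measurableT (EFin \o f)
    (EFin \o (fun z : R * R => u z.1 * v z.2))).
  - exact/measurable_EFinP.
  - move=> z _ /=; rewrite lee_fin /f /half_plane_fun; case: ifP => // _.
    by rewrite normr0 normr_ge0.
  - apply/integrable12ltyP; first exact/measurable_EFinP.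
    have vfin : (\int[leb]_y `|v y|%:E)%E \is a fin_num.
      case/integrableP : iv => _ /=.
      by rewrite ge0_fin_numE//; exact: integral_ge0.
    have E0 x : (\int[leb]_y `|(EFin \o (fun z : R * R => u z.1 * v z.2)%R) (x, y)| =
        `|u x|%:E * \int[leb]_y `|v y|%:E)%E.
      under eq_integral do rewrite /= normrM EFinM.
      rewrite ge0_integralZl//=; apply/measurable_EFinP; exact: measurableT_comp.
    under eq_integral do rewrite E0.
    rewrite ge0_integralZr//=.
    + rewrite lte_mul_pinfty//.
      * exact: integral_ge0.
      * case/integrableP : iu => _.
        by rewrite ge0_fin_numE//; exact: integral_ge0.
      * by rewrite -ge0_fin_numE//; exact: integral_ge0.
    + by apply/measurable_EFinP; exact: measurableT_comp.
    + exact: integral_ge0.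
Qed.

(** The inner integral of the iterated integral. *)
Lemma half_plane_slice u v x : leb.-integrable setT (EFin \o v) ->
  (\int[leb]_y (EFin \o half_plane_fun u v) (x, y) =
    (u x * \int[leb]_(y in `]-oo, x[) v y)%:E)%E.
Proof.
move=> iv.
have ivD A : measurable A -> leb.-integrable A (EFin \o v).
  by move=> mA; exact: integrableS iv.
rewrite EFinM /Rintegral fineK; last first.
  by apply: integrable_fin_num => //; exact: ivD.
rewrite -integralZl//=; last exact: ivD.
rewrite [RHS]integral_mkcond; apply: eq_integral => y _ /=.
rewrite patchE /half_plane_fun /=.
have -> : (y \in [set` `]-oo, x[%R]) = (y < x).
  by apply/idP/idP; rewrite inE /= in_itv.
by case: ifP.
Qed.

Lemma integrable_mul_primitive u v :
  leb.-integrable setT (EFin \o u) -> leb.-integrable setT (EFin \o v) ->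
  leb.-integrable setT (EFin \o (fun x => u x * \int[leb]_(y in `]-oo, x[) v y)).
Proof.
move=> iu iv; have If := integrable_half_plane iu iv.
apply: eq_integrable (integrable_fubini_F If) => //= x _.
by rewrite /fubini_F half_plane_slice.
Qed.

(** Fubini's theorem on the half plane {y < x}. *)
Lemma fubini_half_plane u v :
  leb.-integrable setT (EFin \o u) -> leb.-integrable setT (EFin \o v) ->
  \int[leb]_x (u x * \int[leb]_(y in `]-oo, x[) v y) +
  \int[leb]_x (v x * \int[leb]_(y in `]-oo, x[) u y) =
  (\int[leb]_x u x) * (\int[leb]_x v x).
Proof.
move=> iu iv.
have iuD A : measurable A -> leb.-integrable A (EFin \o u).
  by move=> mA; exact: integrableS iu.
pose f := half_plane_fun u v.
have If := integrable_half_plane iu iv.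
have F := Fubini If.
have E2 y : (\int[leb]_x (EFin \o f) (x, y) =
    (v y * (\int[leb]_x u x - \int[leb]_(x in `]-oo, y[) u x))%:E)%E.
  have -> : (\int[leb]_x u x - \int[leb]_(x in `]-oo, y[) u x =
    \int[leb]_(x in `]y, +oo[) u x)%R.
    rewrite Rintegral_itv_bndo_bndc; last exact: iuD.
    by rewrite -set_itvNyy Rintegral_itvB ?bnd_simp//; exact: iuD.
  rewrite EFinM /Rintegral fineK; last first.
    by apply: integrable_fin_num => //; exact: iuD.
  rewrite -integralZl//=; last exact: iuD.
  rewrite [RHS]integral_mkcond; apply: eq_integral => x _ /=.
  rewrite patchE /f /half_plane_fun /=.
  have -> : (x \in [set` `]y, +oo[%R]) = (y < x).
    by apply/idP/idP; rewrite inE /= in_itv/= ?andbT.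
  by case: ifP => // _; rewrite mulrC EFinM.
have I4 := integrable_mul_primitive iv iu.
have I3 : leb.-integrable setT (EFin \o (fun y => v y * \int[leb]_x u x)).
  by have := integrableZr measurableT (\int[leb]_x u x) iv.
have /(congr1 fine) G : (\int[leb]_x (u x * \int[leb]_(y in `]-oo, x[) v y)%:E =
  \int[leb]_y (v y * (\int[leb]_x u x - \int[leb]_(x in `]-oo, y[) u x))%:E)%E.
  by under eq_integral do rewrite -(half_plane_slice u _ iv); under [RHS]eq_integral do rewrite -E2.
rewrite -!/(Rintegral _ _ _) in G; rewrite G.
under [in LHS]eq_Rintegral do rewrite mulrBr.
by rewrite RintegralB// subrK RintegralZr// mulrC.
Qed.

End Primitives.

Section AbsolutelyContinuous.
Context {R : realType}.
Local Notation leb := (@lebesgue_measure R).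
Implicit Types f g h u v : R -> R.

(** The primitive of [g] on (0, L) that vanishes at 0. *)
Definition prim g (x : R) : R := \int[leb]_(t in `]0, x[) g t.

(** [h] is, on [0, L], a primitive of the square integrable function [g];
    equivalently, it is the continuous representative of an element of
    H^1(0, L) with derivative [g]. *)
Definition ac (L : R) h g : Prop :=
  sqi (dom L) g /\ forall x, 0 <= x <= L -> h x = h 0 + prim g x.

Lemma measurable_dom (L : R) : measurable (dom L).
Proof. exact: measurable_itv. Qed.
Lemma leb_dom (L : R) : 0 < L -> leb (dom L) = L%:E.
Proof. by move=> L0; rewrite /dom lebesgue_measure_itv/= lte_fin L0 sube0. Qed.

Variable L : R.
Hypothesis L0 : 0 < L.
Local Notation D := (dom L).
Let mD : measurable D := measurable_dom L.

Lemma integrable_cst_dom (r : R) : leb.-integrable D (EFin \o (fun=> r)).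
Proof.
apply/integrableP; split; first exact: measurable_cst.
rewrite [X in (X < _)%E](_ : _ = (`|r|%:E * L%:E)%E); first by rewrite -EFinM ltry.
by rewrite -leb_dom// -integral_cst//.
Qed.

Lemma sqi_cst (r : R) : sqi D (fun=> r).
Proof. by split; [exact: measurable_cst|exact: integrable_cst_dom]. Qed.

Lemma sqi_integrable g : sqi D g -> leb.-integrable D (EFin \o g).
Proof.
move=> hg; have := sqi_intM mD hg (sqi_cst 1).
by under eq_fun do rewrite mulr1.
Qed.

Lemma sqi_restr g : sqi D g -> leb.-integrable setT (EFin \o (g \_ D)).
Proof.
move=> hg; rewrite -restrict_EFin; apply/integrable_restrict => //.
by rewrite setTI; exact: sqi_integrable.
Qed.

Lemma prim_restr g x : x <= L -> prim g x = \int[leb]_(t in `]-oo, x[) (g \_ D) t.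
Proof.
move=> xL; rewrite /prim Rintegral_mkcond [RHS]Rintegral_mkcond.
apply: eq_Rintegral => y _; rewrite !patchE.
have [yx|yx] := boolP (y \in [set` `]0, x[]); last first.
  case: ifP => // y1; case: ifP => // yD; case/negP: yx.
  move: y1 yD; rewrite !inE /dom /= !in_itv/= => yx /andP[-> _].
  by rewrite yx.
move: yx; rewrite inE /= in_itv /= => /andP[y0 yx].
rewrite ifT; last by rewrite inE /= in_itv.
by rewrite ifT // inE /dom /= in_itv /= y0 (lt_le_trans yx xL).
Qed.

Lemma integrable_sub_dom g x : x <= L -> sqi D g ->
  leb.-integrable `]0, x[ (EFin \o g).
Proof.
move=> xL hg; apply: integrableS (sqi_integrable hg) => //.
by apply: subset_itvl; rewrite bnd_simp.
Qed.

Lemma prim_lin2 (a b : R) u v x : x <= L -> sqi D u -> sqi D v ->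
  prim (fun y => a * u y + b * v y) x = a * prim u x + b * prim v x.
Proof.
move=> xL hu hv; rewrite /prim RintegralD// ?RintegralZl//;
  try exact: integrable_sub_dom.
- exact: (integrable_sub_dom xL (sqiZ mD a hu)).
- exact: (integrable_sub_dom xL (sqiZ mD b hv)).
Qed.

Lemma prim0 g : prim g 0 = 0.
Proof. by rewrite /prim set_itv_ge ?Rintegral_set0// bnd_simp ltxx. Qed.

Lemma Rintegral_cst_dom (r : R) : \int[leb]_(x in D) r = r * L.
Proof. by rewrite Rintegral_cst// [X in fine X](leb_dom L0). Qed.

Lemma ip_dom_cst (r s : R) : ip D (fun=> r) (fun=> s) = r * s * L.
Proof. exact: Rintegral_cst_dom. Qed.

Lemma prim_dom g : prim g L = ip D g (fun=> 1).
Proof. by rewrite /prim /ip; apply: eq_Rintegral => x _; rewrite mulr1. Qed.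

Lemma prim_sq_le g x : 0 <= x <= L -> sqi D g -> prim g x ^+ 2 <= L * ip D g g.
Proof.
move=> /andP[x0 xL] hg.
pose ind := fun y : R => if y < x then 1 else 0 : R.
have hi : sqi D ind.
  apply: (@sqi_le _ _ mD _ (fun=> 1)); last 2 first.
  - exact: sqi_cst.
  - by move=> y _; rewrite /ind; case: ifP => // _; rewrite expr0n expr1n ler01.
  apply: measurable_funTS; apply: measurable_fun_ifT => //.
  by apply: measurable_fun_ltr => //; exact: measurable_cst.
have -> : prim g x = ip D g ind.
  rewrite /prim /ip Rintegral_mkcond [RHS]Rintegral_mkcond.
  apply: eq_Rintegral => y _; rewrite !patchE.
  have [yx|yx] := boolP (y \in [set` `]0, x[]).
    move: yx; rewrite inE /= in_itv /= => /andP[y0 yx].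
    rewrite ifT /ind ?yx ?mulr1//.
    by rewrite inE /dom/= in_itv/= y0 (lt_le_trans yx xL).
  case: ifP => // yD; rewrite /ind; case: ifP => [y1|]; last by rewrite mulr0.
  by case/negP: yx; move: yD; rewrite !inE /dom /= !in_itv/= y1 => /andP[->].
apply: (le_trans (cauchy_schwarz mD hg hi)).
rewrite mulrC ler_wpM2r ?ip_ge0//.
rewrite -[leRHS]mul1r -[X in X * L]mulr1 -(ip_dom_cst 1 1).
apply: le_Rintegral => //.
- exact: sqi_intM.
- exact: (sqi_intM mD (sqi_cst 1) (sqi_cst 1)).
- by move=> y _; rewrite /ind; case: ifP => _; rewrite ?mulr1 ?mulr0 ?ler01.
Qed.

Lemma prim_continuous g : sqi D g -> {within `[0, L], continuous (prim g)}.
Proof.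
move=> hg; pose g' := g \_ D.
have ig : leb.-integrable `[0, L] (EFin \o g').
  by apply: integrableS (sqi_restr hg).
have := parameterized_integral_continuous (ltW L0) ig.
apply: subspace_eq_continuous => x; rewrite inE /= in_itv /= => /andP[x0 xL].
rewrite /parameterized_integral /from_subspace /= -Rintegral_itv_obnd_cbnd; last first.
  by apply: integrableS (sqi_restr hg).
rewrite -Rintegral_itv_bndo_bndc; last first.
  by apply: integrableS (sqi_restr hg).
apply: eq_Rintegral => y; rewrite inE /= in_itv /= => /andP[y0 yx].
by rewrite /g' patchE ifT// inE /dom /= in_itv/= y0 (lt_le_trans yx).
Qed.

Lemma continuous_measurable_dom h :
  {within `[0, L], continuous h} -> measurable_fun D h.
Proof.
move=> /subspace_continuous_measurable_fun => /(_ (measurable_itv _)).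
by apply: measurable_funS => //; exact: subset_itv_oo_cc.
Qed.

Lemma sqi_prim g : sqi D g -> sqi D (prim g).
Proof.
move=> hg.
apply: (@sqi_le _ _ mD _ (fun=> Num.sqrt (L * ip D g g))).
- by apply: continuous_measurable_dom; exact: prim_continuous.
- exact: sqi_cst.
- move=> x; rewrite /dom /= in_itv /= => /andP[x0 xL].
  rewrite sqr_sqrtr; first by apply: prim_sq_le => //; rewrite !ltW.
  by rewrite mulr_ge0 ?ip_ge0// ltW.
Qed.

Lemma ip_prim_le g : sqi D g -> ip D (prim g) (prim g) <= L ^+ 2 * ip D g g.
Proof.
move=> hg; have hp := sqi_prim hg.
have -> : L ^+ 2 * ip D g g = \int[leb]_(x in D) (L * ip D g g).
  by rewrite Rintegral_cst_dom; ring.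
apply: le_Rintegral => //; first exact: sqi_intM.
  exact: integrable_cst_dom.
move=> x; rewrite /dom /= in_itv /= => /andP[x0 xL].
by rewrite -expr2; apply: prim_sq_le => //; rewrite !ltW.
Qed.

Lemma ac_continuous h g : ac L h g -> {within `[0, L], continuous h}.
Proof.
move=> [hg hh].
have : {within `[0, L], continuous (fun x => h 0 + prim g x)}.
  move=> x; apply: cvgD; first exact: cvg_cst.
  exact: prim_continuous.
apply: subspace_eq_continuous => x; rewrite inE /= in_itv /= => xL.
by rewrite /from_subspace /= -hh.
Qed.

Lemma sqi_ac h g : ac L h g -> sqi D h.
Proof.
move=> hh; have mh := continuous_measurable_dom (ac_continuous hh).
case: hh => hg hh.
have s := sqiD mD (sqi_cst (h 0)) (sqi_prim hg).
apply: sqi_le mh s _ => // x; rewrite /dom /= in_itv /= => /andP[x0 xL].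
by rewrite hh// !ltW.
Qed.

(** Integration by parts for absolutely continuous functions. *)
Lemma ac_by_parts h1 g1 h2 g2 : ac L h1 g1 -> ac L h2 g2 ->
  ip D g1 h2 + ip D h1 g2 = h1 L * h2 L - h1 0 * h2 0.
Proof.
move=> a1 a2; have s1 := sqi_ac a1; have s2 := sqi_ac a2.
move: a1 a2 => [q1 H1] [q2 H2].
have LL : 0 <= L <= L by rewrite lexx ltW.
have p1 := sqi_prim q1; have p2 := sqi_prim q2.
have E h g u : sqi D u -> sqi D g ->
   (forall x, 0 <= x <= L -> h x = h 0 + prim g x) ->
   ip D u h = h 0 * prim u L + ip D u (prim g).
  move=> hu hg H.
  have -> : ip D u h = ip D u (fun x => h 0 + prim g x).
    apply: eq_Rintegral => x; rewrite inE /dom /= in_itv /= => /andP[x0 xL].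
    by rewrite H// !ltW.
  rewrite ipC ipD//; last 2 first.
    exact: sqi_cst.
    exact: sqi_prim.
  rewrite (ipC _ (prim g)) prim_dom; congr (_ + _).
  rewrite -(ipC _ (fun=> 1)) -ipZ//; last exact: sqi_cst.
  by apply: eq_Rintegral => x _; rewrite mulr1.
have C u v : sqi D u -> ip D u (prim v) =
   \int[leb]_x ((u \_ D) x * \int[leb]_(y in `]-oo, x[) (v \_ D) y).
  move=> hu; rewrite /ip Rintegral_mkcond; apply: eq_Rintegral => x _.
  rewrite !patchE; case: ifPn => [|_]; last by rewrite mul0r.
  rewrite inE /dom /= in_itv /= => /andP[x0 xL].
  by rewrite prim_restr// ltW.
have P u : sqi D u -> \int[leb]_x (u \_ D) x = prim u L.
  by move=> hu; rewrite /prim [RHS]Rintegral_mkcond.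
have F := fubini_half_plane (sqi_restr q1) (sqi_restr q2).
rewrite -C// -C// !P// in F.
rewrite (ipC D h1) (E h2 g2)// (E h1 g1)// (H1 L)// (H2 L)//.
by rewrite [X in X - _]mulrDl !mulrDr -F; ring.
Qed.

End AbsolutelyContinuous.
#[global] Hint Resolve measurable_dom : core.

(** * Weak derivatives *)

Section Tent.
Context {R : realType}.

(** The positive part of a real number. *)
Definition pos_part (z : R) : R := Num.max 0 z.

Lemma is_derive_pos_part_sq (z : R) :
  is_derive z 1 (fun z => pos_part z ^+ 2) (2 * pos_part z).
Proof.
have bnd h : 0 <= pos_part (z + h) ^+ 2 - pos_part z ^+ 2 - h * (2 * pos_part z) <= h ^+ 2.
  rewrite /pos_part; case: (leP 0 (z + h)) => zh; case: (leP 0 z) => z0.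
  - apply/andP; split; rewrite -subr_ge0.
      by rewrite (_ : _ - _ = h ^+ 2) ?sqr_ge0//; ring.
    by rewrite (_ : _ - _ = 0)//; ring.
  - apply/andP; split.
      by rewrite expr0n /= mulr0 mulr0 !subr0 sqr_ge0.
    rewrite expr0n /= !mulr0 !subr0 -subr_ge0.
    rewrite (_ : _ - _ = (- z) * ((z + h) + h)); last by ring.
    by rewrite mulr_ge0 ?oppr_ge0 ?ltW//; lra.
  - apply/andP; split.
      rewrite expr0n /= sub0r (_ : _ - _ = z * ((- (z + h)) + (- h))); last by ring.
      by rewrite mulr_ge0//; lra.
    rewrite expr0n /= sub0r -subr_ge0 (_ : _ - _ = (z + h) ^+ 2) ?sqr_ge0//; ring.
  - by rewrite expr0n /= !mulr0 !subr0 lexx sqr_ge0.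
have H : h^-1 *: (pos_part (h *: 1 + z) ^+ 2 - pos_part z ^+ 2) @[h --> (0:R)^'] -->
    2 * pos_part z.
  apply/cvgrPdist_le => /= e e0; near=> h.
  have h0 : h != 0 by near: h; exact: nbhs_dnbhs_neq.
  have he : `|h| < e by near: h; exact: dnbhs0_lt.
  rewrite [h%:A]mulr1 (addrC h) -[_ *: _]/(h^-1 * _) distrC.
  have -> : h^-1 * (pos_part (z + h) ^+ 2 - pos_part z ^+ 2) - 2 * pos_part z =
    h^-1 * (pos_part (z + h) ^+ 2 - pos_part z ^+ 2 - h * (2 * pos_part z)) by field.
  rewrite normrM normfV ler_pdivrMl ?normr_gt0//.
  have /andP[b1 b2] := bnd h.
  rewrite ger0_norm// (le_trans b2)// -real_normK ?num_real// expr2.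
  by rewrite ler_wpM2l// ltW.
by apply: DeriveDef; [apply/cvg_ex; eexists; exact: H|exact/cvg_lim].
Unshelve. all: by end_near. Qed.

(** The tent function supported on [-1, 1] and its primitive, a C^1 step. *)
Definition tent (z : R) : R :=
  pos_part (z + 1) - 2 * pos_part z + pos_part (z - 1).
Definition step (z : R) : R :=
  2^-1 * (pos_part (z + 1) ^+ 2 - 2 * pos_part z ^+ 2 + pos_part (z - 1) ^+ 2).

Lemma tent_bound z : 0 <= tent z <= 1.
Proof.
rewrite /tent /pos_part.
by case: (leP 0 (z + 1)); case: (leP 0 z); case: (leP 0 (z - 1)); move=> *; lra.
Qed.

Lemma tent_out z : 1 <= `|z| -> tent z = 0.
Proof.
rewrite ler_normr /tent /pos_part => /orP h.
by case: (leP 0 (z + 1)); case: (leP 0 z); case: (leP 0 (z - 1)); move=> *; lra.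
Qed.

Lemma step_left z : z <= -1 -> step z = 0.
Proof.
move=> z1; rewrite /step /pos_part !max_l; lra.
Qed.

Lemma step_right z : 1 <= z -> step z = 1.
Proof.
move=> z1; rewrite /step /pos_part !max_r; lra.
Qed.

Lemma continuous_pos_part : continuous pos_part.
Proof.
move=> z; apply: continuous_max; [exact: cvg_cst|exact: cvg_id].
Qed.

(** The tent of mass 1 supported on [x - e, x + e], and its primitive. *)
Definition tent_at (x e z : R) : R := e^-1 * tent (e^-1 * (z - x)).
Definition step_at (x e z : R) : R := step (e^-1 * (z - x)).

Lemma is_derive_affine (a b z : R) : is_derive z 1 (fun z => a * (z + b)) a.
Proof.
have := is_deriveZ a (is_deriveD (is_derive_id z (1 : R)) (is_derive_cst b z 1)).
by rewrite addr0 [a *: 1]mulr1; exact.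
Qed.

Lemma is_derive_step (z : R) : is_derive z 1 step (tent z).
Proof.
have d1 (b : R) : is_derive z 1 (fun z => pos_part (z + b) ^+ 2) (2 * pos_part (z + b)).
  have ds : is_derive z 1 (fun z => z + b) 1.
    by have := is_derive_affine 1 b z; under eq_fun do rewrite mul1r.
  rewrite -[X in is_derive _ _ _ X]mulr1.
  exact: (@is_derive1_comp _ (fun z => pos_part z ^+ 2) (fun z => z + b) z _ _
    (is_derive_pos_part_sq (z + b)) ds).
have := is_deriveZ 2^-1 (is_deriveD (is_deriveD (d1 1)
  (is_deriveZ (-2) (is_derive_pos_part_sq z))) (d1 (-1))).
set F := (F in is_derive _ _ F _); set d := (d in is_derive _ _ _ d -> _).
have -> : F = step.
  apply/funext => s; rewrite /F /step !fctE /= /GRing.scale /=; ring.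
suff -> : d = tent z by [].
by rewrite /d /tent /GRing.scale /=; field.
Qed.

Lemma is_derive_step_at (x e z : R) : is_derive z 1 (step_at x e) (tent_at x e z).
Proof.
rewrite /tent_at mulrC.
exact: (@is_derive1_comp _ step (fun z => e^-1 * (z - x)) z _ _
  (is_derive_step _) (is_derive_affine e^-1 (- x) z)).
Qed.

Lemma continuous_tent_at x e : continuous (tent_at x e).
Proof.
have ca (b : R) : continuous (fun z : R => z + b).
  by move=> z; apply: cvgD; [exact: cvg_id|exact: cvg_cst].
have ct : continuous tent.
  move=> z; apply: cvgD; first apply: cvgB.
  - by apply: (continuous_comp (ca 1 z)); exact: continuous_pos_part.
  - by apply: cvgM; [exact: cvg_cst|exact: continuous_pos_part].
  - by apply: (continuous_comp (ca (-1) z)); exact: continuous_pos_part.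
move=> z; apply: cvgM; first exact: cvg_cst.
apply: (continuous_comp (f := fun z => e^-1 * (z - x))); last exact: ct.
by apply: cvgM; [exact: cvg_cst|exact: ca].
Qed.

End Tent.

Section WeakDerivatives.
Context {R : realType}.
Local Notation leb := (@lebesgue_measure R).
Implicit Types f g h u v w phi : R -> R.
Variable L : R.
Hypothesis L0 : 0 < L.
Local Notation D := (dom L).
Let mD : measurable D := measurable_dom L.

Lemma sqi_continuous f : continuous f -> sqi D f.
Proof.
move=> cf; have c2 : continuous (fun x => f x ^+ 2).
  by move=> x; under eq_fun do rewrite expr2; apply: cvgM; exact: cf.
split; first by apply: measurable_funTS; exact: continuous_measurable_fun.
apply: (@integrableS _ _ _ leb `[0, L]) => //.
  exact: subset_itv_oo_cc.
apply: continuous_compact_integrable; first exact: segment_compact.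
exact: continuous_subspaceT.
Qed.

Lemma C1_ac F f : (forall x : R, is_derive x 1 F (f x)) -> continuous f -> ac L F f.
Proof.
move=> dF cf; split; first exact: sqi_continuous.
move=> x /andP[+ xL]; rewrite le_eqVlt => /predU1P[<-|x0].
  by rewrite prim0 addr0.
have cF : continuous F.
  move=> y; apply: differentiable_continuous; apply/derivable1_diffP.
  by case: (dF y).
have H : (\int[leb]_(y in `[0%R, x]) (f y)%:E = (F x)%:E - (F 0)%:E)%E.
  apply: continuous_FTC2 => //; first exact: continuous_subspaceT.
  - split.
    + by move=> y _; case: (dF y).
    + by apply: cvg_at_right_filter; exact: cF.
    + by apply: cvg_at_left_filter; exact: cF.
  - by move=> y _; rewrite derive1E; case: (dF y).
have ii : leb.-integrable `[0, x] (EFin \o f).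
  apply: continuous_compact_integrable; first exact: segment_compact.
  exact: continuous_subspaceT.
rewrite /prim Rintegral_itv_bndo_bndc; last first.
  by apply: integrableS ii => //; exact: subset_itv_oo_cc.
rewrite Rintegral_itv_obnd_cbnd; last first.
  by apply: integrableS ii => //; exact: subset_itv_oc_cc.
by rewrite /Rintegral H /=; ring.
Qed.

Lemma test_function_ac phi : test_function L phi -> ac L phi (derive1 phi).
Proof.
move=> [dphi cphi _]; apply: C1_ac => // x.
by apply: DeriveDef; [exact: dphi|rewrite derive1E].
Qed.

Lemma test_function_bnd phi : test_function L phi -> phi 0 = 0 /\ phi L = 0.
Proof.
move=> [_ _ [a [b [a0 bL ab]]]]; split; apply/eqP.
- have [//|/ab] := eqVneq (phi 0) 0; lra.
- have [//|/ab] := eqVneq (phi L) 0; lra.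
Qed.

(** [g] is the weak derivative on (0, L) of the real function [f]. *)
Definition wd f g : Prop :=
  [/\ sqi D f, sqi D g &
    forall phi, test_function L phi -> ip D (derive1 phi) f = - ip D phi g].

Lemma wd_ac h g : ac L h g -> wd h g.
Proof.
move=> hg; split; [exact: sqi_ac hg|by case: hg|].
move=> phi tphi; have := ac_by_parts L0 (test_function_ac tphi) hg.
have [-> ->] := test_function_bnd tphi.
by rewrite !mul0r subrr => /eqP; rewrite addr_eq0 => /eqP.
Qed.

Lemma tent_at_mass (x e : R) : 0 < e -> e < x -> x + e < L ->
  \int[leb]_(z in D) tent_at x e z = 1.
Proof.
move=> e0 ex xeL.
have [_ /(_ L)] := C1_ac (is_derive_step_at x e) (@continuous_tent_at _ x e).
rewrite lexx ltW// => /(_ isT).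
rewrite /step_at step_right; last first.
  by rewrite ler_pdivlMl// mulr1; lra.
rewrite step_left; last first.
  by rewrite ler_pdivrMl//; lra.
by rewrite add0r => ->.
Qed.

Lemma sqi_tent_at (x e : R) : sqi D (tent_at x e).
Proof. by apply: sqi_continuous; exact: continuous_tent_at. Qed.

(** The average of [w] against a narrow tent is close to the value of [w] at a
    Lebesgue point. *)
Lemma tent_average w (x e d : R) : sqi D w -> 0 < e -> e < x -> x + e < L ->
  (davg (w \_ D) x e < d%:E)%E ->
  `|ip D (tent_at x e) w - w x| <= 2 * d.
Proof.
move=> hw e0 ex xeL; rewrite /davg /iavg (lebesgue_measure_ball _ (ltW e0)).
set I := (\int[_]_(y in _) _)%E => avg.
have wx : (w \_ D) x = w x.
  by rewrite patchE ifT// inE /dom /= in_itv/=; apply/andP; split; lra.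
have subD : ball x e `<=` D.
  by rewrite ball_itv /dom => y /=; rewrite !in_itv/= => /andP[? ?]; lra.
have iw : leb.-integrable (ball x e) (EFin \o (fun y => w y - w x)).
  apply: (@integrableS _ _ _ leb D) => //; first exact: measurable_ball.
  by apply: (sqi_integrable L0); apply: sqiB => //; exact: sqi_cst.
have IE : I = (\int[leb]_(y in ball x e) `|w y - w x|)%:E.
  rewrite /Rintegral fineK; last first.
    apply: integrable_fin_num; first exact: measurable_ball.
    exact: (integrable_norm iw).
  apply: eq_integral => y /[1!inE] By /=; rewrite wx /shift patchE ifT//.
  by rewrite inE; exact: subD.
have sw : sqi D (fun y => w y - w x) by apply: sqiB => //; exact: sqi_cst.
have st := sqi_tent_at x e.
have hx : ip D (tent_at x e) w - w x = ip D (tent_at x e) (fun y => w y - w x).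
  rewrite [in RHS]/ip; under [RHS]eq_Rintegral do rewrite mulrBr.
  rewrite RintegralB//; [|exact: sqi_intM|].
    rewrite RintegralZr//; last exact: (sqi_integrable L0).
    by rewrite tent_at_mass// mul1r.
  exact: (sqi_intM mD st (sqi_cst L0 (w x))).
rewrite hx /ip.
apply: le_trans.
  apply: le_normr_Rintegral => //; exact: (sqi_intM mD st sw).
apply: (@le_trans _ _ (\int[leb]_(y in ball x e) (e^-1 * `|w y - w x|))).
  rewrite [leRHS](_ : _ = \int[leb]_(y in D `&` ball x e) (e^-1 * `|w y - w x|)); last first.
    by rewrite setIidr.
  rewrite Rintegral_mkcondr; apply: le_Rintegral => //.
  - exact: (integrable_norm (sqi_intM mD st sw)).
  - rewrite -restrict_EFin; apply/integrable_restrict => //; first exact: measurable_ball.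
    rewrite setIidr//.
    rewrite (_ : _ \o _ = fun y => (e^-1%:E * (EFin \o (fun y => `|w y - w x|%R)) y)%E)//.
    apply: integrableZl; first exact: measurable_ball.
    exact: (integrable_norm iw).
  - move=> y Dy; rewrite patchE; case: ifPn => By.
      rewrite normrM ler_wpM2r// /tent_at normrM ger0_norm ?invr_ge0 ?(ltW e0)//.
      rewrite -[leRHS]mulr1 ler_wpM2l ?invr_ge0 ?(ltW e0)//.
      have /andP[t0 t1] := tent_bound (e^-1 * (y - x)).
      by rewrite ger0_norm.
    rewrite /tent_at tent_out ?mulr0 ?mul0r ?normr0//.
    rewrite normrM ger0_norm ?invr_ge0 ?(ltW e0)// ler_pdivlMl// mulr1 leNgt.
    apply/negP => lt; case/negP: By; rewrite inE /ball /= distrC//.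
rewrite RintegralZl//; [|exact: measurable_ball|exact: (integrable_norm iw)].
move: avg; rewrite IE inver gt_eqF; last by rewrite pmulrn_lgt0.
rewrite -EFinM lte_fin => avg; rewrite ler_pdivrMl//.
move: avg; rewrite ltr_pdivrMl ?pmulrn_lgt0// => /ltW /le_trans; apply.
by rewrite -mulr_natr; lra.
Qed.

End WeakDerivatives.

Section DuBoisReymond.
Context {R : realType}.
Local Notation leb := (@lebesgue_measure R).
Implicit Types f g h u v w phi : R -> R.
Variable L : R.
Hypothesis L0 : 0 < L.
Local Notation D := (dom L).
Let mD : measurable D := measurable_dom L.

Lemma davg_lt w (x d : R) : 0 < d -> lebesgue_pt w x ->
  \forall e \near (0:R)^'+, (davg w x e < d%:E)%E.
Proof.
move=> d0 lx; have : nbhs 0%E [set y : \bar R | (y < d%:E)%E].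
  by apply: open_nbhs_nbhs; split; [exact: open_ereal_lt_ereal|rewrite /= lte_fin].
by move=> /lx.
Qed.

Lemma test_function_step (x y e : R) : 0 < e -> e < x -> x + e < L ->
  e < y -> y + e < L ->
  test_function L (fun z => step_at x e z - step_at y e z) /\
  derive1 (fun z => step_at x e z - step_at y e z) =
    (fun z => tent_at x e z - tent_at y e z).
Proof.
move=> e0 ex xeL ey yeL.
have dd (z : R) : is_derive z 1 (fun z => step_at x e z - step_at y e z)
    (tent_at x e z - tent_at y e z).
  exact: (is_deriveB (is_derive_step_at x e z) (is_derive_step_at y e z)).
have d1 : derive1 (fun z => step_at x e z - step_at y e z) =
    (fun z => tent_at x e z - tent_at y e z).
  by apply/funext => z; rewrite derive1E; case: (dd z).
split => //; split.
- by move=> z; case: (dd z).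
- by rewrite d1 => z; apply: cvgB; exact: continuous_tent_at.
- exists (Num.min (x - e) (y - e)), (Num.max (x + e) (y + e)); split.
  + by rewrite lt_min; apply/andP; split; lra.
  + by rewrite gt_max; apply/andP; split; lra.
  + move=> z; apply: contraNT; rewrite negb_and -!ltNge lt_min gt_max.
    case/orP => /andP[h1 h2]; rewrite /step_at.
      by rewrite !step_left ?subrr// ler_pdivrMl//; lra.
    by rewrite !step_right ?subrr// ler_pdivlMl//; lra.
Qed.

(** A function whose weak derivative vanishes is constant: it takes the same
    value at any two Lebesgue points. *)
Lemma du_bois_reymond w : sqi D w ->
  (forall phi, test_function L phi -> ip D (derive1 phi) w = 0) ->
  exists c : R, ae_eq leb D w (fun=> c).
Proof.
move=> hw H.
have loc : locally_integrable setT (w \_ D).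
  by apply: integrable_locally_restrict => //; exact: (sqi_integrable L0).
have LP := lebesgue_differentiation loc.
(* test against the difference of two steps, whose derivative is the
   difference of the averages near x and y *)
have key x y : D x -> D y -> lebesgue_pt (w \_ D) x -> lebesgue_pt (w \_ D) y ->
    w x = w y.
  rewrite /dom /= !in_itv /= => /andP[x0 xL] /andP[y0 yL] lx ly.
  apply/eqP; rewrite -subr_eq0 -normr_le0; apply/ler_addgt0Pr => d d0.
  rewrite add0r; near (0:R)^'+ => e.
  have e0 : 0 < e by near: e; exact: nbhs_right_gt.
  have ex : e < x by near: e; exact: nbhs_right_lt.
  have ey : e < y by near: e; exact: nbhs_right_lt.
  have xeL : x + e < L.
    by rewrite -ltrBrDl; near: e; apply: nbhs_right_lt; rewrite subr_gt0.
  have yeL : y + e < L.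
    by rewrite -ltrBrDl; near: e; apply: nbhs_right_lt; rewrite subr_gt0.
  have ax : (davg (w \_ D) x e < (4^-1 * d)%:E)%E.
    by near: e; apply: davg_lt => //; lra.
  have ay : (davg (w \_ D) y e < (4^-1 * d)%:E)%E.
    by near: e; apply: davg_lt => //; lra.
  have bx := tent_average L0 hw e0 ex xeL ax.
  have b_y := tent_average L0 hw e0 ey yeL ay.
  have [tf td] := test_function_step e0 ex xeL ey yeL.
  have := H _ tf; rewrite td.
  have -> : ip D (fun z => tent_at x e z - tent_at y e z) w =
      ip D (tent_at x e) w - ip D (tent_at y e) w.
    have := ip_lin2 mD 1 (-1) (sqi_tent_at L x e) (sqi_tent_at L y e) hw.
    rewrite mul1r mulN1r => <-; congr (ip D _ w); apply/funext => z.
    by rewrite mul1r mulN1r.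
  move: bx b_y; set p := ip _ _ _; set q := ip _ _ _.
  rewrite !ler_norml => /andP[? ?] /andP[? ?] pq.
  by apply/andP; split; lra.
have [[x0 [Dx0 lx0]]|no] := pselect (exists x, D x /\ lebesgue_pt (w \_ D) x).
  exists (w x0); move: LP; apply: filterS.
    exact: (ae_filter_ringOfSetsType leb).
  by move=> x lx Dx; exact: key.
exists 0; move: LP; apply: filterS; first exact: (ae_filter_ringOfSetsType leb).
by move=> x lx Dx; exfalso; apply: no; exists x.
Unshelve. all: by end_near. Qed.

(** Every weakly differentiable function has an absolutely continuous
    representative. *)
Lemma wd_representative f g : wd L f g ->
  exists h, [/\ ac L h g, ae_eq leb D f h & {within `[0, L], continuous h}].
Proof.
move=> [hf hg H].
have hp := sqi_prim L0 hg.
have acp : ac L (prim g) g by split => // x _; rewrite prim0 add0r.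
have hw := sqiB mD hf hp.
have [phi tphi|c Hc] := du_bois_reymond hw.
  have [_ _ W] := wd_ac L0 acp.
  have [q _] := test_function_ac tphi.
  have := ip_lin2r mD 1 (-1) hf hp q.
  rewrite H// W// mul1r mulN1r subrr => <-; congr (ip D _ _); apply/funext => z.
  by rewrite mul1r mulN1r.
have ach : ac L (fun x => c + prim g x) g.
  by split => // x _; rewrite prim0 addr0.
exists (fun x => c + prim g x); split => //; last exact: ac_continuous ach.
by apply: filterS Hc => x /[apply]; lra.
Qed.

(** Square integrable functions with vanishing primitive vanish. *)
Lemma prim_eq0 u : sqi D u -> (forall x, D x -> prim u x = 0) ->
  ae_eq leb D u (fun=> 0).
Proof.
move=> hu H; have iu := sqi_restr L0 hu.
have loc : locally_integrable setT (u \_ D).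
  by apply: integrable_locally_restrict => //; exact: (sqi_integrable L0).
have ii (y : R) : leb.-integrable `]0, y] (EFin \o (u \_ D)).
  by apply: integrableS iu.
have := FTC1 ii loc; apply: filterS; first exact: (ae_filter_ringOfSetsType leb).
move=> x Hx Dx.
move: (Dx); rewrite /dom /= in_itv /= => /andP[x0 xL].
have [_] := Hx x0.
have -> : (u \_ D) x = u x by rewrite patchE ifT// inE.
move=> <-; rewrite derive1E.
rewrite (@near_eq_derive _ _ _ _ (cst 0)) ?oner_eq0 ?derive_cst//.
have : \forall y \near x, D y by apply: near_in_itvoo; rewrite in_itv /= x0.
apply: filterS => y Dy; move: (Dy); rewrite /dom /= in_itv /= => /andP[y0 yL].
rewrite -[RHS](H y)// /prim -Rintegral_itv_bndo_bndc; last exact: integrableS iu.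
apply: eq_Rintegral => z; rewrite inE /= in_itv /= => /andP[z0 zy].
by rewrite patchE ifT// inE /dom /= in_itv /= z0 (lt_trans zy).
Qed.

(** Continuous functions on [0, L] that agree almost everywhere agree. *)
Lemma continuous_ae_eq h1 h2 :
  {within `[0, L], continuous h1} -> {within `[0, L], continuous h2} ->
  ae_eq leb D h1 h2 -> forall x, 0 <= x <= L -> h1 x = h2 x.
Proof.
move=> /(continuous_within_itvP _ L0)[i1 l1 r1].
move=> /(continuous_within_itvP _ L0)[i2 l2 r2] [N [mN N0 subN]].
have E x : D x -> h1 x = h2 x.
  move=> Dx; apply/eqP; apply: contraT => ne.
  have xD : x \in `]0, L[ by exact: Dx.
  have c12 : {for x, continuous (fun y => h1 y - h2 y)}.
    by apply: cvgB; [exact: i1|exact: i2].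
  have nz : \forall y \near x, h1 y - h2 y != 0.
    by apply: (cvgr_neq0 _ c12); rewrite /= subr_eq0.
  have nD : \forall y \near x, D y by exact: near_in_itvoo xD.
  have /nbhs_ballP[r /= r0 sub] : \forall y \near x, h1 y - h2 y != 0 /\ D y.
    by near=> y; split; near: y.
  have sB : ball x r `<=` N.
    move=> y /sub[+ Dy]; rewrite subr_eq0 => /eqP ny; apply: subN => /= H.
    exact: ny (H Dy).
  have : (leb (ball x r) <= leb N)%E.
    by apply: le_measure => //; rewrite inE//; exact: measurable_ball.
  rewrite (lebesgue_measure_ball _ (ltW r0)) N0 lee_fin.
  by rewrite leNgt pmulrn_lgt0// r0.
move=> x /andP[]; rewrite le_eqVlt => /predU1P[<- _|x0].
  apply: (@cvg_unique _ _ (h2 x @[x --> 0^'+])) => //.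
  move: l1; apply: cvg_trans; apply: near_eq_cvg.
  near=> y; apply: E; rewrite /dom /= in_itv /=; apply/andP; split.
    by near: y; exact: nbhs_right_gt.
  by near: y; exact: nbhs_right_lt.
rewrite le_eqVlt => /predU1P[->|xL]; last first.
  by apply: E; rewrite /dom /= in_itv /= x0.
apply: (@cvg_unique _ _ (h2 x @[x --> L^'-])) => //.
move: r1; apply: cvg_trans; apply: near_eq_cvg.
near=> y; apply: E; rewrite /dom /= in_itv /=; apply/andP; split.
  by near: y; exact: nbhs_left_gt.
by near: y; exact: nbhs_left_lt.
Unshelve. all: by end_near. Qed.

Lemma wd_unique f g1 g2 : wd L f g1 -> wd L f g2 -> ae_eq leb D g1 g2.
Proof.
move=> w1 w2; have [h1 [a1 e1 c1]] := wd_representative w1.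
have [h2 [a2 e2 c2]] := wd_representative w2.
have e12 : ae_eq leb D h1 h2.
  by apply: filterS2 e1 e2 => x H1 H2 Dx; rewrite -H1// -H2.
have E := continuous_ae_eq c1 c2 e12.
move: w1 w2 => [_ s1 _] [_ s2 _].
have : ae_eq leb D (fun x => 1 * g1 x + (-1) * g2 x) (fun=> 0).
  apply: prim_eq0; first exact: sqi_lin2.
  move=> x; rewrite /dom /= in_itv /= => /andP[x0 xL].
  rewrite (prim_lin2 L0 _ _ (ltW xL))//.
  have xi : 0 <= x <= L by rewrite !ltW.
  have := a1.2 x xi; have := a2.2 x xi.
  by rewrite (E x xi) (E 0) ?lexx ?ltW//; lra.
by apply: filterS => x /[apply]; lra.
Qed.

End DuBoisReymond.

(** * The diffusive weight *)

Section DiffusiveWeight.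
Context {R : realType}.
Local Notation leb := (@lebesgue_measure R).

Lemma continuous_within_gt0 (f : R -> R) (s t : R) : 0 < s ->
  (forall x : R, 0 < x -> {for x, continuous f}) ->
  {within `[s, t], continuous f}.
Proof.
move=> s0 cf; apply: continuous_in_subspaceT => x; rewrite inE /= in_itv /=.
by move=> /andP[sx _]; apply: cf; exact: lt_le_trans sx.
Qed.

Lemma continuous_powR (q x : R) : 0 < x -> {for x, continuous (fun x => x `^ q)}.
Proof.
move=> x0; apply: differentiable_continuous; apply/derivable1_diffP.
by case: (is_derive1_powR q x0).
Qed.

Lemma integral_powR (q s t : R) : q != 0 -> 0 < s -> s < t ->
  (\int[leb]_(x in `[s, t]) (x `^ (q - 1))%:E = ((t `^ q - s `^ q) / q)%:E)%E.
Proof.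
move=> q0 s0 st.
have dF (x : R) : 0 < x -> is_derive x 1 (fun x => q^-1 * x `^ q) (x `^ (q - 1)).
  move=> x0; have := is_deriveZ q^-1 (is_derive1_powR q x0).
  by rewrite [_ *: _]mulrA mulVf// mul1r.
have cF (x : R) : 0 < x -> {for x, continuous (fun x => q^-1 * x `^ q)}.
  move=> x0; apply: differentiable_continuous; apply/derivable1_diffP.
  by case: (dF x x0).
rewrite (@continuous_FTC2 _ _ (fun x => q^-1 * x `^ q))//.
- by rewrite -EFinB; congr (_%:E); ring.
- by apply: continuous_within_gt0 => // x; exact: continuous_powR.
- split.
  + move=> x; rewrite in_itv /= => /andP[sx _].
    by case: (dF x (lt_trans s0 sx)).
  + by apply: cvg_at_right_filter; exact: cF.
  + by apply: cvg_at_left_filter; apply: cF; exact: lt_trans st.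
- move=> x; rewrite in_itv /= => /andP[sx _]; rewrite derive1E.
  by case: (dF x (lt_trans s0 sx)).
Qed.

(** |x|^(p - 1) / (x^2 + e), that is, varpi(x)^2 / (x^2 + e) for p = 2 a. *)
Definition weight_sq (p e x : R) : R := `|x| `^ (p - 1) / (x ^+ 2 + e).

Variables p e : R.
Hypotheses (p0 : 0 < p) (p2 : p < 2) (e0 : 0 < e).

Lemma sqr_add_gt0 (x : R) : 0 < x ^+ 2 + e.
Proof. by rewrite ltr_wpDl// sqr_ge0. Qed.

Lemma weight_sq_ge0 x : 0 <= weight_sq p e x.
Proof. by rewrite divr_ge0 ?powR_ge0// ltW// sqr_add_gt0. Qed.

Lemma weight_sqN x : weight_sq p e (- x) = weight_sq p e x.
Proof. by rewrite /weight_sq normrN sqrrN. Qed.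

Lemma continuous_weight_sq (x : R) : x != 0 -> {for x, continuous (weight_sq p e)}.
Proof.
move=> x0; apply: cvgM.
  apply: (@continuous_comp _ _ _ (fun x : R => `|x|) (fun x => x `^ (p - 1)) x).
    exact: norm_continuous.
  by apply: continuous_powR; rewrite normr_gt0.
apply: cvgV; first by rewrite gt_eqF// sqr_add_gt0.
apply: cvgD; last exact: cvg_cst.
by under eq_fun do rewrite expr2; apply: cvgM; exact: cvg_id.
Qed.

Lemma measurable_weight_sq : measurable_fun setT (weight_sq p e).
Proof.
apply: measurable_funM.
  apply: (measurableT_comp (measurable_powR (p - 1))).
  by apply: continuous_measurable_fun; exact: norm_continuous.
have cx : continuous (fun x : R => (x ^+ 2 + e)^-1).
  move=> x; apply: cvgV; first by rewrite gt_eqF// sqr_add_gt0.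
  apply: cvgD; last exact: cvg_cst.
  by under eq_fun do rewrite expr2; apply: cvgM; exact: cvg_id.
exact: continuous_measurable_fun.
Qed.

Lemma weight_sq_le_small x : 0 < x -> weight_sq p e x <= e^-1 * x `^ (p - 1).
Proof.
move=> x0; rewrite /weight_sq gtr0_norm// mulrC ler_wpM2r ?powR_ge0//.
by rewrite lef_pV2 ?posrE ?sqr_add_gt0// lerDr sqr_ge0.
Qed.

Lemma weight_sq_le_large x : 0 < x -> weight_sq p e x <= x `^ (p - 2 - 1).
Proof.
move=> x0; rewrite /weight_sq gtr0_norm//.
have -> : x `^ (p - 2 - 1) = x `^ (p - 1) * (x ^+ 2)^-1.
  rewrite -powR_mulrn ?ltW// -powRN -powRD.
    by congr (_ `^ _); ring.
  by rewrite (gt_eqF x0) implybT.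
rewrite ler_wpM2l ?powR_ge0// lef_pV2 ?posrE ?sqr_add_gt0 ?exprn_gt0//.
by rewrite lerDl ltW.
Qed.

(** A bound for the integral of the weight over (0, oo): the two terms bound
    the integrals over (0, 1) and (1, oo). *)
Definition weight_bound : R := e^-1 * p^-1 + (2 - p)^-1.

(** The integral over [s, t] is bounded uniformly in s and t. *)
Lemma integral_weight_sq_pos (s t : R) : 0 < s -> s < 1 -> 1 < t ->
  (\int[leb]_(x in `[s, t]) (weight_sq p e x)%:E <= weight_bound%:E)%E.
Proof.
move=> s0 s1 t1.
have mw A : measurable A -> measurable_fun A (EFin \o weight_sq p e).
  move=> mA; apply/measurable_EFinP; apply: measurable_funTS.
  exact: measurable_weight_sq.
have mp q A : measurable A -> measurable_fun A (EFin \o (fun x : R => x `^ q)).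
  move=> mA; apply/measurable_EFinP; apply: measurable_funTS.
  exact: measurable_powR.
rewrite (@itv_bndbnd_setU _ _ _ (BRight 1)) ?bnd_simp ?(ltW s1) ?(ltW t1)//.
rewrite ge0_integral_setU//=; last 3 first.
- by apply: mw; exact: measurableU.
- by move=> x _; rewrite lee_fin weight_sq_ge0.
- apply/disj_setPS => x [/=]; rewrite !in_itv/= => /andP[_ h] /andP[h' _].
  by move: h'; rewrite ltNge h.
rewrite EFinD; apply: leeD.
  apply: (@le_trans _ _ (\int[leb]_(x in `[s, 1%R]) (e^-1%:E * (x `^ (p - 1))%:E))%E).
    apply: ge0_le_integral => //.
    - by move=> x _; rewrite lee_fin weight_sq_ge0.
    - exact: mw.
    - by apply: measurable_funeM; exact: mp.
    - move=> x; rewrite /= in_itv /= => /andP[sx _].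
      by rewrite -EFinM lee_fin weight_sq_le_small// (lt_le_trans s0).
  rewrite ge0_integralZl//; last 3 first.
  - exact: mp.
  - by move=> x _; rewrite lee_fin powR_ge0.
  - by rewrite lee_fin invr_ge0 ltW.
  rewrite integral_powR ?gt_eqF// -EFinM lee_fin ler_wpM2l ?invr_ge0 ?(ltW e0)//.
  by rewrite powR1 ler_pdivrMr// mulVf ?gt_eqF// gerBl powR_ge0.
apply: (@le_trans _ _ (\int[leb]_(x in `]1%R, t]) (x `^ (p - 2 - 1))%:E)%E).
  apply: ge0_le_integral => //.
  - by move=> x _; rewrite lee_fin weight_sq_ge0.
  - exact: mw.
  - exact: mp.
  - move=> x; rewrite /= in_itv /= => /andP[sx _].
    by rewrite lee_fin weight_sq_le_large// (lt_trans ltr01).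
have q0 : p - 2 != 0 by rewrite lt_eqF// subr_lt0.
rewrite integral_itv_obnd_cbnd; last exact: mp.
rewrite integral_powR// lee_fin powR1.
have -> : (t `^ (p - 2) - 1) / (p - 2) = (1 - t `^ (p - 2)) / (2 - p).
  by field; rewrite q0 -opprB oppr_eq0 q0.
rewrite ler_pdivrMr ?subr_gt0// mulVf ?gerBl ?powR_ge0//.
by rewrite gt_eqF// subr_gt0.
Qed.

(** At 0 the weight is of order x^(p - 1), at infinity of order x^(p - 3). *)
Lemma integrable_weight_sq : leb.-integrable setT (EFin \o weight_sq p e).
Proof.
have mw A : measurable A -> measurable_fun A (EFin \o weight_sq p e).
  move=> mA; apply/measurable_EFinP; apply: measurable_funTS.
  exact: measurable_weight_sq.
apply/integrableP; split; first exact: mw.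
under eq_integral do rewrite /= ger0_norm ?weight_sq_ge0//.
(* exhaust R minus 0 by 1/(n + 2) <= |x| <= n + 2 *)
pose s n : R := n.+2%:R^-1; pose t n : R := n.+2%:R.
pose F n : set R := `[- t n, - s n] `|` `[s n, t n].
have s0 n : 0 < s n by rewrite invr_gt0.
have t1 n : 1 < t n by rewrite ltr1n.
have s1 n : s n < 1 by rewrite invf_lt1// t1.
have FE n x : F n x <-> s n <= `|x| <= t n.
  rewrite /F /= !in_itv /=; have := s0 n; have := s1 n; have := t1 n => ? ? ?.
  case: (ger0P x) => x0; split.
  - by case=> /andP[? ?]; apply/andP; split; lra.
  - by right.
  - by case=> /andP[? ?]; apply/andP; split; lra.
  - by move=> /andP[? ?]; left; apply/andP; split; lra.
have mF n : measurable (F n) by apply: measurableU; exact: measurable_itv.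
have ndF : nondecreasing_seq F.
  move=> n m nm; apply/subsetPset => x /FE /andP[a b]; apply/FE/andP; split.
    by apply: le_trans a; rewrite lef_pV2 ?posrE// ler_nat !ltnS.
  by apply: (le_trans b); rewrite ler_nat !ltnS.
have bF n : (\int[leb]_(x in F n) (weight_sq p e x)%:E <=
    (weight_bound + weight_bound)%:E)%E.
  rewrite ge0_integral_setU//=; last 3 first.
  - exact: (mw _ (mF n)).
  - by move=> x _; rewrite lee_fin weight_sq_ge0.
  - apply/disj_setPS => x [/=]; rewrite !in_itv/= => /andP[_ h] /andP[h' _].
    by have := s0 n; lra.
  rewrite EFinD; apply: leeD; last exact: integral_weight_sq_pos.
  rewrite integration_by_substitution_oppr; last 2 first.
  - by have := s1 n; have := t1 n; lra.
  - apply: continuous_in_subspaceT => x; rewrite inE /= in_itv /= => /andP[_ xs].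
    apply: continuous_weight_sq; rewrite lt_eqF//.
    by have := s0 n; lra.
  under eq_integral do rewrite /= weight_sqN.
  exact: integral_weight_sq_pos.
have lim : (\int[leb]_(x in F n) (weight_sq p e x)%:E)%E @[n --> \oo] -->
    (\int[leb]_(x in \bigcup_n F n) (weight_sq p e x)%:E)%E.
  apply: ge0_nondecreasing_set_cvg_integral => //.
    by move=> n; exact: (mw _ (mF n)).
  by move=> n x _; rewrite lee_fin weight_sq_ge0.
have cup : (\int[leb]_(x in \bigcup_n F n) (weight_sq p e x)%:E <=
    (weight_bound + weight_bound)%:E)%E.
  by apply: cvge_to_le lim _; near=> n; exact: bF.
have -> : [set: R] = \bigcup_n F n `|` [set 0].
  apply/seteqP; split => // x _; have [->|x0] := eqVneq x 0; first by right.
  left; near \oo => n.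
  have : `|x| + `|x|^-1 <= n%:R by near: n; exact: nbhs_infty_ger.
  have xp : 0 < `|x| by rewrite normr_gt0.
  have xip : 0 < `|x|^-1 by rewrite invr_gt0.
  have : n%:R <= t n by rewrite ler_nat; exact: leqW (leqnSn _).
  move=> h1 h2; exists n => //; apply/FE/andP; split; last by lra.
  by rewrite /s invf_ple ?posrE// -/(t n); lra.
have mU : measurable (\bigcup_n F n) by exact: bigcup_measurable.
rewrite ge0_integral_setU//=; last 3 first.
- by apply: (mw (\bigcup_n F n `|` [set 0])); exact: measurableU.
- by move=> x _; rewrite lee_fin weight_sq_ge0.
- apply/disj_setPS => x [[n _ /FE /andP[h _]] /= x0].
  by move: h; rewrite x0 normr0 leNgt s0.
by rewrite integral_set1 adde0; apply: le_lt_trans cup _; rewrite ltry.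
Unshelve. all: by end_near. Qed.

End DiffusiveWeight.

(** * Testing the equations *)

(** The real (or imaginary) parts of a state, of its space derivatives and of
    its time derivative, at a given time. *)
Record snapshot (R : realType) := Snapshot {
  sV : R -> R; sVx : R -> R; sVxx : R -> R;
  sf : R -> R; sfx : R -> R; sft : R -> R;
  sP : R -> R; sPx : R -> R; sPxx : R -> R;
  sg : R -> R; sgx : R -> R; sgt : R -> R;
  sth : R -> R; sthx : R -> R; sthxx : R -> R; stht : R -> R;
  sp1 : R -> R; sp1t : R -> R; sp2 : R -> R; sp2t : R -> R }.

Section Snapshots.
Context {R : realType}.
Local Notation leb := (@lebesgue_measure R).
Variable p : params R.
Hypothesis hp : admissible p.
Local Notation L := (len p).
Local Notation D := (dom L).
Implicit Types (s : snapshot R) (h phi : R -> R).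

(** The coefficient of the memory terms. *)
Definition kappa : R := sin (a p * pi) / pi.

(** |xi| phi(xi) *)
Definition weighted phi : R -> R := fun xi => `|xi| * phi xi.

(** The square of the norm of [phi] in L^2 with weight xi^2 + eta. *)
Definition weighted_sq phi : R :=
  ip setT (weighted phi) (weighted phi) + eta p * ip setT phi phi.

(** Regularity in space and boundary conditions. *)
Record regular s : Prop := {
  rV : ac L (sV s) (sVx s); rVx : ac L (sVx s) (sVxx s); rV0 : sV s 0 = 0;
  rf : ac L (sf s) (sfx s); rf0 : sf s 0 = 0; rft : sqi D (sft s);
  rP : ac L (sP s) (sPx s); rPx : ac L (sPx s) (sPxx s); rP0 : sP s 0 = 0;
  rg : ac L (sg s) (sgx s); rg0 : sg s 0 = 0; rgt : sqi D (sgt s);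
  rth : ac L (sth s) (sthx s); rthx : ac L (sthx s) (sthxx s);
  rthx0 : sthx s 0 = 0; rthL : sth s L = 0; rtht : sqi D (stht s);
  rp1 : sqi setT (sp1 s); rwp1 : sqi setT (weighted (sp1 s));
  rp1t : sqi setT (sp1t s);
  rp2 : sqi setT (sp2 s); rwp2 : sqi setT (weighted (sp2 s));
  rp2t : sqi setT (sp2t s);
  rS1 : alpha p * sVx s L - gamma p * beta p * sPx s L =
    - (l1 p * (kappa * ip setT (varpi p) (sp1 s)));
  rS2 : beta p * sPx s L - gamma p * beta p * sVx s L =
    - (l2 p * (kappa * ip setT (varpi p) (sp2 s))) }.

(** The equations of the system. *)
Record solves s : Prop := {
  eV : ae_eq leb D (fun x => rho p * sft s x)
    (fun x => 1 * (alpha p * sVxx s x + (- (gamma p * beta p)) * sPxx s x)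
      + (- delta p) * sthx s x);
  eP : ae_eq leb D (fun x => mu p * sgt s x)
    (fun x => beta p * sPxx s x + (- (gamma p * beta p)) * sVxx s x);
  eth : ae_eq leb D (fun x => c p * stht s x)
    (fun x => k p * sthxx s x + (- delta p) * sfx s x);
  ep1 : ae_eq leb setT (sp1t s)
    (fun xi => - ((xi ^+ 2 + eta p) * sp1 s xi) + sf s L * varpi p xi);
  ep2 : ae_eq leb setT (sp2t s)
    (fun xi => - ((xi ^+ 2 + eta p) * sp2 s xi) + sg s L * varpi p xi) }.

Let L0 : 0 < L. Proof. by case: hp => _ [[]]. Qed.
Let eta0 : 0 < eta p. Proof. by case: hp => _ [_ [[]]]. Qed.
Let mD : measurable D := measurable_dom L.
Let mT : measurable [set: R] := measurableT.

Lemma kappa_gt0 : 0 < kappa.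
Proof.
have [_ [_ [_ [/andP[a0 a1] _]]]] := hp.
rewrite /kappa divr_gt0 ?pi_gt0//; apply: sin_gt0_pi.
by rewrite mulr_gt0 ?pi_gt0//= gtr_pMl ?pi_gt0.
Qed.

Lemma ip_by_parts0 h hx u ux : ac L h hx -> h 0 = 0 -> ac L u ux ->
  ip D ux h = u L * h L - ip D u hx.
Proof.
move=> ah h0 au; have := ac_by_parts L0 au ah.
by rewrite h0 mulr0 subr0 => <-; rewrite addrK.
Qed.

Lemma ip_ae_l u v h : sqi D u -> sqi D v -> sqi D h -> ae_eq leb D u v ->
  ip D u h = ip D v h.
Proof.
by move=> [m1 _] [m2 _] [m3 _] uv; apply: ip_ae => //; exact: ae_eq_refl.
Qed.

(** The equation for V tested against h in H^1 with h(0) = 0. *)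
Lemma test_V s h hx : regular s -> solves s -> ac L h hx -> h 0 = 0 ->
  rho p * ip D (sft s) h =
  (alpha p * sVx s L - gamma p * beta p * sPx s L) * h L
  - alpha p * ip D (sVx s) hx + gamma p * beta p * ip D (sPx s) hx
  - delta p * ip D (sthx s) h.
Proof.
move=> r e ah h0; have sh := sqi_ac L0 ah.
have [_ qV] := rVx r; have qVxx := (rVx r).1; have qPxx := (rPx r).1.
have qthx := (rth r).1; have qft := rft r.
rewrite -ipZ// (ip_ae_l _ _ sh (eV e)); last 2 first.
- exact: sqiZ.
- by apply: sqi_lin2 => //; exact: sqi_lin2.
rewrite !ip_lin2//; last exact: sqi_lin2.
rewrite (ip_by_parts0 ah h0 (rVx r)) (ip_by_parts0 ah h0 (rPx r)).
by ring.
Qed.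

Lemma test_P s h hx : regular s -> solves s -> ac L h hx -> h 0 = 0 ->
  mu p * ip D (sgt s) h =
  (beta p * sPx s L - gamma p * beta p * sVx s L) * h L
  - beta p * ip D (sPx s) hx + gamma p * beta p * ip D (sVx s) hx.
Proof.
move=> r e ah h0; have sh := sqi_ac L0 ah.
have qVxx := (rVx r).1; have qPxx := (rPx r).1; have qgt := rgt r.
rewrite -ipZ// (ip_ae_l _ _ sh (eP e)); last 2 first.
- exact: sqiZ.
- exact: sqi_lin2.
rewrite !ip_lin2//.
rewrite (ip_by_parts0 ah h0 (rVx r)) (ip_by_parts0 ah h0 (rPx r)).
by ring.
Qed.

(** The heat equation tested against the temperature. *)
Lemma test_th s : regular s -> solves s ->
  c p * ip D (stht s) (sth s) =
  - k p * ip D (sthx s) (sthx s) + delta p * ip D (sthx s) (sf s).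
Proof.
move=> r e; have sh := sqi_ac L0 (rth r).
have q1 := (rthx r).1; have q2 := (rf r).1; have qt := rtht r.
rewrite -ipZ// (ip_ae_l _ _ sh (eth e)); last 2 first.
- exact: sqiZ.
- exact: sqi_lin2.
rewrite ip_lin2//.
have := ac_by_parts L0 (rthx r) (rth r).
have := ac_by_parts L0 (rf r) (rth r).
rewrite (rthL r) (rthx0 r) (rf0 r) !mulr0 !mul0r subr0 (ipC D (sf s)).
by move=> /eqP; rewrite addr_eq0 => /eqP -> /eqP; rewrite addr_eq0 => /eqP ->; ring.
Qed.

(** The heat equation integrated over (0, x): as theta_x and V_t vanish at 0,
    it expresses V_t by theta_x and the time derivative of a primitive of
    theta. *)
Lemma integrated_heat s x : regular s -> solves s -> 0 <= x <= L ->
  c p * prim (stht s) x = k p * sthx s x - delta p * sf s x.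
Proof.
move=> r e xL; have xL' : x <= L by case/andP: xL.
have -> : c p * prim (stht s) x = prim (fun y => c p * stht s y) x.
  by rewrite /prim RintegralZl//; apply: (integrable_sub_dom L0) => //; exact: rtht r.
have -> : prim (fun y => c p * stht s y) x =
    prim (fun x => k p * sthxx s x + (- delta p) * sfx s x) x.
  rewrite /prim /Rintegral; congr fine; apply: ae_eq_integral => //.
  - have [m _] := integrableP _ _ _ (integrable_sub_dom L0 xL' (sqiZ mD (c p) (rtht r))).
    exact: m.
  - have [m _] := integrableP _ _ _ (integrable_sub_dom L0 xL'
      (sqi_lin2 mD (k p) (- delta p) (rthx r).1 (rf r).1)).
    exact: m.
  - apply: filterS (eth e) => y H; rewrite /= in_itv /= => /andP[y0 yx].
    by rewrite H// /dom /= in_itv /= y0 (lt_le_trans yx).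
rewrite (prim_lin2 L0 _ _ xL')//; last 2 first.
- exact: (rthx r).1.
- exact: (rf r).1.
have := (rthx r).2 x xL; rewrite (rthx0 r) add0r => ->.
by have := (rf r).2 x xL; rewrite (rf0 r) add0r => ->; ring.
Qed.

(** varpi(xi) / (xi^2 + eta)^(1/2), whose square integrability makes the
    memory terms finite. *)
Definition sigma (xi : R) : R := varpi p xi / Num.sqrt (xi ^+ 2 + eta p).

Lemma measurable_varpi : measurable_fun setT (varpi p).
Proof.
apply: (measurableT_comp (measurable_powR _)).
by apply: continuous_measurable_fun; exact: norm_continuous.
Qed.

Lemma continuous_sqrt_weight : continuous (fun xi : R => Num.sqrt (xi ^+ 2 + eta p)).
Proof.
move=> x.
apply: (@continuous_comp _ _ _ (fun xi : R => xi ^+ 2 + eta p) Num.sqrt); last first.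
  exact: sqrt_continuous.
apply: cvgD; last exact: cvg_cst.
by under eq_fun do rewrite expr2; apply: cvgM; exact: cvg_id.
Qed.

Lemma sqi_sigma : sqi setT sigma.
Proof.
have [_ [_ [_ [/andP[a0 a1] _]]]] := hp.
split.
  apply: measurable_funM; first exact: measurable_varpi.
  apply: continuous_measurable_fun => x; apply: cvgV.
    by rewrite gt_eqF// sqrtr_gt0 sqr_add_gt0.
  exact: continuous_sqrt_weight.
have -> : EFin \o (fun x => sigma x ^+ 2) = EFin \o weight_sq (2 * a p) (eta p).
  apply/funext => x /=; congr (_%:E); rewrite /sigma /weight_sq expr_div_n.
  rewrite sqr_sqrtr ?(ltW (sqr_add_gt0 eta0 x))//; congr (_ / _).
  by rewrite /varpi -powR_mulrn ?powR_ge0// -powRrM; congr (_ `^ _); field.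
have h1 : 0 < 2 * a p by lra.
have h2 : 2 * a p < 2 by lra.
exact: (integrable_weight_sq h1 h2 eta0).
Qed.

(** (xi^2 + eta)^(1/2) phi(xi) *)
Definition sqrt_weighted phi (xi : R) : R := Num.sqrt (xi ^+ 2 + eta p) * phi xi.

Lemma sqrt_weightedM phi psi xi : sqrt_weighted phi xi * sqrt_weighted psi xi =
  weighted phi xi * weighted psi xi + eta p * (phi xi * psi xi).
Proof.
rewrite /sqrt_weighted /weighted.
transitivity (Num.sqrt (xi ^+ 2 + eta p) ^+ 2 * (phi xi * psi xi)); first by ring.
rewrite sqr_sqrtr ?(ltW (sqr_add_gt0 eta0 xi))// -(real_normK (num_real xi)).
by ring.
Qed.

Lemma sqi_sqrt_weighted phi : sqi setT phi -> sqi setT (weighted phi) ->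
  sqi setT (sqrt_weighted phi).
Proof.
move=> sp sw; split.
  by apply: measurable_funM; [apply: continuous_measurable_fun; exact: continuous_sqrt_weight|case: sp].
have -> : EFin \o (fun xi => sqrt_weighted phi xi ^+ 2) =
  (EFin \o (fun xi => weighted phi xi ^+ 2)) \+
  (fun xi => (eta p)%:E * (EFin \o (fun xi => phi xi ^+ 2)%R) xi)%E.
  by apply/funext => xi /=; rewrite expr2 sqrt_weightedM -!expr2.
apply: integrableD => //; first by case: sw.
by apply: integrableZl => //; case: sp.
Qed.

Lemma ip_sqrt_weighted phi : sqi setT phi -> sqi setT (weighted phi) ->
  ip setT (sqrt_weighted phi) (sqrt_weighted phi) = weighted_sq phi.
Proof.
move=> sp sw; rewrite /weighted_sq -(ipZ mT)// /ip -RintegralD//; last 2 first.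
- exact: sqi_intM.
- by apply: sqi_intM => //; exact: sqiZ.
by apply: eq_Rintegral => xi _; rewrite sqrt_weightedM mulrA.
Qed.

Lemma varpi_sigma phi xi : varpi p xi * phi xi = sigma xi * sqrt_weighted phi xi.
Proof.
rewrite /sigma /sqrt_weighted mulrA divfK//.
by rewrite gt_eqF// sqrtr_gt0 sqr_add_gt0.
Qed.

Lemma integrable_varpi phi : sqi setT phi -> sqi setT (weighted phi) ->
  leb.-integrable setT (EFin \o (fun xi => varpi p xi * phi xi)).
Proof.
move=> sp sw; under eq_fun do rewrite varpi_sigma.
by apply: sqi_intM => //; [exact: sqi_sigma|exact: sqi_sqrt_weighted].
Qed.

Lemma ip_varpi_sq_le phi : sqi setT phi -> sqi setT (weighted phi) ->
  ip setT (varpi p) phi ^+ 2 <= ip setT sigma sigma * weighted_sq phi.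
Proof.
move=> sp sw; rewrite -ip_sqrt_weighted//.
have -> : ip setT (varpi p) phi = ip setT sigma (sqrt_weighted phi).
  by apply: eq_Rintegral => xi _; rewrite varpi_sigma.
by apply: cauchy_schwarz => //; [exact: sqi_sigma|exact: sqi_sqrt_weighted].
Qed.

Lemma weighted_sq_ge0 phi : 0 <= weighted_sq phi.
Proof. by rewrite addr_ge0 ?ip_ge0// mulr_ge0 ?ip_ge0// ltW. Qed.

(** The equation for phi tested against phi. *)
Lemma test_phi phi phit (r : R) : sqi setT phi -> sqi setT (weighted phi) ->
  sqi setT phit ->
  ae_eq leb setT phit
    (fun xi => - ((xi ^+ 2 + eta p) * phi xi) + r * varpi p xi) ->
  ip setT phit phi = - weighted_sq phi + r * ip setT (varpi p) phi.
Proof.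
move=> sp sw spt e.
have i1 := sqi_intM mT (sqi_sqrt_weighted sp sw) (sqi_sqrt_weighted sp sw).
have i2 := integrable_varpi sp sw.
rewrite -ip_sqrt_weighted// addrC /ip -RintegralZl// -RintegralB//; last first.
  rewrite (_ : _ \o _ = fun xi => (r%:E * (EFin \o (fun xi => varpi p xi * phi xi)%R) xi)%E)//.
  exact: integrableZl.
rewrite /Rintegral; congr fine; apply: ae_eq_integral => //.
- by apply/measurable_EFinP; apply: measurable_funM; [case: spt|case: sp].
- apply/measurable_EFinP; apply: measurable_funB.
    apply: measurable_funM => //; apply: measurable_funM.
      exact: measurable_varpi.
    by case: sp.
  by apply: measurable_funM; case: (sqi_sqrt_weighted sp sw).
- apply: filterS e => xi H _; congr (_%:E); rewrite H// sqrt_weightedM /weighted.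
  by rewrite -(real_normK (num_real xi)); ring.
Qed.

End Snapshots.

(** * Multiplier estimates *)

Section Young.
Context {R : realType}.

Lemma young_scalar (d x y : R) : 0 < d -> `|x * y| <= d * x ^+ 2 + (4 * d)^-1 * y ^+ 2.
Proof.
move=> d0; have d4 : 0 < 4 * d by rewrite mulr_gt0.
have K r : 0 <= d * x ^+ 2 + (4 * d)^-1 * y ^+ 2 - r * (x * y) + (r ^+ 2 - 1) * ((4 * d)^-1 * y ^+ 2).
  have -> : d * x ^+ 2 + (4 * d)^-1 * y ^+ 2 - r * (x * y) + (r ^+ 2 - 1) * ((4 * d)^-1 * y ^+ 2) =
     (4 * d)^-1 * (2 * d * x - r * y) ^+ 2 by field; rewrite gt_eqF.
  by rewrite mulr_ge0 ?sqr_ge0// invr_ge0 ltW.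
by rewrite ler_norml; have := K 1; have := K (-1); rewrite sqrrN expr1n subrr !mul0r => ? ?; lra.
Qed.

Lemma young_scaled (D : set R) (mD : measurable D) (r d : R) (u v : R -> R) :
  0 < d -> sqi D u -> sqi D v ->
  `|r * ip D u v| <= d * ip D u u + r ^+ 2 / (4 * d) * ip D v v.
Proof.
move=> d0 su sv; have := young_norm mD d0 su (sqiZ mD r sv).
have srv := sqiZ mD r sv.
rewrite (ipC D u (fun x => r * v x)) (ipZ mD r sv su) (ipZ mD r sv srv).
rewrite (ipC D v (fun x => r * v x)) (ipZ mD r sv sv) (ipC D v u).
move=> /le_trans; apply.
by rewrite lerD2l le_eqVlt; apply/orP; left; apply/eqP; ring.
Qed.

End Young.

Section Estimates.
Context {R : realType}.
Local Notation leb := (@lebesgue_measure R).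
Variable p : params R.
Hypothesis hp : admissible p.
Local Notation L := (len p).
Local Notation D := (dom L).
Implicit Types (s : snapshot R) (h phi : R -> R).

Let L0 : 0 < L. Proof. by case: hp => _ [[]]. Qed.
Let eta0 : 0 < eta p. Proof. by case: hp => _ [_ [[]]]. Qed.
Let mD : measurable D := measurable_dom L.

(** Poincare's inequality and the trace inequality at L for functions that
    vanish at 0. *)
Lemma poincare h hx : ac L h hx -> h 0 = 0 ->
  ip D h h <= L ^+ 2 * ip D hx hx /\ h L ^+ 2 <= L * ip D hx hx.
Proof.
move=> [q H] h0; have E x : 0 <= x <= L -> h x = prim hx x.
  by move=> xL; rewrite H// h0 add0r.
split.
  apply: le_trans (ip_prim_le L0 q); rewrite le_eqVlt; apply/orP; left; apply/eqP.
  apply: eq_Rintegral => x; rewrite inE /dom /= in_itv /= => /andP[x0 xL].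
  by rewrite E// !ltW.
have LL : 0 <= L <= L by rewrite lexx ltW.
by rewrite E//; exact: prim_sq_le.
Qed.

(** Poincare's inequality for functions that vanish at L. *)
Lemma poincare_right h hx : ac L h hx -> h L = 0 ->
  ip D h h <= 4 * L ^+ 2 * ip D hx hx.
Proof.
move=> ah hL; have sh := sqi_ac L0 ah; case: ah => q H.
have LL : 0 <= L <= L by rewrite lexx ltW.
have -> : 4 * L ^+ 2 * ip D hx hx = \int[leb]_(x in D) (4 * (L * ip D hx hx)).
  by rewrite Rintegral_cst_dom//; ring.
apply: le_Rintegral => //; first exact: sqi_intM.
  exact: (integrable_cst_dom L0).
move=> x; rewrite /dom /= in_itv /= => /andP[x0 xL].
have xi : 0 <= x <= L by rewrite !ltW.
have h1 := prim_sq_le L0 xi q; have h2 := prim_sq_le L0 LL q.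
have := H L LL; rewrite hL => h0; rewrite -expr2 (H x xi).
have -> : h 0 = - prim hx L by apply/eqP; rewrite -addr_eq0; apply/eqP.
have := sqr_ge0 (prim hx L + prim hx x).
rewrite !sqrrD sqrrN mulNr; set P := prim hx L; set Q := prim hx x => h3.
by move: h1 h2; rewrite -/P -/Q; lra.
Qed.

(** The squared norms of V_t, V_x, P_x and P_t. *)
Definition nf s := ip D (sf s) (sf s).
Definition nVx s := ip D (sVx s) (sVx s).
Definition nPx s := ip D (sPx s) (sPx s).
Definition ng s := ip D (sg s) (sg s).

(** The dissipated quantities. *)
Definition dissip s : R :=
  ip D (sthx s) (sthx s) + weighted_sq p (sp1 s) + weighted_sq p (sp2 s).

(** The stresses at x = L. *)
Definition stressV s := alpha p * sVx s L - gamma p * beta p * sPx s L.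
Definition stressP s := beta p * sPx s L - gamma p * beta p * sVx s L.

Lemma nf_ge0 s : 0 <= nf s. Proof. exact: ip_ge0. Qed.
Lemma nVx_ge0 s : 0 <= nVx s. Proof. exact: ip_ge0. Qed.
Lemma nPx_ge0 s : 0 <= nPx s. Proof. exact: ip_ge0. Qed.
Lemma ng_ge0 s : 0 <= ng s. Proof. exact: ip_ge0. Qed.

Lemma thx_dissip s : ip D (sthx s) (sthx s) <= dissip s.
Proof.
rewrite /dissip -addrA lerDl addr_ge0//; exact: weighted_sq_ge0.
Qed.

Lemma dissip_ge0 s : 0 <= dissip s.
Proof. by apply: le_trans (thx_dissip s); exact: ip_ge0. Qed.

Lemma th_dissip s : regular p s -> ip D (sth s) (sth s) <= 4 * L ^+ 2 * dissip s.
Proof.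
move=> r; apply: (le_trans (poincare_right (rth r) (rthL r))).
by rewrite ler_wpM2l ?thx_dissip// mulr_ge0 ?sqr_ge0.
Qed.

Lemma ac_prim_th s : regular p s -> ac L (prim (sth s)) (sth s).
Proof.
by move=> r; split=> [|x _]; [exact: (sqi_ac L0 (rth r))|rewrite prim0 add0r].
Qed.

Lemma prim_th_dissip s : regular p s ->
  ip D (prim (sth s)) (prim (sth s)) <= L ^+ 2 * (4 * L ^+ 2) * dissip s /\
  prim (sth s) L ^+ 2 <= L * (4 * L ^+ 2) * dissip s.
Proof.
move=> r; have [h1 h2] := poincare (ac_prim_th r) (prim0 _).
have h := th_dissip r; split.
  by apply: (le_trans h1); rewrite -mulrA ler_wpM2l ?sqr_ge0.
by apply: (le_trans h2); rewrite -mulrA ler_wpM2l ?(ltW L0).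
Qed.

(** The stresses at x = L are controlled by the dissipation, through the
    memory terms. *)
Lemma stress_dissip : exists2 K : R, 0 <= K & forall s, regular p s ->
  stressV s ^+ 2 <= K * dissip s /\ stressP s ^+ 2 <= K * dissip s.
Proof.
have sg0 := @ip_ge0 R setT (sigma p).
pose K1 := (l1 p * kappa p) ^+ 2 * ip setT (sigma p) (sigma p).
pose K2 := (l2 p * kappa p) ^+ 2 * ip setT (sigma p) (sigma p).
have k1 : 0 <= K1 by rewrite mulr_ge0 ?sqr_ge0.
have k2 : 0 <= K2 by rewrite mulr_ge0 ?sqr_ge0.
exists (K1 + K2); first exact: addr_ge0.
move=> s r; have d0 := dissip_ge0 s.
have w1 := weighted_sq_ge0 hp (sp1 s); have w2 := weighted_sq_ge0 hp (sp2 s).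
have t0 := @ip_ge0 R D (sthx s).
have b1 := ip_varpi_sq_le hp (rp1 r) (rwp1 r).
have b2 := ip_varpi_sq_le hp (rp2 r) (rwp2 r).
have e1 : stressV s ^+ 2 = (l1 p * kappa p) ^+ 2 * ip setT (varpi p) (sp1 s) ^+ 2.
  by rewrite /stressV (rS1 r); ring.
have e2 : stressP s ^+ 2 = (l2 p * kappa p) ^+ 2 * ip setT (varpi p) (sp2 s) ^+ 2.
  by rewrite /stressP (rS2 r); ring.
split.
  apply: (@le_trans _ _ (K1 * weighted_sq p (sp1 s))).
    by rewrite e1 /K1 -mulrA ler_wpM2l ?sqr_ge0.
  apply: ler_pM => //; first by rewrite lerDl.
  by rewrite /dissip; lra.
apply: (@le_trans _ _ (K2 * weighted_sq p (sp2 s))).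
  by rewrite e2 /K2 -mulrA ler_wpM2l ?sqr_ge0.
apply: ler_pM => //; first by rewrite lerDr.
by rewrite /dissip; lra.
Qed.

(** Time derivatives of the energy and of the four multiplier functionals. *)
Definition dE s : R :=
  rho p * ip D (sft s) (sf s) + alpha p * ip D (sfx s) (sVx s)
  + mu p * ip D (sgt s) (sg s) + beta p * ip D (sgx s) (sPx s)
  - gamma p * beta p * (ip D (sfx s) (sPx s) + ip D (sVx s) (sgx s))
  + c p * ip D (stht s) (sth s)
  + kappa p * (l1 p * ip setT (sp1t s) (sp1 s) + l2 p * ip setT (sp2t s) (sp2 s)).
Definition dF1 s : R :=
  c p * rho p * (ip D (prim (stht s)) (sf s) + ip D (prim (sth s)) (sft s)).
Definition dF2 s : R :=
  rho p * (ip D (sft s) (sV s) + ip D (sf s) (sf s))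
  + gamma p * mu p * (ip D (sgt s) (sV s) + ip D (sg s) (sf s)).
Definition dF3 s : R :=
  - rho p * (ip D (sft s) (sP s) + ip D (sf s) (sg s)).
Definition dF4 s : R :=
  - mu p * (ip D (sgt s) (sP s) + ip D (sg s) (sg s)).

Lemma energy_identity s : regular p s -> solves p s ->
  dE s = - k p * ip D (sthx s) (sthx s)
    - kappa p * (l1 p * weighted_sq p (sp1 s) + l2 p * weighted_sq p (sp2 s)).
Proof.
move=> r e; rewrite /dE (test_V hp r e (rf r) (rf0 r)) (test_P hp r e (rg r) (rg0 r)).
rewrite (test_th hp r e).
rewrite (test_phi hp (rp1 r) (rwp1 r) (rp1t r) (ep1 e)).
rewrite (test_phi hp (rp2 r) (rwp2 r) (rp2t r) (ep2 e)).
rewrite (rS1 r) (rS2 r) (ipC D (sfx s)) (ipC D (sfx s)) (ipC D (sgx s)).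
by ring.
Qed.

(** The energy decreases at least at the rate of the dissipation. *)
Lemma dissipation : exists2 K : R, 0 < K & forall s, regular p s -> solves p s ->
  dE s <= - K * dissip s.
Proof.
have kap := kappa_gt0 hp.
have [_ [[_ _ l1p l2p] [[_ _ _ kp] _]]] := hp.
exists (Num.min (k p) (Num.min (kappa p * l1 p) (kappa p * l2 p))).
  have m1 : 0 < kappa p * l1 p by rewrite mulr_gt0.
  have m2 : 0 < kappa p * l2 p by rewrite mulr_gt0.
  by rewrite lt_min kp lt_min m1 m2.
move=> s r e; rewrite energy_identity//.
set K := Num.min _ _; have K1 : K <= k p by rewrite /K ge_min lexx.
have K2 : K <= kappa p * l1 p by rewrite /K !ge_min lexx !orbT.
have K3 : K <= kappa p * l2 p by rewrite /K !ge_min lexx !orbT.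
have a1 := ler_wpM2r (@ip_ge0 R D (sthx s)) K1.
have a2 := ler_wpM2r (weighted_sq_ge0 hp (sp1 s)) K2.
have a3 := ler_wpM2r (weighted_sq_ge0 hp (sp2 s)) K3.
by rewrite /dissip; lra.
Qed.

End Estimates.

Section MultiplierEstimates.
Context {R : realType}.
Local Notation leb := (@lebesgue_measure R).
Variable p : params R.
Hypothesis hp : admissible p.
Local Notation L := (len p).
Local Notation D := (dom L).
Implicit Types (s : snapshot R).

Let L0 : 0 < L. Proof. by case: hp => _ [[]]. Qed.
Let mD : measurable D := measurable_dom L.

(** Equipartition for P: controls P_t by V_x and P_x. *)
Lemma dF4_le : exists2 K : R, 0 <= K & forall s, regular p s -> solves p s ->
  dF4 p s <= - mu p * ng p s + K * (nVx p s + nPx p s + dissip p s).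
Proof.
have [KS KS0 HS] := stress_dissip hp.
have [[_ _ _ be0 ga0] _] := hp.
pose G2 := (gamma p * beta p) ^+ 2 / (4 * 1).
have G20 : 0 <= G2 by rewrite divr_ge0 ?sqr_ge0// mulr1.
have Lp := ltW L0; have bp := ltW be0.
exists (KS + L + beta p + G2 + 1); first by lra.
set K := KS + L + beta p + G2 + 1 => s r e.
have Px := rP r; have qV := (rV r).1; have qP := (rP r).1.
have [_ pL] := poincare hp Px (rP0 r); have [_ sP2] := HS s r.
have b1 := young_scalar (stressP p s) (sP s L) ltr01.
have b2 := young_scaled mD (gamma p * beta p) ltr01 qV qP.
rewrite ler_norml in b1; case/andP: b1 => b1 _.
rewrite ler_norml in b2; case/andP: b2 => b2 _.
have -> : dF4 p s = - (mu p * ip D (sgt s) (sP s)) - mu p * ng p s.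
  by rewrite /dF4 /ng; ring.
rewrite (test_P hp r e Px (rP0 r)) -/(stressP p s) -/(nPx p s).
rewrite -/G2 -/(nPx p s) -/(nVx p s) in b2 pL.
have kB : 1 * nVx p s <= K * nVx p s by rewrite ler_wpM2r ?nVx_ge0// /K; lra.
have kC : (L + beta p + G2) * nPx p s <= K * nPx p s.
  by rewrite ler_wpM2r ?nPx_ge0// /K; lra.
have kD : KS * dissip p s <= K * dissip p s.
  by rewrite ler_wpM2r ?dissip_ge0// /K; lra.
have lc : 0 <= L * nPx p s by rewrite mulr_ge0 ?nPx_ge0.
move: b1 b2 pL sP2 kB kC kD lc; set X := stressP p s * sP s L; set Y := ip D _ _.
move: (stressP p s ^+ 2) (sP s L ^+ 2) => x2 y2.
move=> *; lra.
Qed.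

(** Controls P_x, through the coupling term of the equation for V. *)
Lemma dF3_le (e : R) : 0 < e ->
  exists2 K : R, 0 <= K & forall s, regular p s -> solves p s ->
  dF3 p s <= - (gamma p * beta p / 2) * nPx p s + e * ng p s
    + K * (nf p s + nVx p s + dissip p s).
Proof.
move=> e0; have [KS KS0 HS] := stress_dissip hp.
have [[rh0 al0 _ be0 ga0] [_ [[_ de0 _ _] _]]] := hp.
pose q := gamma p * beta p / 8.
have q0 : 0 < q by rewrite divr_gt0 ?mulr_gt0.
pose d1 := q / L; have d10 : 0 < d1 by rewrite divr_gt0.
pose d2 := q / L ^+ 2; have d20 : 0 < d2 by rewrite divr_gt0 ?exprn_gt0.
pose K1 := (4 * d1)^-1 * KS; pose K2 := alpha p ^+ 2 / (4 * q).
pose K3 := delta p ^+ 2 / (4 * d2); pose K4 := rho p ^+ 2 / (4 * e).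
have K10 : 0 <= K1 by rewrite mulr_ge0// invr_ge0 ltW// mulr_gt0.
have K20 : 0 <= K2 by rewrite divr_ge0 ?sqr_ge0// ltW// mulr_gt0.
have K30 : 0 <= K3 by rewrite divr_ge0 ?sqr_ge0// ltW// mulr_gt0.
have K40 : 0 <= K4 by rewrite divr_ge0 ?sqr_ge0// ltW// mulr_gt0.
exists (K1 + K2 + K3 + K4); first by rewrite !addr_ge0.
set K := K1 + K2 + K3 + K4 => s r eq.
have Px := rP r; have qV := (rV r).1; have qP := (rP r).1; have qth := (rth r).1.
have hP := sqi_ac L0 Px; have hf := sqi_ac L0 (rf r); have hg := sqi_ac L0 (rg r).
have hthx := sqi_ac L0 (rthx r).
have [pp pL] := poincare hp Px (rP0 r); have [SV2 _] := HS s r.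
have b1 := young_scalar (sP s L) (stressV p s) d10.
have b2 := young_scaled mD (alpha p) q0 qP qV.
have b3 := young_scaled mD (delta p) d20 hP hthx.
have b4 := young_scaled mD (rho p) e0 hg hf.
rewrite ler_norml in b1; case/andP: b1 => b1 _.
rewrite ler_norml in b2; case/andP: b2 => _ b2.
rewrite ler_norml in b3; case/andP: b3 => _ b3.
rewrite ler_norml in b4; case/andP: b4 => b4 _.
have -> : dF3 p s = - (rho p * ip D (sft s) (sP s)) - rho p * ip D (sg s) (sf s).
  by rewrite /dF3 (ipC D (sf s)); ring.
rewrite (test_V hp r eq Px (rP0 r)) -/(stressV p s) -/(nPx p s).
rewrite (ipC D (sVx s)) (ipC D (sthx s)).
rewrite -/K2 -/(nPx p s) -/(nVx p s) in b2 pL pp.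
rewrite -/K3 in b3; rewrite -/K4 -/(ng p s) -/(nf p s) in b4.
have c1 : d1 * sP s L ^+ 2 <= q * nPx p s.
  by apply: (le_trans (ler_wpM2l (ltW d10) pL)); rewrite mulrA divfK ?gt_eqF.
have c2 : (4 * d1)^-1 * stressV p s ^+ 2 <= K1 * dissip p s.
  rewrite /K1 -mulrA ler_wpM2l// invr_ge0 ltW// mulr_gt0//.
have c3 : d2 * ip D (sP s) (sP s) <= q * nPx p s.
  by apply: (le_trans (ler_wpM2l (ltW d20) pp)); rewrite mulrA divfK ?gt_eqF ?exprn_gt0.
have c4 : K3 * ip D (sthx s) (sthx s) <= K3 * dissip p s.
  by rewrite ler_wpM2l ?thx_dissip.
have eq8 : gamma p * beta p = 8 * q by rewrite /q; field.
have kA : K4 * nf p s <= K * nf p s by rewrite ler_wpM2r ?nf_ge0// /K; lra.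
have kB : K2 * nVx p s <= K * nVx p s by rewrite ler_wpM2r ?nVx_ge0// /K; lra.
have kD : (K1 + K3) * dissip p s <= K * dissip p s.
  by rewrite ler_wpM2r ?dissip_ge0// /K; lra.
have c0 : 0 <= q * nPx p s by rewrite mulr_ge0 ?nPx_ge0// ltW.
rewrite eq8; move: b1 b2 b3 b4 c0 c1 c2 c3 c4 kA kB kD.
rewrite -!/(nVx p s) -!/(nPx p s).
move: (ip D (sPx s) (sVx s)) (ip D (sP s) (sthx s)) (ip D (sg s) (sf s)) => Y Z W.
move: (dissip p s) (nVx p s) (nf p s) (ng p s) (nPx p s) => Dd B A G C.
move: (ip D (sthx s) (sthx s)) (ip D (sP s) (sP s)) (stressV p s ^+ 2) (sP s L ^+ 2) => T PP S2 P2.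
by move=> *; lra.
Qed.

(** Controls V_x: in the combination rho V_tt + gamma mu P_tt the second
    derivative of P cancels. *)
Lemma dF2_le (e : R) : 0 < e ->
  exists2 K : R, 0 <= K & forall s, regular p s -> solves p s ->
  dF2 p s <= - (alpha1 p / 2) * nVx p s + e * ng p s
    + K * (nf p s + dissip p s).
Proof.
move=> e0; have [KS KS0 HS] := stress_dissip hp.
have [[rh0 al0 al1 be0 ga0] [[mu0 _ _ _] [[_ de0 _ _] [_ alE]]]] := hp.
pose q := alpha1 p / 8.
have q0 : 0 < q by rewrite divr_gt0 ?mulr_gt0.
pose d1 := q / L; have d10 : 0 < d1 by rewrite divr_gt0.
pose d2 := q / L ^+ 2; have d20 : 0 < d2 by rewrite divr_gt0 ?exprn_gt0.
have d1i : 0 <= (4 * d1)^-1 by rewrite invr_ge0 ltW// mulr_gt0.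
pose K1 := (4 * d1)^-1 * KS; pose K2 := (4 * d1)^-1 * (gamma p ^+ 2 * KS).
pose K3 := delta p ^+ 2 / (4 * d2); pose K4 := (gamma p * mu p) ^+ 2 / (4 * e).
have K10 : 0 <= K1 by rewrite mulr_ge0.
have K20 : 0 <= K2 by rewrite mulr_ge0// mulr_ge0 ?sqr_ge0.
have K30 : 0 <= K3 by rewrite divr_ge0 ?sqr_ge0// ltW// mulr_gt0.
have K40 : 0 <= K4 by rewrite divr_ge0 ?sqr_ge0// ltW// mulr_gt0.
have rh1 := ltW rh0.
exists (K1 + K2 + K3 + K4 + rho p); first by rewrite !addr_ge0.
set K := K1 + K2 + K3 + K4 + rho p => s r eq.
have Vx := rV r; have qth := (rth r).1.
have hV := sqi_ac L0 Vx; have hf := sqi_ac L0 (rf r); have hg := sqi_ac L0 (rg r).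
have hthx := sqi_ac L0 (rthx r).
have [pp pL] := poincare hp Vx (rV0 r); have [SV2 SP2] := HS s r.
have b1 := young_scalar (sV s L) (stressV p s) d10.
have b2 := young_scalar (sV s L) (gamma p * stressP p s) d10.
have b3 := young_scaled mD (delta p) d20 hV hthx.
have b4 := young_scaled mD (gamma p * mu p) e0 hg hf.
rewrite ler_norml in b1; case/andP: b1 => _ b1.
rewrite ler_norml in b2; case/andP: b2 => _ b2.
rewrite ler_norml in b3; case/andP: b3 => b3 _.
rewrite ler_norml in b4; case/andP: b4 => _ b4.
have -> : dF2 p s = rho p * ip D (sft s) (sV s) + gamma p * (mu p * ip D (sgt s) (sV s))
   + rho p * nf p s + gamma p * mu p * ip D (sg s) (sf s).
  by rewrite /dF2 /nf; ring.
rewrite (test_V hp r eq Vx (rV0 r)) -/(stressV p s).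
rewrite (test_P hp r eq Vx (rV0 r)) -/(stressP p s).
rewrite (ipC D (sthx s)) alE -!/(nVx p s).
rewrite -/(nVx p s) in pL pp.
rewrite -/K3 in b3; rewrite -/K4 -/(ng p s) -/(nf p s) in b4.
have c1 : d1 * sV s L ^+ 2 <= q * nVx p s.
  by apply: (le_trans (ler_wpM2l (ltW d10) pL)); rewrite mulrA divfK ?gt_eqF.
have c2 : (4 * d1)^-1 * stressV p s ^+ 2 <= K1 * dissip p s.
  by rewrite /K1 -mulrA ler_wpM2l.
have c2' : (4 * d1)^-1 * (gamma p * stressP p s) ^+ 2 <= K2 * dissip p s.
  by rewrite /K2 -mulrA ler_wpM2l// exprMn -(mulrA (gamma p ^+ 2)) ler_wpM2l ?sqr_ge0.
have c3 : d2 * ip D (sV s) (sV s) <= q * nVx p s.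
  by apply: (le_trans (ler_wpM2l (ltW d20) pp)); rewrite mulrA divfK ?gt_eqF ?exprn_gt0.
have c4 : K3 * ip D (sthx s) (sthx s) <= K3 * dissip p s.
  by rewrite ler_wpM2l ?thx_dissip.
have eq8 : alpha1 p = 8 * q by rewrite /q; field.
have kA : (K4 + rho p) * nf p s <= K * nf p s by rewrite ler_wpM2r ?nf_ge0// /K; lra.
have kD : (K1 + K2 + K3) * dissip p s <= K * dissip p s.
  by rewrite ler_wpM2r ?dissip_ge0// /K; lra.
have c0 : 0 <= q * nVx p s by rewrite mulr_ge0 ?nVx_ge0// ltW.
rewrite eq8 (ipC D (sPx s)); move: b1 b2 b3 b4 c0 c1 c2 c2' c3 c4 kA kD.
move: (ip D (sVx s) (sPx s)) (ip D (sV s) (sthx s)) (ip D (sg s) (sf s)) => Y Z W.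
move: (dissip p s) (nVx p s) (nf p s) (ng p s) => Dd B A G.
move: (ip D (sthx s) (sthx s)) (ip D (sV s) (sV s)) (stressV p s ^+ 2) (sV s L ^+ 2) => T PP S2 P2.
move: ((gamma p * stressP p s) ^+ 2) => S3.
by move=> *; lra.
Qed.

(** Controls V_t, through the integrated heat equation. *)
Lemma dF1_le (e : R) : 0 < e ->
  exists2 K : R, 0 <= K & forall s, regular p s -> solves p s ->
  dF1 p s <= - (delta p * rho p / 2) * nf p s + e * (nVx p s + nPx p s)
    + K * dissip p s.
Proof.
move=> e0; have [KS KS0 HS] := stress_dissip hp.
have [[rh0 al0 al1 be0 ga0] [[mu0 _ _ _] [[_ de0 c0 k0] _]]] := hp.
pose q := delta p * rho p / 2.
have q0 : 0 < q by rewrite divr_gt0 ?mulr_gt0.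
pose T1 := 4 * L ^+ 2; have T10 : 0 <= T1 by rewrite mulr_ge0 ?sqr_ge0.
have cp := ltW c0; have Lp := ltW L0.
pose K1 := (rho p * k p) ^+ 2 / (4 * q); pose K2 := c p * (KS + L * T1).
pose K3 := (c p * alpha p) ^+ 2 / (4 * e) * T1.
pose K4 := (c p * (gamma p * beta p)) ^+ 2 / (4 * e) * T1.
pose K5 := 1 + (c p * delta p) ^+ 2 / (4 * 1) * (L ^+ 2 * T1).
have K10 : 0 <= K1 by rewrite divr_ge0 ?sqr_ge0// ltW// mulr_gt0.
have K20 : 0 <= K2 by rewrite mulr_ge0// addr_ge0// mulr_ge0.
have K30 : 0 <= K3 by rewrite mulr_ge0// divr_ge0 ?sqr_ge0// ltW// mulr_gt0.
have K40 : 0 <= K4 by rewrite mulr_ge0// divr_ge0 ?sqr_ge0// ltW// mulr_gt0.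
have K50 : 0 <= K5.
  by rewrite addr_ge0// mulr_ge0// ?divr_ge0 ?sqr_ge0// ?mulr1// mulr_ge0 ?sqr_ge0.
exists (K1 + K2 + K3 + K4 + K5); first by lra.
set K := K1 + K2 + K3 + K4 + K5 => s r eq.
have qth := (rth r).1; have qV := (rV r).1; have qP := (rP r).1.
have hf := sqi_ac L0 (rf r); have hth := sqi_ac L0 (rth r).
have hthx := sqi_ac L0 (rthx r).
have aT := ac_prim_th hp r; have hT := sqi_ac L0 aT.
have thD := th_dissip hp r; have [TD TLD] := prim_th_dissip hp r.
have [SV2 _] := HS s r.
have b1 := young_scaled mD (rho p * k p) q0 hf hthx.
have b2 := young_scalar (stressV p s) (prim (sth s) L) ltr01.
have b3 := young_scaled mD (c p * alpha p) e0 qV hth.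
have b4 := young_scaled mD (c p * (gamma p * beta p)) e0 qP hth.
have b5 := young_scaled mD (c p * delta p) ltr01 hthx hT.
rewrite ler_norml in b1; case/andP: b1 => _ b1.
rewrite ler_norml in b2; case/andP: b2 => _ b2.
rewrite ler_norml in b3; case/andP: b3 => b3 _.
rewrite ler_norml in b4; case/andP: b4 => _ b4.
rewrite ler_norml in b5; case/andP: b5 => b5 _.
have H : c p * ip D (prim (stht s)) (sf s) = k p * ip D (sf s) (sthx s) - delta p * nf p s.
  rewrite -ipZ//; last exact: (sqi_prim L0 (rtht r)).
  have -> : ip D (fun x => c p * prim (stht s) x) (sf s) =
      ip D (fun x => k p * sthx s x + (- delta p) * sf s x) (sf s).
    apply: eq_Rintegral => x; rewrite inE /dom /= in_itv /= => /andP[x0 xL].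
    by rewrite (integrated_heat hp r eq) ?mulNr// !ltW.
  by rewrite ip_lin2// (ipC D (sthx s)) mulNr.
have -> : dF1 p s = rho p * (c p * ip D (prim (stht s)) (sf s))
    + c p * (rho p * ip D (sft s) (prim (sth s))).
  by rewrite /dF1 (ipC D (sft s)); ring.
rewrite H (test_V hp r eq aT (prim0 _)) -/(stressV p s).
rewrite -/K1 -/(nf p s) in b1.
have c1 : K1 * ip D (sthx s) (sthx s) <= K1 * dissip p s.
  by rewrite ler_wpM2l ?thx_dissip.
have c2 : c p * (stressV p s * prim (sth s) L) <= K2 * dissip p s.
  rewrite /K2 -mulrA ler_wpM2l//; apply: (le_trans b2).
  rewrite [leRHS]mulrDl; apply: lerD; first by rewrite mul1r.
  by apply: le_trans TLD; have := sqr_ge0 (prim (sth s) L); lra.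
have c3 : (c p * alpha p) ^+ 2 / (4 * e) * ip D (sth s) (sth s) <= K3 * dissip p s.
  by rewrite /K3 -[leRHS]mulrA ler_wpM2l// divr_ge0 ?sqr_ge0// ltW// mulr_gt0.
have c4 : (c p * (gamma p * beta p)) ^+ 2 / (4 * e) * ip D (sth s) (sth s)
    <= K4 * dissip p s.
  by rewrite /K4 -[leRHS]mulrA ler_wpM2l// divr_ge0 ?sqr_ge0// ltW// mulr_gt0.
have c5 : 1 * ip D (sthx s) (sthx s) +
   (c p * delta p) ^+ 2 / (4 * 1) * ip D (prim (sth s)) (prim (sth s)) <= K5 * dissip p s.
  rewrite /K5 [leRHS]mulrDl; apply: lerD; first by rewrite !mul1r thx_dissip.
  by rewrite -[leRHS]mulrA ler_wpM2l// divr_ge0 ?sqr_ge0// mulr1.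
have kD : (K1 + K2 + K3 + K4 + K5) * dissip p s = K * dissip p s by [].
have eq2 : delta p * rho p = 2 * q by rewrite /q; field.
have -> : forall z, rho p * (z - delta p * nf p s) = rho p * z - (2 * q) * nf p s.
  by move=> z; rewrite -eq2; ring.
have -> : delta p * rho p / 2 = q by [].
rewrite -/(nVx p s) -/(nPx p s) in b3 b4 *.
move: b1 b3 b4 b5 c1 c2 c3 c4 c5; rewrite -kD.
move: (ip D (sf s) (sthx s)) (ip D (sVx s) (sth s)) (ip D (sPx s) (sth s)) (ip D (sthx s) (prim (sth s))) => W X Y Z.
move: (stressV p s * prim (sth s) L) => S.
move: (dissip p s) (nVx p s) (nf p s) (nPx p s) => Dd B A C.
move: (ip D (sthx s) (sthx s)) (ip D (sth s) (sth s)) (ip D (prim (sth s)) (prim (sth s))) => T1' T2' T3'.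
by move=> *; lra.
Qed.

End MultiplierEstimates.

(** * The Lyapunov functional *)

Arguments tdiffZ {R} r {F a t} _ [_] _.

Section Lyapunov.
Context {R : realType}.
Local Notation leb := (@lebesgue_measure R).
Variable p : params R.
Hypothesis hp : admissible p.
Local Notation L := (len p).
Local Notation D := (dom L).
Implicit Types (s : snapshot R) (S : R -> snapshot R) (t : R).

Let L0 : 0 < L. Proof. by case: hp => _ [[]]. Qed.
Let mD : measurable D := measurable_dom L.
Let mT : measurable [set: R] := measurableT.

(** The energy of a snapshot, with the square of gamma V_x - P_x expanded. *)
Definition snap_energy s : R :=
  2^-1 * (rho p * nf p s + alpha p * nVx p s + mu p * ng p s + beta p * nPx p s
    - 2 * (gamma p * beta p) * ip D (sVx s) (sPx s)
    + c p * ip D (sth s) (sth s))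
  + kappa p / 2 * (l1 p * ip setT (sp1 s) (sp1 s) + l2 p * ip setT (sp2 s) (sp2 s)).
(** The multiplier functionals. *)
Definition F1 s : R := c p * rho p * ip D (prim (sth s)) (sf s).
Definition F2 s : R := rho p * ip D (sf s) (sV s) + gamma p * mu p * ip D (sg s) (sV s).
Definition F3 s : R := - rho p * ip D (sf s) (sP s).
Definition F4 s : R := - mu p * ip D (sg s) (sP s).

(** Along a trajectory the components are differentiable in time as curves in
    L^2, with V and P differentiable together with their space derivatives. *)
Record evolves S : Prop := {
  evV : forall t, 0 <= t -> l2diff D (fun t => sV (S t)) (sf (S t)) t;
  evVx : forall t, 0 <= t -> l2diff D (fun t => sVx (S t)) (sfx (S t)) t;
  evf : forall t, 0 <= t -> l2diff D (fun t => sf (S t)) (sft (S t)) t;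
  evP : forall t, 0 <= t -> l2diff D (fun t => sP (S t)) (sg (S t)) t;
  evPx : forall t, 0 <= t -> l2diff D (fun t => sPx (S t)) (sgx (S t)) t;
  evg : forall t, 0 <= t -> l2diff D (fun t => sg (S t)) (sgt (S t)) t;
  evth : forall t, 0 <= t -> l2diff D (fun t => sth (S t)) (stht (S t)) t;
  ev1 : forall t, 0 <= t -> l2diff setT (fun t => sp1 (S t)) (sp1t (S t)) t;
  ev2 : forall t, 0 <= t -> l2diff setT (fun t => sp2 (S t)) (sp2t (S t)) t }.

(** Differentiation in time commutes with taking primitives in space. *)
Lemma l2diff_prim (U : R -> R -> R) (U' : R -> R) t : 0 <= t ->
  (forall r, 0 <= r -> sqi D (U r)) -> sqi D U' -> l2diff D U U' t ->
  l2diff D (fun r => prim (U r)) (prim U') t.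
Proof.
move=> t0 hU hU'; rewrite /l2diff => dU.
have lim : L ^+ 2 * ip D (dq_err U U' t h) (dq_err U U' t h) @[h --> increments t] --> 0.
  by rewrite -[X in _ --> X](mulr0 (L ^+ 2)); exact: cvgMl_tmp.
apply: (@squeeze_cvgr _ _ _ _ (fun=> 0) _ _) lim; last exact: cvg_cst.
near=> h; rewrite ip_ge0/=.
have [h0 th] : h != 0 /\ 0 <= t + h by near: h; exact: near_increments.
apply: le_trans (ip_prim_le L0 (sqi_dq_err mD t0 th hU hU')).
rewrite le_eqVlt; apply/orP; left; apply/eqP.
have E x : 0 <= x <= L ->
    dq_err (fun r => prim (U r)) (prim U') t h x = prim (dq_err U U' t h) x.
  move=> /andP[_ xL]; rewrite /dq_err.
  have st := hU _ t0; have sth := hU _ th.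
  rewrite (_ : (fun y => _) = fun y => h^-1 * (1 * U (t + h) y + (-1) * U t y) + (-1) * U' y);
    last by apply/funext => y; ring.
  rewrite (_ : (fun y => _) = fun y => 1 * (h^-1 * (1 * U (t + h) y + (-1) * U t y)) + (-1) * U' y);
    last by apply/funext => y; ring.
  rewrite (prim_lin2 L0 1 (-1) xL); [|apply: sqiZ => //; exact: sqi_lin2|by []].
  have -> : prim (fun y => h^-1 * (1 * U (t + h) y + (-1) * U t y)) x =
      h^-1 * (prim (U (t + h)) x - prim (U t) x).
    have := prim_lin2 L0 (h^-1) (- h^-1) xL sth st.
    rewrite mulrBr mulNr => <-; congr (prim _ x); apply/funext => y; ring.
  by ring.
apply: eq_Rintegral => x; rewrite inE /dom /= in_itv /= => /andP[x0 xL].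
by rewrite E// !ltW.
Unshelve. all: by end_near. Qed.

Lemma tdiff_eq F d d' t : d = d' -> tdiff F d t -> @tdiff R F d' t.
Proof. by move=> ->. Qed.

Section AlongTrajectory.
Variable S : R -> snapshot R.
Hypothesis hr : forall t, 0 <= t -> regular p (S t).
Hypothesis hS : evolves S.

Let qV t : 0 <= t -> sqi D (sV (S t)). Proof. by move=> /hr/rV/(sqi_ac L0). Qed.
Let qVx t : 0 <= t -> sqi D (sVx (S t)). Proof. by move=> /hr/rVx/(sqi_ac L0). Qed.
Let qf t : 0 <= t -> sqi D (sf (S t)). Proof. by move=> /hr/rf/(sqi_ac L0). Qed.
Let qfx t : 0 <= t -> sqi D (sfx (S t)). Proof. by move=> /hr/rf []. Qed.
Let qft t : 0 <= t -> sqi D (sft (S t)). Proof. by move=> /hr/rft. Qed.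
Let qP t : 0 <= t -> sqi D (sP (S t)). Proof. by move=> /hr/rP/(sqi_ac L0). Qed.
Let qPx t : 0 <= t -> sqi D (sPx (S t)). Proof. by move=> /hr/rPx/(sqi_ac L0). Qed.
Let qg t : 0 <= t -> sqi D (sg (S t)). Proof. by move=> /hr/rg/(sqi_ac L0). Qed.
Let qgx t : 0 <= t -> sqi D (sgx (S t)). Proof. by move=> /hr/rg []. Qed.
Let qgt t : 0 <= t -> sqi D (sgt (S t)). Proof. by move=> /hr/rgt. Qed.
Let qth t : 0 <= t -> sqi D (sth (S t)). Proof. by move=> /hr/rth/(sqi_ac L0). Qed.
Let qtht t : 0 <= t -> sqi D (stht (S t)). Proof. by move=> /hr/rtht. Qed.
Let q1 t : 0 <= t -> sqi setT (sp1 (S t)). Proof. by move=> /hr/rp1. Qed.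
Let q1t t : 0 <= t -> sqi setT (sp1t (S t)). Proof. by move=> /hr/rp1t. Qed.
Let q2 t : 0 <= t -> sqi setT (sp2 (S t)). Proof. by move=> /hr/rp2. Qed.
Let q2t t : 0 <= t -> sqi setT (sp2t (S t)). Proof. by move=> /hr/rp2t. Qed.

Lemma tdiff_energy t : 0 <= t ->
  tdiff (fun t => snap_energy (S t)) (dE p (S t)) t.
Proof.
move=> t0.
have df := tdiff_ip mD t0 qf (qft t0) qf (qft t0) (evf hS t0) (evf hS t0).
have dV := tdiff_ip mD t0 qVx (qfx t0) qVx (qfx t0) (evVx hS t0) (evVx hS t0).
have dg := tdiff_ip mD t0 qg (qgt t0) qg (qgt t0) (evg hS t0) (evg hS t0).
have dP := tdiff_ip mD t0 qPx (qgx t0) qPx (qgx t0) (evPx hS t0) (evPx hS t0).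
have dVP := tdiff_ip mD t0 qVx (qfx t0) qPx (qgx t0) (evVx hS t0) (evPx hS t0).
have dth := tdiff_ip mD t0 qth (qtht t0) qth (qtht t0) (evth hS t0) (evth hS t0).
have d1 := tdiff_ip mT t0 q1 (q1t t0) q1 (q1t t0) (ev1 hS t0) (ev1 hS t0).
have d2 := tdiff_ip mT t0 q2 (q2t t0) q2 (q2t t0) (ev2 hS t0) (ev2 hS t0).
have := tdiffD (tdiffZ 2^-1 (tdiffD (tdiffD (tdiffD (tdiffD (tdiffD
  (tdiffZ (rho p) df) (tdiffZ (alpha p) dV)) (tdiffZ (mu p) dg))
  (tdiffZ (beta p) dP)) (tdiffZ (- (2 * (gamma p * beta p))) dVP))
  (tdiffZ (c p) dth)))
  (tdiffZ (kappa p / 2) (tdiffD (tdiffZ (l1 p) d1) (tdiffZ (l2 p) d2))).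
rewrite (_ : (fun t => _ + _) = fun t => snap_energy (S t)); last first.
  by apply/funext => r; rewrite /snap_energy /nf /nVx /ng /nPx; ring.
apply: tdiff_eq; rewrite /dE.
rewrite (ipC D (sf (S t)) (sft _)) (ipC D (sVx (S t)) (sfx _)) (ipC D (sg (S t)) (sgt _)).
rewrite (ipC D (sPx (S t)) (sgx _)) (ipC D (sth (S t)) (stht _)).
rewrite (ipC setT (sp1 (S t)) (sp1t _)) (ipC setT (sp2 (S t)) (sp2t _)).
by field.
Qed.

Lemma tdiff_F1 t : 0 <= t -> tdiff (fun t => F1 (S t)) (dF1 p (S t)) t.
Proof.
move=> t0.
have qT r : 0 <= r -> sqi D (prim (sth (S r))) by move=> /qth; exact: sqi_prim.
have qTt := sqi_prim L0 (qtht t0).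
have dT := l2diff_prim t0 qth (qtht t0) (evth hS t0).
exact: (tdiffZ (c p * rho p) (tdiff_ip mD t0 qT qTt qf (qft t0) dT (evf hS t0))).
Qed.

Lemma tdiff_F2 t : 0 <= t -> tdiff (fun t => F2 (S t)) (dF2 p (S t)) t.
Proof.
move=> t0.
have d1 := tdiff_ip mD t0 qf (qft t0) qV (qf t0) (evf hS t0) (evV hS t0).
have d2 := tdiff_ip mD t0 qg (qgt t0) qV (qf t0) (evg hS t0) (evV hS t0).
exact: (tdiffD (tdiffZ (rho p) d1) (tdiffZ (gamma p * mu p) d2)).
Qed.

Lemma tdiff_F3 t : 0 <= t -> tdiff (fun t => F3 (S t)) (dF3 p (S t)) t.
Proof.
move=> t0.
have d1 := tdiff_ip mD t0 qf (qft t0) qP (qg t0) (evf hS t0) (evP hS t0).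
exact: (tdiffZ (- rho p) d1).
Qed.

Lemma tdiff_F4 t : 0 <= t -> tdiff (fun t => F4 (S t)) (dF4 p (S t)) t.
Proof.
move=> t0.
have d1 := tdiff_ip mD t0 qg (qgt t0) qP (qg t0) (evg hS t0) (evP hS t0).
exact: (tdiffZ (- mu p) d1).
Qed.

End AlongTrajectory.

(** The energy controls each of its parts. *)
Lemma energy_controls : exists2 K : R, 0 <= K & forall s, regular p s ->
  [/\ nf p s <= K * snap_energy s, nVx p s <= K * snap_energy s,
      nPx p s <= K * snap_energy s, ng p s <= K * snap_energy s &
      ip D (sth s) (sth s) <= K * snap_energy s] /\ 0 <= snap_energy s.
Proof.
have kap := kappa_gt0 hp.
have [[rh0 al0 al1 be0 ga0] [[mu0 _ l10 l20] [[_ de0 c0 k0] [_ alE]]]] := hp.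
pose k1 := 2 / rho p; pose k2 := 2 / alpha1 p; pose k3 := 2 / mu p.
pose k4 := 2 / c p; pose k5 := 4 / beta p; pose k6 := 2 * gamma p ^+ 2 * k2.
have k10 : 0 < k1 by rewrite divr_gt0.
have k20 : 0 < k2 by rewrite divr_gt0.
have k30 : 0 < k3 by rewrite divr_gt0.
have k40 : 0 < k4 by rewrite divr_gt0.
have k50 : 0 < k5 by rewrite divr_gt0.
have k60 : 0 < k6 by rewrite mulr_gt0// mulr_gt0// exprn_gt0.
exists (k1 + k2 + k3 + k4 + k5 + k6); first by lra.
move=> s r; set E := snap_energy s.
have hV := sqi_ac L0 (rVx r); have hP := sqi_ac L0 (rPx r).
have w := ip_ge0 D (fun x => gamma p * sVx s x + (-1) * sPx s x).
have w2 := ip_ge0 D (fun x => 2 * gamma p * sVx s x + (-1) * sPx s x).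
rewrite (ip_sq_lin2 mD)// -/(nVx p s) -/(nPx p s) in w.
rewrite (ip_sq_lin2 mD)// -/(nVx p s) -/(nPx p s) in w2.
set Y := ip D (sVx s) (sPx s) in w w2.
set W := gamma p ^+ 2 * _ + _ + _ in w.
have Af := nf_ge0 p s; have Bf := nVx_ge0 p s; have Cf := nPx_ge0 p s.
have Gf := ng_ge0 p s; have Tf := ip_ge0 D (sth s).
have p1 := ip_ge0 setT (sp1 s); have p2 := ip_ge0 setT (sp2 s).
(* W is the squared norm of gamma V_x - P_x *)
have EE : 2 * E = rho p * nf p s + alpha1 p * nVx p s + mu p * ng p s + beta p * W
   + c p * ip D (sth s) (sth s) + kappa p * (l1 p * ip setT (sp1 s) (sp1 s) + l2 p * ip setT (sp2 s) (sp2 s)).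
  by rewrite /E /snap_energy alE /W -/Y; field.
have a1 : 0 <= rho p * nf p s by rewrite mulr_ge0// ltW.
have a2 : 0 <= alpha1 p * nVx p s by rewrite mulr_ge0// ltW.
have a3 : 0 <= mu p * ng p s by rewrite mulr_ge0// ltW.
have a4 : 0 <= beta p * W by rewrite mulr_ge0// ltW.
have a5 : 0 <= c p * ip D (sth s) (sth s) by rewrite mulr_ge0// ltW.
have a6 : 0 <= kappa p * (l1 p * ip setT (sp1 s) (sp1 s) + l2 p * ip setT (sp2 s) (sp2 s)).
  by apply: mulr_ge0; [exact: ltW|rewrite addr_ge0// mulr_ge0// ltW].
have E0 : 0 <= E by lra.
have m (q x : R) : 0 < q -> q * x <= 2 * E -> x <= 2 / q * E.
  by move=> q0 h; rewrite mulrAC ler_pdivlMr// (mulrC x).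
have b1 : nf p s <= k1 * E by apply: m => //; lra.
have b2 : nVx p s <= k2 * E by apply: m => //; lra.
have b3 : ng p s <= k3 * E by apply: m => //; lra.
have b4 : ip D (sth s) (sth s) <= k4 * E by apply: m => //; lra.
have b5 : W <= 2 / beta p * E by apply: m => //; lra.
have b6 : nPx p s <= (k5 + k6) * E.
  have : nPx p s <= 2 * gamma p ^+ 2 * nVx p s + 2 * W by rewrite /W; lra.
  have h1 : 2 * gamma p ^+ 2 * nVx p s <= k6 * E.
    by rewrite /k6 -[leRHS]mulrA ler_wpM2l// mulr_ge0 ?sqr_ge0.
  have h2 : 2 * W <= k5 * E.
    by rewrite (_ : k5 = 2 * (2 / beta p)) -1?mulrA ?ler_wpM2l// /k5; field; rewrite gt_eqF.
  by rewrite mulrDl; lra.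
have mono (q : R) : q <= k1 + k2 + k3 + k4 + k5 + k6 ->
   q * E <= (k1 + k2 + k3 + k4 + k5 + k6) * E by move=> h; rewrite ler_wpM2r.
split => //; split.
- by apply: (le_trans b1); apply: mono; lra.
- by apply: (le_trans b2); apply: mono; lra.
- by apply: (le_trans b6); apply: mono; lra.
- by apply: (le_trans b3); apply: mono; lra.
- by apply: (le_trans b4); apply: mono; lra.
Qed.

(** The quantities recovered by the energy identity and by the four
    multipliers control the energy. *)
Lemma energy_le : exists2 K : R, 0 < K & forall s, regular p s ->
  snap_energy s <= K * (nf p s + nVx p s + nPx p s + ng p s + dissip p s).
Proof.
have kap := kappa_gt0 hp.
have [[rh0 al0 al1 be0 ga0] [[mu0 _ l10 l20] [[et0 de0 c0 k0] [_ alE]]]] := hp.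
pose k1 := 2^-1 * (c p * (4 * L ^+ 2)).
pose k2 := kappa p / 2 * (l1 p / eta p); pose k3 := kappa p / 2 * (l2 p / eta p).
pose G2 := (gamma p * beta p) ^+ 2 / (4 * 1).
have k10 : 0 <= k1.
  by rewrite mulr_ge0// mulr_ge0 ?(ltW c0)// mulr_ge0 ?sqr_ge0.
have k20 : 0 <= k2 by rewrite mulr_ge0// divr_ge0 ?(ltW kap) ?(ltW l10) ?(ltW et0).
have k30 : 0 <= k3 by rewrite mulr_ge0// divr_ge0 ?(ltW kap) ?(ltW l20) ?(ltW et0).
have G20 : 0 <= G2 by rewrite divr_ge0 ?sqr_ge0// mulr1.
pose K := rho p + alpha p + mu p + beta p + G2 + 1 + k1 + k2 + k3.
exists K; first by rewrite /K; lra.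
move=> s r; have hV := sqi_ac L0 (rVx r); have hP := sqi_ac L0 (rPx r).
have Af := nf_ge0 p s; have Bf := nVx_ge0 p s; have Cf := nPx_ge0 p s.
have Gf := ng_ge0 p s; have Df := dissip_ge0 hp s.
have := young_scaled mD (gamma p * beta p) ltr01 hV hP.
rewrite ler_norml => /andP[y _].
rewrite -/G2 -/(nVx p s) -/(nPx p s) in y.
have t1 : 2^-1 * (c p * ip D (sth s) (sth s)) <= k1 * dissip p s.
  rewrite /k1 -!mulrA ler_wpM2l// ler_wpM2l ?(ltW c0)//.
  by have := th_dissip hp r; rewrite -!mulrA.
have w1 := weighted_sq_ge0 hp (sp1 s); have w2 := weighted_sq_ge0 hp (sp2 s).
have tx := ip_ge0 D (sthx s).
have pq (l : R) phi : 0 <= l -> weighted_sq p phi <= dissip p s ->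
    kappa p / 2 * (l * ip setT phi phi) <= kappa p / 2 * (l / eta p) * dissip p s.
  move=> l0 h; have kk : 0 <= kappa p / 2 by apply: divr_ge0 => //; exact: ltW.
  rewrite -(mulrA _ (l / _)); apply: ler_wpM2l => //.
  rewrite -(mulrA l); apply: ler_wpM2l => //.
  rewrite ler_pdivlMl//; apply: le_trans h.
  by rewrite /weighted_sq lerDr ip_ge0.
have t2 : kappa p / 2 * (l1 p * ip setT (sp1 s) (sp1 s)) <= k2 * dissip p s.
  by apply: pq; [exact: ltW|rewrite /dissip; lra].
have t3 : kappa p / 2 * (l2 p * ip setT (sp2 s) (sp2 s)) <= k3 * dissip p s.
  by apply: pq; [exact: ltW|rewrite /dissip; lra].
have mono (q x : R) : 0 <= x -> q <= K -> q * x <= K * x by move=> *; rewrite ler_wpM2r.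
have rp := ltW rh0; have ap := ltW al0; have mp := ltW mu0; have bp := ltW be0.
have m1 : (2^-1 * rho p) * nf p s <= K * nf p s by apply: mono => //; rewrite /K; lra.
have m2 : (2^-1 * alpha p + 1) * nVx p s <= K * nVx p s by apply: mono => //; rewrite /K; lra.
have m3 : (2^-1 * beta p + G2) * nPx p s <= K * nPx p s by apply: mono => //; rewrite /K; lra.
have m4 : (2^-1 * mu p) * ng p s <= K * ng p s by apply: mono => //; rewrite /K; lra.
have m5 : (k1 + k2 + k3) * dissip p s <= K * dissip p s by apply: mono => //; rewrite /K; lra.
rewrite /snap_energy; move: y t1 t2 t3 m1 m2 m3 m4 m5.
move: (dissip p s) (nVx p s) (nf p s) (nPx p s) (ng p s) => Dd B A C G.
move: (ip D (sVx s) (sPx s)) (ip D (sth s) (sth s)) => Y T.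
by move=> *; lra.
Qed.

(** The multiplier functionals are controlled by the energy. *)
Lemma functionals_le : exists2 K : R, 0 <= K & forall s, regular p s ->
  [/\ `|F1 s| <= K * snap_energy s, `|F2 s| <= K * snap_energy s,
      `|F3 s| <= K * snap_energy s & `|F4 s| <= K * snap_energy s].
Proof.
have [K K0 HK] := energy_controls.
pose H (q : R) := (L ^+ 2 + q ^+ 2 / (4 * 1)) * K.
have H0 q : 0 <= H q by rewrite mulr_ge0// addr_ge0 ?sqr_ge0// divr_ge0 ?sqr_ge0// mulr1.
pose q1 := c p * rho p; pose q2 := rho p; pose q3 := gamma p * mu p; pose q4 := mu p.
exists (H q1 + H q2 + H q3 + H q4); first by rewrite addr_ge0// addr_ge0// addr_ge0.
move=> s r; have [[hA hB hC hG hT] E0] := HK s r; set E := snap_energy s in hA hB hC hG hT E0 *.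
have hV := sqi_ac L0 (rV r); have hP := sqi_ac L0 (rP r).
have hf := sqi_ac L0 (rf r); have hg := sqi_ac L0 (rg r).
have aT := ac_prim_th hp r; have hTh := sqi_ac L0 aT.
have [pV _] := poincare hp (rV r) (rV0 r); have [pP _] := poincare hp (rP r) (rP0 r).
have [pT _] := poincare hp aT (prim0 _).
have gen (q : R) u v : sqi D u -> sqi D v -> ip D u u <= L ^+ 2 * (K * E) ->
    ip D v v <= K * E -> `|q * ip D u v| <= H q * E.
  move=> su sv hu hv; apply: (le_trans (young_scaled mD q ltr01 su sv)).
  have -> : H q * E = L ^+ 2 * (K * E) + q ^+ 2 / (4 * 1) * (K * E).
    by rewrite /H; ring.
  rewrite mul1r; apply: lerD => //.
  by rewrite ler_wpM2l// divr_ge0 ?sqr_ge0// mulr1.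
have LL z : z <= K * E -> L ^+ 2 * z <= L ^+ 2 * (K * E).
  by move=> h; rewrite ler_wpM2l ?sqr_ge0.
have bT : ip D (prim (sth s)) (prim (sth s)) <= L ^+ 2 * (K * E).
  by apply: (le_trans pT); exact: LL.
have bV : ip D (sV s) (sV s) <= L ^+ 2 * (K * E) by apply: (le_trans pV); exact: LL.
have bP : ip D (sP s) (sP s) <= L ^+ 2 * (K * E) by apply: (le_trans pP); exact: LL.
have HE q : 0 <= H q * E by rewrite mulr_ge0.
have g1 := gen q1 _ _ hTh hf bT hA.
have g2 := gen q2 _ _ hV hf bV hA.
have g3 := gen q3 _ _ hV hg bV hG.
have g4 := gen q2 _ _ hP hf bP hA.
have g5 := gen q4 _ _ hP hg bP hG.
have e1 := HE q1; have e2 := HE q2; have e3 := HE q3; have e4 := HE q4.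
rewrite !mulrDl; split.
- by rewrite -/q1; apply: (le_trans g1); lra.
- rewrite /F2 (ipC D (sf s)) (ipC D (sg s)); apply: (le_trans (ler_normD _ _)).
  by apply: (le_trans (lerD g2 g3)); lra.
- by rewrite /F3 mulNr normrN (ipC D (sf s)); apply: (le_trans g4); lra.
- by rewrite /F4 mulNr normrN (ipC D (sg s)); apply: (le_trans g5); lra.
Qed.

End Lyapunov.

Section Decay.
Context {R : realType}.
Variable p : params R.
Hypothesis hp : admissible p.

(** Exponential decay of the energy of a trajectory of snapshots. *)
Lemma snapshot_decay : exists M w : R, [/\ 0 < M, 0 < w &
  forall S : R -> snapshot R, (forall t, 0 <= t -> regular p (S t)) ->
  (forall t, 0 < t -> solves p (S t)) -> evolves p S ->
  forall t, 0 <= t ->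
    snap_energy p (S t) <= M * snap_energy p (S 0) * expR (- w * t)].
Proof.
have [[rh0 _ al1 be0 ga0] [[mu0 _ _ _] [[_ de0 _ _] _]]] := hp.
have [Kd Kd0 HE] := dissipation hp.
have [KE KE0 HKE] := energy_le hp.
have [KF KF0 HKF] := functionals_le hp.
have [KC _ HKC] := energy_controls hp.
have [K4 K40 H4] := dF4_le hp.
(* each weight absorbs the terms produced by the functionals after it *)
pose gb := gamma p * beta p; have gb0 : 0 < gb by rewrite mulr_gt0.
pose N3 := 2 * (K4 + 1) / gb.
have N30 : 0 < N3 by rewrite divr_gt0// mulr_gt0// ltr_wpDl.
pose e3 := mu p / (4 * N3); have e30 : 0 < e3 by rewrite divr_gt0// mulr_gt0.
have [K3 K30 H3] := dF3_le hp e30.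
have NK3 : 0 <= N3 * K3 by rewrite mulr_ge0// ltW.
pose N2 := 2 * (K4 + N3 * K3 + 1) / alpha1 p.
have N20 : 0 < N2 by rewrite divr_gt0// mulr_gt0// ltr_wpDl// addr_ge0.
pose e2 := mu p / (4 * N2); have e20 : 0 < e2 by rewrite divr_gt0// mulr_gt0.
have [K2 K20 H2] := dF2_le hp e20.
have NK2 : 0 <= N2 * K2 by rewrite mulr_ge0// ltW.
pose dr := delta p * rho p; have dr0 : 0 < dr by rewrite mulr_gt0.
pose N1 := 2 * (N3 * K3 + N2 * K2 + 1) / dr.
have N10 : 0 < N1 by rewrite divr_gt0// mulr_gt0// ltr_wpDl// addr_ge0.
pose e1 := (2 * N1)^-1; have e10 : 0 < e1 by rewrite invr_gt0 mulr_gt0.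
have [K1 K10 H1] := dF1_le hp e10.
have NK1 : 0 <= N1 * K1 by rewrite mulr_ge0// ltW.
pose Q := KF * (N1 + N2 + N3 + 1).
have Q0 : 0 <= Q by rewrite mulr_ge0//; lra.
pose J := (K4 + N3 * K3 + N2 * K2 + N1 * K1 + 1) / Kd.
have J0 : 0 < J by apply: divr_gt0 => //; lra.
pose N := J + Q + 1.
pose F s := N * snap_energy p s + N1 * F1 p s + N2 * F2 p s + N3 * F3 p s + F4 p s.
pose F' s := N * dE p s + N1 * dF1 p s + N2 * dF2 p s + N3 * dF3 p s + dF4 p s.
pose c0 := Num.min 2^-1 (2^-1 * mu p).
have c00 : 0 < c0 by rewrite lt_min; apply/andP; split; [lra|rewrite mulr_gt0].
have Fbnd s : regular p s -> snap_energy p s <= F s <= (N + Q) * snap_energy p s.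
  move=> r; have [b1 b2 b3 b4] := HKF s r; have [_ E0] := HKC s r.
  have m1 := ler_wpM2l (ltW N10) b1; have m2 := ler_wpM2l (ltW N20) b2.
  have m3 := ler_wpM2l (ltW N30) b3.
  have i1 := ler_norm (N1 * F1 p s); have i2 := ler_norm (N2 * F2 p s).
  have i3 := ler_norm (N3 * F3 p s); have i4 := ler_norm (F4 p s).
  have j1 := ler_norm (- (N1 * F1 p s)); have j2 := ler_norm (- (N2 * F2 p s)).
  have j3 := ler_norm (- (N3 * F3 p s)); have j4 := ler_norm (- F4 p s).
  have nn (q x : R) : 0 < q -> `|q * x| = q * `|x| by move=> q0; rewrite normrM gtr0_norm.
  rewrite normrN (nn _ _ N10) in j1; rewrite normrN (nn _ _ N20) in j2.
  rewrite normrN (nn _ _ N30) in j3; rewrite normrN in j4.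
  rewrite (nn _ _ N10) in i1; rewrite (nn _ _ N20) in i2; rewrite (nn _ _ N30) in i3.
  have QE : Q * snap_energy p s = N1 * (KF * snap_energy p s) +
    N2 * (KF * snap_energy p s) + N3 * (KF * snap_energy p s) + KF * snap_energy p s.
    by rewrite /Q; ring.
  have JE : 0 <= J * snap_energy p s by rewrite mulr_ge0// ltW.
  have NE : N * snap_energy p s = J * snap_energy p s + Q * snap_energy p s + snap_energy p s.
    by rewrite /N; ring.
  rewrite /F [(N + Q) * _]mulrDl NE QE.
  move: m1 m2 m3 b4 i1 i2 i3 i4 j1 j2 j3 j4 JE E0.
  move: (N1 * `|F1 p s|) (N2 * `|F2 p s|) (N3 * `|F3 p s|) `|F4 p s| => a1 a2 a3 a4.
  move: (N1 * F1 p s) (N2 * F2 p s) (N3 * F3 p s) (F4 p s) => f1 f2 f3 f4.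
  by move=> *; apply/andP; split; lra.
have F'le s : regular p s -> solves p s -> F' s <=
    - c0 * (nf p s + nVx p s + nPx p s + ng p s + dissip p s).
  move=> r e; have d0 := dissip_ge0 hp s.
  have Af := nf_ge0 p s; have Bf := nVx_ge0 p s; have Cf := nPx_ge0 p s.
  have Gf := ng_ge0 p s.
  have h4 := H4 s r e; have h3 := ler_wpM2l (ltW N30) (H3 s r e).
  have h2 := ler_wpM2l (ltW N20) (H2 s r e); have h1 := ler_wpM2l (ltW N10) (H1 s r e).
  have h0 : N * dE p s <= - (J * Kd) * dissip p s.
    have dE0 : dE p s <= 0 by apply: le_trans (HE s r e) _; rewrite mulNr oppr_le0 mulr_ge0// ltW.
    have NJ : N * dE p s <= J * dE p s by rewrite ler_wnM2r// /N; lra.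
    apply: (le_trans NJ); apply: (le_trans (ler_wpM2l (ltW J0) (HE s r e))).
    by rewrite mulrA mulrN.
  have JK : J * Kd = K4 + N3 * K3 + N2 * K2 + N1 * K1 + 1 by rewrite /J divfK ?gt_eqF.
  rewrite JK in h0.
  have q3 : N3 * (gb / 2) = K4 + 1 by rewrite /N3; field; rewrite gt_eqF.
  have q2 : N2 * (alpha1 p / 2) = K4 + N3 * K3 + 1 by rewrite /N2; field; rewrite gt_eqF.
  have q1 : N1 * (dr / 2) = N3 * K3 + N2 * K2 + 1 by rewrite /N1; field; rewrite gt_eqF.
  have n3 : N3 * e3 = 4^-1 * mu p by rewrite /e3; field; rewrite gt_eqF.
  have n2 : N2 * e2 = 4^-1 * mu p by rewrite /e2; field; rewrite gt_eqF.
  have n1 : N1 * e1 = 2^-1 by rewrite /e1; field; rewrite gt_eqF.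
  have g3 : N3 * dF3 p s <= - (K4 + 1) * nPx p s + 4^-1 * mu p * ng p s +
     N3 * K3 * (nf p s + nVx p s + dissip p s).
    by apply: (le_trans h3); rewrite -q3 -n3 -/gb le_eqVlt; apply/orP; left; apply/eqP; ring.
  have g2 : N2 * dF2 p s <= - (K4 + N3 * K3 + 1) * nVx p s + 4^-1 * mu p * ng p s +
     N2 * K2 * (nf p s + dissip p s).
    by apply: (le_trans h2); rewrite -q2 -n2 le_eqVlt; apply/orP; left; apply/eqP; ring.
  have g1 : N1 * dF1 p s <= - (N3 * K3 + N2 * K2 + 1) * nf p s +
     2^-1 * (nVx p s + nPx p s) + N1 * K1 * dissip p s.
    by apply: (le_trans h1); rewrite -q1 -n1 -/dr le_eqVlt; apply/orP; left; apply/eqP; ring.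
  have m1 : c0 <= 2^-1 by rewrite /c0 ge_min lexx.
  have m2 : c0 <= 2^-1 * mu p by rewrite /c0 ge_min lexx orbT.
  have c1 := ler_wpM2r Af m1; have c2 := ler_wpM2r Bf m1; have c3 := ler_wpM2r Cf m1.
  have c4 := ler_wpM2r Gf m2; have c5 := ler_wpM2r d0 m1.
  rewrite /F'; move: g1 g2 g3 h4 h0 c1 c2 c3 c4 c5 d0 Af Bf Cf Gf.
  move: (nf p s) (nVx p s) (nPx p s) (ng p s) (dissip p s) => A B C G Dd.
  move: (N1 * K1) (N2 * K2) (N3 * K3) => k1 k2 k3.
  move: (N * dE p s) (N1 * dF1 p s) (N2 * dF2 p s) (N3 * dF3 p s) (dF4 p s) => f0 f1 f2 f3 f4.
  by move=> *; lra.
have NQ : 0 < N + Q by rewrite /N; lra.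
exists (N + Q), (c0 / (KE * (N + Q))); split => //.
  by rewrite divr_gt0// mulr_gt0.
set w := c0 / _ => S hr hs hS t t0.
have decay : F (S t) <= F (S 0) * expR (- w * t).
  apply: (@tdiff_exp_decay R (fun t => F (S t)) (fun t => F' (S t)) w) => //.
    move=> u u0; apply: tdiffD; last exact: tdiff_F4.
    apply: tdiffD; last by apply: tdiffZ; exact: tdiff_F3.
    apply: tdiffD; last by apply: tdiffZ; exact: tdiff_F2.
    apply: tdiffD; last by apply: tdiffZ; exact: tdiff_F1.
    by apply: tdiffZ; exact: tdiff_energy.
  move=> u u0; have r := hr u (ltW u0).
  apply: (le_trans (F'le _ r (hs u u0))).
  have /andP[_ f2] := Fbnd _ r.
  rewrite !mulNr lerN2 /w -mulrA ler_wpM2l ?(ltW c00)//.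
  rewrite ler_pdivrMl ?mulr_gt0//; apply: (le_trans f2).
  rewrite (mulrC KE) -mulrA ler_wpM2l ?(ltW NQ)//.
  exact: HKE.
have /andP[f1 _] := Fbnd _ (hr t t0); apply: (le_trans f1); apply: (le_trans decay).
have /andP[_ f2] := Fbnd _ (hr 0 (lexx 0)).
by rewrite ler_wpM2r ?expR_ge0.
Qed.

End Decay.

(** * Real and imaginary parts of complex fields *)

Section Parts.
Context {R : realType}.
Local Notation leb := (@lebesgue_measure R).
Implicit Types (z : Rcomplex R) (F G : field R) (D : set R) (b : bool).

(** The real part ([b = false]) or the imaginary part ([b = true]). *)
Definition part b z : R := if b then complex.Im z else complex.Re z.
Definition fpart b F : R -> R := fun x => part b (F x).

Lemma partD b z1 z2 : part b (z1 + z2) = part b z1 + part b z2.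
Proof. by case: b; case: z1 => ? ?; case: z2 => ? ?. Qed.
Lemma partN b z : part b (- z) = - part b z.
Proof. by case: b; case: z => ? ?. Qed.
Lemma partB b z1 z2 : part b (z1 - z2) = part b z1 - part b z2.
Proof. by rewrite partD partN. Qed.
Lemma partZ b (r : R) z : part b (r *: z) = r * part b z.
Proof. by case: b; case: z => ? ?. Qed.
Lemma part0 b : part b (0 : Rcomplex R) = 0.
Proof. by case: b. Qed.

Lemma part_eq0_3 b (a1 a2 a3 : R) z1 z2 z3 :
  a1 *: z1 - a2 *: z2 + a3 *: z3 = 0 ->
  a1 * part b z1 - a2 * part b z2 + a3 * part b z3 = 0.
Proof.
by move=> E; rewrite -!(partZ b) -partN -!partD E part0.
Qed.

Lemma part_eq0_4 b (a1 a2 a3 a4 : R) z1 z2 z3 z4 :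
  a1 *: z1 - a2 *: z2 + a3 *: z3 + a4 *: z4 = 0 ->
  a1 * part b z1 - a2 * part b z2 + a3 * part b z3 + a4 * part b z4 = 0.
Proof.
by move=> E; rewrite -!(partZ b) -partN -!partD E part0.
Qed.

Lemma part_eqN b (a1 a2 a3 : R) z1 z2 z3 :
  a1 *: z1 - a2 *: z2 = - (a3 *: z3) ->
  a1 * part b z1 - a2 * part b z2 = - (a3 * part b z3).
Proof. by move=> E; rewrite -!(partZ b) -!partN -partD E. Qed.

Lemma part_inj z1 z2 : (forall b, part b z1 = part b z2) -> z1 = z2.
Proof.
move=> H; have := H true; have := H false; rewrite /part.
by case: z1 {H} => ? ?; case: z2 => ? ? /= -> ->.
Qed.

Lemma abs2E z : abs2 z = part false z ^+ 2 + part true z ^+ 2.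
Proof. by []. Qed.

Lemma abs2_ge0 z : 0 <= abs2 z.
Proof. by rewrite addr_ge0 ?sqr_ge0. Qed.

Lemma part_sq_le b z : part b z ^+ 2 <= abs2 z.
Proof. by rewrite abs2E; case: b; rewrite ?lerDl ?lerDr sqr_ge0. Qed.

Lemma part_cintegral b D F : part b (cintegral D F) = \int[leb]_(x in D) fpart b F x.
Proof. by case: b. Qed.

Lemma L2_sqi D (mD : measurable D) F b : L2 D F -> sqi D (fpart b F).
Proof.
move=> [mr mi fin].
have mb : measurable_fun D (fpart b F) by case: b.
apply: sqiP => //; apply: le_lt_trans fin.
apply: ge0_le_integral => //.
- by move=> x _; rewrite lee_fin sqr_ge0.
- by apply/measurable_EFinP; exact: measurable_funX.
- by apply/measurable_EFinP; apply: measurable_funD; exact: measurable_funX.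
- by move=> x _; rewrite lee_fin part_sq_le.
Qed.

Lemma sqi_L2 D (mD : measurable D) F : (forall b, sqi D (fpart b F)) -> L2 D F.
Proof.
move=> H; have [mr ir] := H false; have [mi ii] := H true; split => //.
have : leb.-integrable D ((EFin \o (fun x => fpart false F x ^+ 2)%R) \+
    (EFin \o (fun x => fpart true F x ^+ 2)%R))%E by apply: integrableD.
move=> /integrableP[_]; apply: le_lt_trans.
rewrite /L2sq le_eqVlt; apply/orP; left; apply/eqP.
apply: eq_integral => x _ /=.
by rewrite ger0_norm ?addr_ge0 ?sqr_ge0.
Qed.

Lemma L2sq_part D (mD : measurable D) F b : L2 D F ->
  ((ip D (fpart b F) (fpart b F))%:E <= L2sq D F)%E.
Proof.
move=> hF; have [mr mi fin] := hF; have s := L2_sqi mD b hF.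
rewrite /ip /Rintegral fineK; last first.
  by apply: integrable_fin_num => //; exact: sqi_intM.
apply: ge0_le_integral => //.
- by move=> x _; rewrite lee_fin -expr2 sqr_ge0.
- by apply/measurable_EFinP; case: s => m _; exact: measurable_funM.
- by apply/measurable_EFinP; apply: measurable_funD; exact: measurable_funX.
- by move=> x _; rewrite lee_fin -expr2 part_sq_le.
Qed.

Lemma L2sq_ge0 D F : (0 <= L2sq D F)%E.
Proof. by apply: integral_ge0 => x _; rewrite lee_fin abs2_ge0. Qed.

Lemma fpart_ae D F G b : F = G %[ae leb in D] -> ae_eq leb D (fpart b F) (fpart b G).
Proof.
apply: filterS; first exact: (ae_filter_ringOfSetsType leb).
by move=> x /[apply]; rewrite /fpart => ->.
Qed.

Lemma ae_fpart D F G : (forall b, ae_eq leb D (fpart b F) (fpart b G)) ->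
  F = G %[ae leb in D].
Proof.
move=> H; have h0 := H false; have h1 := H true; move: h0 h1; apply: filterS2.
by move=> x h0 h1 Dx; apply: part_inj => -[]; [exact: h1|exact: h0].
Qed.

Lemma L2sq_ae D (mD : measurable D) F G : L2 D F -> L2 D G ->
  F = G %[ae leb in D] -> L2sq D F = L2sq D G.
Proof.
move=> [m1 m2 _] [m3 m4 _] FG; apply: ae_eq_integral => //.
- by apply/measurable_EFinP; apply: measurable_funD; exact: measurable_funX.
- by apply/measurable_EFinP; apply: measurable_funD; exact: measurable_funX.
- move: FG; apply: filterS; first exact: (ae_filter_ringOfSetsType leb).
  by move=> x /[apply] ->.
Qed.

Variable L : R.
Hypothesis L0 : 0 < L.
Let mD : measurable (dom L) := measurable_dom L.

Lemma is_wderiv_wd F G b : L2 (dom L) F -> is_wderiv L F G ->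
  wd L (fpart b F) (fpart b G).
Proof.
move=> hF [hG H]; split; [exact: L2_sqi|exact: L2_sqi|].
move=> phi tphi; have := congr1 (part b) (H phi tphi).
rewrite partN !part_cintegral /ip /fpart.
by under eq_Rintegral do rewrite partZ; under [in X in - X]eq_Rintegral do rewrite partZ.
Qed.

Lemma wd_is_wderiv F G : (forall b, wd L (fpart b F) (fpart b G)) ->
  L2 (dom L) F /\ is_wderiv L F G.
Proof.
move=> H; split; first by apply: sqi_L2 => // b; case: (H b).
split; first by apply: sqi_L2 => // b; case: (H b).
move=> phi tphi; apply: part_inj => b; have [_ _ /(_ phi tphi)] := H b.
rewrite partN !part_cintegral /ip /fpart.
by under [in X in _ -> X = _]eq_Rintegral do rewrite partZ;
  under [in X in _ -> _ = - X]eq_Rintegral do rewrite partZ.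
Qed.

Lemma H1_wderiv F : H1 L F -> is_wderiv L F (wderiv L F).
Proof. by move=> [_ /(@xgetPex _ 0)]. Qed.

Lemma H1_wd F b : H1 L F -> wd L (fpart b F) (fpart b (wderiv L F)).
Proof. by move=> hF; apply: is_wderiv_wd (H1_wderiv hF); case: hF. Qed.

(** The weak derivative selected by [wderiv] agrees with any other one. *)
Lemma wd_H1 F G : (forall b, wd L (fpart b F) (fpart b G)) ->
  H1 L F /\ wderiv L F = G %[ae leb in dom L].
Proof.
move=> H; have [hF hG] := wd_is_wderiv H.
have h1 : H1 L F by split => //; exists G.
split => //; apply: ae_fpart => b; exact: (wd_unique L0 (H1_wd b h1) (H b)).
Qed.

Lemma crep_exists F : H1 L F -> exists h, is_crep L F h.
Proof.
move=> hF; have [h0 [a0 e0 c0]] := wd_representative L0 (H1_wd false hF).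
have [h1 [a1 e1 c1]] := wd_representative L0 (H1_wd true hF).
exists (fun x => Complex (h0 x) (h1 x)); split => //.
apply: filterS2 e0 e1 => x E0 E1 Dx; apply: part_inj => -[] /=.
  by rewrite -E1.
by rewrite -E0.
Qed.

Lemma trace_crep F : H1 L F -> is_crep L F (trace L F).
Proof. by move=> /crep_exists /(@xgetPex _ 0). Qed.

Lemma trace_ae F b : H1 L F -> ae_eq leb (dom L) (fpart b (trace L F)) (fpart b F).
Proof. by move=> /trace_crep[_ _] /(@fpart_ae _ _ _ b). Qed.

(** The trace is the absolutely continuous representative. *)
Lemma trace_ac F b : H1 L F -> ac L (fpart b (trace L F)) (fpart b (wderiv L F)).
Proof.
move=> hF; have [h [[sg ah] eh ch]] := wd_representative L0 (H1_wd b hF).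
have ct : {within `[0, L], continuous (fpart b (trace L F))}.
  by case: (trace_crep hF) => cr ci _; case: b {h sg ah eh ch}.
have e : ae_eq leb (dom L) (fpart b (trace L F)) h.
  by apply: filterS2 (trace_ae b hF) eh => x E1 E2 Dx; rewrite (E1 Dx); exact: E2.
have E := continuous_ae_eq L0 ct ch e.
split => // x xL; rewrite (E x xL) (ah x xL) (E 0)//.
by rewrite lexx ltW.
Qed.

Lemma ac_ae h g g' : ac L h g -> sqi (dom L) g' -> ae_eq leb (dom L) g g' -> ac L h g'.
Proof.
move=> [sg H] sg' e; split => // x xL; rewrite (H x xL); congr (_ + _).
have xL' : x <= L by case/andP: xL.
rewrite /prim /Rintegral; congr fine; apply: ae_eq_integral => //.
- by have [m _] := integrableP _ _ _ (integrable_sub_dom L0 xL' sg).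
- by have [m _] := integrableP _ _ _ (integrable_sub_dom L0 xL' sg').
- apply: filterS e => y E; rewrite /= in_itv /= => /andP[y0 yx].
  by rewrite E// /dom /= in_itv /= y0 (lt_le_trans yx).
Qed.

Lemma H2_ac F b : H2 L F ->
  ac L (fpart b (trace L F)) (fpart b (trace L (wderiv L F))).
Proof.
move=> [h1 h2]; have a2 := trace_ac b h2.
apply: ac_ae (trace_ac b h1) (sqi_ac L0 a2) _.
by apply: filterS (trace_ae b h2) => x /[apply].
Qed.

End Parts.

(** * Reduction to real snapshots *)

(* Keeps conversion from unfolding the choice behind these two operators. *)
#[local] Opaque wderiv trace.

(* The equations of the system, solved for the time derivatives. *)
Fact solve_4 (R : realType) (q1 q2 q3 q4 y1 y2 y3 y4 : R) :
  q1 * y1 - q2 * y2 + q3 * y3 + q4 * y4 = 0 ->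
  q1 * y1 = 1 * (q2 * y2 + (- q3) * y3) + (- q4) * y4.
Proof. by lra. Qed.

Fact solve_3 (R : realType) (q1 q2 q3 y1 y2 y3 : R) : q1 * y1 - q2 * y2 + q3 * y3 = 0 ->
  q1 * y1 = q2 * y2 + (- q3) * y3.
Proof. by lra. Qed.

Fact solve_phi (R : realType) (q v y1 y2 y3 : R) : 1 * y1 - (- q) * y2 + (- v) * y3 = 0 ->
  y1 = - (q * y2) + y3 * v.
Proof. by lra. Qed.

Fact density_split (R : realType) (q1 q2 q3 q4 r q5 : R) (z1 z2 z3 z4 z5 : Rcomplex R) :
  let q b := q1 * (part b z1 * part b z1) + q2 * (part b z2 * part b z2)
    + q3 * (part b z3 * part b z3)
    + q4 * ((r * part b z2 + (-1) * part b z4) * (r * part b z2 + (-1) * part b z4))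
    + q5 * (part b z5 * part b z5) in
  q1 * abs2 z1 + q2 * abs2 z2 + q3 * abs2 z3 + q4 * abs2 (r *: z2 - z4) + q5 * abs2 z5 =
  q false + q true.
Proof. by rewrite /= !abs2E !partB !partZ; ring. Qed.

Fact memory_split (R : realType) (q1 q2 : R) (z1 z2 : Rcomplex R) :
  let q b := q1 * (part b z1 * part b z1) + q2 * (part b z2 * part b z2) in
  q1 * abs2 z1 + q2 * abs2 z2 = q false + q true.
Proof. by rewrite /= !abs2E; ring. Qed.

Fact energy_split (R : realType) (q1 q2 q3 q4 r q5 s A A' B B' C C' G G' T T' Y Y' Z Z' : R) :
  2^-1 * ((q1 * A + q2 * B + q3 * G + q4 * (r ^+ 2 * B + 2 * r * -1 * Y + (-1) ^+ 2 * C) + q5 * T)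
    + (q1 * A' + q2 * B' + q3 * G' + q4 * (r ^+ 2 * B' + 2 * r * -1 * Y' + (-1) ^+ 2 * C')
      + q5 * T')) + s / (2 * pi) * (Z + Z') =
  2^-1 * (q1 * A + (q2 + r ^+ 2 * q4) * B + q3 * G + q4 * C - 2 * (r * q4) * Y + q5 * T)
    + s / pi / 2 * Z
  + (2^-1 * (q1 * A' + (q2 + r ^+ 2 * q4) * B' + q3 * G' + q4 * C' - 2 * (r * q4) * Y'
    + q5 * T') + s / pi / 2 * Z').
Proof.
have pi0 : pi != 0 :> R by rewrite gt_eqF ?pi_gt0.
by move: (pi : R) pi0 => r0 r0N; field.
Qed.

Section Reduction.
Context {R : realType}.
Local Notation leb := (@lebesgue_measure R).
Variable p : params R.
Hypothesis hp : admissible p.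
Local Notation L := (len p).
Local Notation D := (dom L).
Implicit Types (u w : state R) (F G : field R) (b : bool) (t : R).

Let L0 : 0 < L. Proof. by case: hp => _ [[]]. Qed.
Let mD : measurable D := measurable_dom L.
Let mT : measurable [set: R] := measurableT.

(** The real or imaginary parts of the state [u] with time derivative [w], in
    terms of continuous representatives wherever they exist. *)
Definition snap b u w : snapshot R :=
  let: (V, f, phi1, P, g, phi2, th) := u in
  let: (_, ft, phi1t, _, gt, phi2t, tht) := w in
  let r F := fpart b (trace L F) in
  Snapshot
    (r V) (r (wderiv L V)) (fpart b (wderiv L (wderiv L V)))
    (r f) (fpart b (wderiv L f)) (fpart b ft)
    (r P) (r (wderiv L P)) (fpart b (wderiv L (wderiv L P)))
    (r g) (fpart b (wderiv L g)) (fpart b gt)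
    (r th) (r (wderiv L th)) (fpart b (wderiv L (wderiv L th))) (fpart b tht)
    (fpart b phi1) (fpart b phi1t) (fpart b phi2) (fpart b phi2t).

Lemma fpart_xi_phi b F : fpart b (xi_phi F) = weighted (fpart b F).
Proof. by apply/funext => xi; rewrite /fpart /xi_phi /weighted partZ. Qed.

Lemma part_memory b F : part b (memory p F) = kappa p * ip setT (varpi p) (fpart b F).
Proof.
rewrite /memory partZ part_cintegral /ip /fpart; congr (_ * _).
by apply: eq_Rintegral => xi _; rewrite partZ.
Qed.

Lemma regular_snap b u w : inD p u -> inH p w -> regular p (snap b u w).
Proof.
case: u => [[[[[[V f] phi1] P] g] phi2] th].
case: w => [[[[[[Vt ft] phi1t] Pt] gt] phi2t] tht].
move=> [[[[hV V0] hf hphi1] [[[hP P0] hg hphi2] hth]]].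
move=> [[h2V h2P [h1f f0] [h1g g0]] [[h2th thx0 thL]]].
move=> [[wphi1 wphi2 _ _] [S1 S2]].
move=> [[_ hft hphi1t] [[_ hgt hphi2t] htht]].
have tr0 F (x : R) : trace L F x = 0 -> fpart b (trace L F) x = 0.
  by move=> h; rewrite /fpart h part0.
split; rewrite /=; try by [exact: H2_ac | exact: trace_ac | exact: tr0 | exact: L2_sqi].
- by apply: trace_ac => //; case: h2V.
- by apply: trace_ac => //; case: h2P.
- by apply: trace_ac => //; case: h2th.
- by rewrite -fpart_xi_phi; exact: L2_sqi.
- by rewrite -fpart_xi_phi; exact: L2_sqi.
- by rewrite -part_memory; exact: (part_eqN b S1).
- by rewrite -part_memory; exact: (part_eqN b S2).
Qed.

Lemma solves_snap b u w : inD p u -> equations p u w -> solves p (snap b u w).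
Proof.
case: u => [[[[[[V f] phi1] P] g] phi2] th].
case: w => [[[[[[Vt ft] phi1t] Pt] gt] phi2t] tht].
move=> [_ [_ [[[_ h2th] _ _] _]]].
move=> [[eq1 eq2 eq3] [eq4 eq5]].
have tx := trace_ae L0 b h2th.
split; rewrite /=.
- move: eq1 tx; apply: filterS2.
    exact: (ae_filter_ringOfSetsType leb).
  move=> x E T Dx.
  have {}E : rho p *: ft x - alpha p *: wderiv L (wderiv L V) x
      + (gamma p * beta p) *: wderiv L (wderiv L P) x + delta p *: wderiv L th x = 0.
    exact: E Dx.
  by rewrite (T Dx); exact: solve_4 (part_eq0_4 b E).
- move: eq2; apply: filterS; first exact: (ae_filter_ringOfSetsType leb).
  move=> x E Dx.
  have {}E : mu p *: gt x - beta p *: wderiv L (wderiv L P) x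
      + (gamma p * beta p) *: wderiv L (wderiv L V) x = 0.
    exact: E Dx.
  exact: solve_3 (part_eq0_3 b E).
- move: eq3; apply: filterS; first exact: (ae_filter_ringOfSetsType leb).
  move=> x E Dx.
  have {}E : c p *: tht x - k p *: wderiv L (wderiv L th) x
      + delta p *: wderiv L f x = 0.
    exact: E Dx.
  exact: solve_3 (part_eq0_3 b E).
- move: eq4; apply: filterS; first exact: (ae_filter_ringOfSetsType leb).
  move=> xi E Dx.
  have {}E : 1 *: phi1t xi - (- (xi ^+ 2 + eta p)) *: phi1 xi
      + (- varpi p xi) *: trace L f L = 0.
    rewrite scale1r scaleNr opprK scaleNr; exact: E Dx.
  exact: solve_phi (part_eq0_3 b E).
- move: eq5; apply: filterS; first exact: (ae_filter_ringOfSetsType leb).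
  move=> xi E Dx.
  have {}E : 1 *: phi2t xi - (- (xi ^+ 2 + eta p)) *: phi2 xi
      + (- varpi p xi) *: trace L g L = 0.
    rewrite scale1r scaleNr opprK scaleNr; exact: E Dx.
  exact: solve_phi (part_eq0_3 b E).
Qed.

(** The integral of the energy density in terms of inner products. *)
Lemma integral_energy_density (f v w g th : R -> R) :
  sqi D f -> sqi D v -> sqi D w -> sqi D g -> sqi D th ->
  let q := fun x => rho p * (f x * f x) + alpha1 p * (v x * v x) + mu p * (g x * g x)
    + beta p * ((gamma p * v x + (-1) * w x) * (gamma p * v x + (-1) * w x))
    + c p * (th x * th x) in
  leb.-integrable D (EFin \o q) /\
  \int[leb]_(x in D) q x = rho p * ip D f f + alpha1 p * ip D v v + mu p * ip D g g
    + beta p * (gamma p ^+ 2 * ip D v v + 2 * gamma p * -1 * ip D v w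
      + (-1) ^+ 2 * ip D w w)
    + c p * ip D th th.
Proof.
move=> sf sv sw sg sth.
have iZ (r : R) h1 h2 : sqi D h1 -> sqi D h2 ->
    leb.-integrable D (EFin \o (fun x => r * (h1 x * h2 x))).
  move=> a1 a2; have := sqi_intM mD (sqiZ mD r a1) a2.
  by under eq_fun do rewrite -mulrA.
have iD (h1 h2 : R -> R) : leb.-integrable D (EFin \o h1) -> leb.-integrable D (EFin \o h2) ->
    leb.-integrable D (EFin \o (fun x => h1 x + h2 x)).
  move=> a1 a2; rewrite (_ : _ \o _ = (EFin \o h1) \+ (EFin \o h2))%E; last by apply/funext.
  exact: integrableD.
have sW := sqi_lin2 mD (gamma p) (-1) sv sw.
have i1 := iZ (rho p) _ _ sf sf; have i2 := iZ (alpha1 p) _ _ sv sv.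
have i3 := iZ (mu p) _ _ sg sg; have i4 := iZ (beta p) _ _ sW sW.
have i5 := iZ (c p) _ _ sth sth.
have i12 := iD _ _ i1 i2; have i123 := iD _ _ i12 i3; have i1234 := iD _ _ i123 i4.
split; first exact: (iD _ _ i1234 i5).
have Z (r : R) h1 h2 : sqi D h1 -> sqi D h2 ->
    \int[leb]_(x in D) (r * (h1 x * h2 x)) = r * ip D h1 h2.
  by move=> a1 a2; rewrite /ip RintegralZl//; exact: sqi_intM.
have RD (h1 h2 : R -> R) : leb.-integrable D (EFin \o h1) -> leb.-integrable D (EFin \o h2) ->
    \int[leb]_(x in D) (h1 x + h2 x) =
    \int[leb]_(x in D) h1 x + \int[leb]_(x in D) h2 x.
  by move=> a1 a2; rewrite RintegralD.
rewrite -(ip_sq_lin2 mD (gamma p) (-1) sv sw).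
rewrite (RD _ _ i1234 i5) (RD _ _ i123 i4) (RD _ _ i12 i3) (RD _ _ i1 i2).
by rewrite !Z.
Qed.

Lemma integral_memory_density (f g : R -> R) : sqi setT f -> sqi setT g ->
  let q := fun x => l1 p * (f x * f x) + l2 p * (g x * g x) in
  leb.-integrable setT (EFin \o q) /\
  \int[leb]_x q x = l1 p * ip setT f f + l2 p * ip setT g g.
Proof.
move=> sf sg.
have iZ (r : R) h1 h2 : sqi setT h1 -> sqi setT h2 ->
    leb.-integrable setT (EFin \o (fun x => r * (h1 x * h2 x))).
  move=> a1 a2; have := sqi_intM mT (sqiZ mT r a1) a2.
  by under eq_fun do rewrite -mulrA.
have i1 := iZ (l1 p) _ _ sf sf; have i2 := iZ (l2 p) _ _ sg sg.
split.
  rewrite /= (_ : _ \o _ = (EFin \o (fun x => l1 p * (f x * f x))) \+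
    (EFin \o (fun x => l2 p * (g x * g x))))%R; last by apply/funext.
  exact: integrableD.
by rewrite /ip -!RintegralZl//; [rewrite -RintegralD|exact: sqi_intM|exact: sqi_intM].
Qed.

Lemma integral_abs2_density (f v w g th : field R) :
  (forall b, sqi D (fpart b f)) -> (forall b, sqi D (fpart b v)) ->
  (forall b, sqi D (fpart b w)) -> (forall b, sqi D (fpart b g)) ->
  (forall b, sqi D (fpart b th)) ->
  let X b := rho p * ip D (fpart b f) (fpart b f) + alpha1 p * ip D (fpart b v) (fpart b v)
    + mu p * ip D (fpart b g) (fpart b g)
    + beta p * (gamma p ^+ 2 * ip D (fpart b v) (fpart b v)
      + 2 * gamma p * -1 * ip D (fpart b v) (fpart b w)
      + (-1) ^+ 2 * ip D (fpart b w) (fpart b w))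
    + c p * ip D (fpart b th) (fpart b th) in
  \int[leb]_(x in D) (rho p * abs2 (f x) + alpha1 p * abs2 (v x) + mu p * abs2 (g x)
    + beta p * abs2 (gamma p *: v x - w x) + c p * abs2 (th x)) = X false + X true.
Proof.
move=> sf sv sw sg sth X.
have [i0 E0] := integral_energy_density (sf false) (sv false) (sw false) (sg false) (sth false).
have [i1 E1] := integral_energy_density (sf true) (sv true) (sw true) (sg true) (sth true).
rewrite /X -E0 -E1 -RintegralD//; apply: eq_Rintegral => x _.
exact: density_split.
Qed.

Lemma integral_abs2_memory (f g : field R) :
  (forall b, sqi setT (fpart b f)) -> (forall b, sqi setT (fpart b g)) ->
  let Z b := l1 p * ip setT (fpart b f) (fpart b f) + l2 p * ip setT (fpart b g) (fpart b g) in
  \int[leb]_x (l1 p * abs2 (f x) + l2 p * abs2 (g x)) = Z false + Z true.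
Proof.
move=> sf sg Z.
have [i0 E0] := integral_memory_density (sf false) (sg false).
have [i1 E1] := integral_memory_density (sf true) (sg true).
rewrite /Z -E0 -E1 -RintegralD//; apply: eq_Rintegral => x _.
exact: memory_split.
Qed.

(** The energy is the sum of those of the real and the imaginary parts. *)
Lemma energy_snap u w : inD p u ->
  energy p u = snap_energy p (snap false u w) + snap_energy p (snap true u w).
Proof.
case: u => [[[[[[V f] phi1] P] g] phi2] th].
case: w => [[[[[[Vt ft] phi1t] Pt] gt] phi2t] tht].
move=> [[[[hV V0] hf hphi1] [[[hP P0] hg hphi2] hth]]].
move=> [[h2V h2P [h1f f0] [h1g g0]] [[h2th _ _] _]].
have sV b : sqi D (fpart b (wderiv L V)) by apply: L2_sqi => //; case: h2V => _ [].
have sP b : sqi D (fpart b (wderiv L P)) by apply: L2_sqi => //; case: h2P => _ [].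
have sf b : sqi D (fpart b f) by exact: L2_sqi.
have sg b : sqi D (fpart b g) by exact: L2_sqi.
have sth b : sqi D (fpart b th) by exact: L2_sqi.
have s1 b : sqi setT (fpart b phi1) by exact: L2_sqi.
have s2 b : sqi setT (fpart b phi2) by exact: L2_sqi.
have tip F b G : H1 L F -> H1 L G -> ip D (fpart b (trace L F)) (fpart b (trace L G)) =
    ip D (fpart b F) (fpart b G).
  move=> hF hG; apply: ip_ae => //; try exact: trace_ae.
  - by case: (sqi_ac L0 (trace_ac L0 b hF)).
  - by case: (L2_sqi mD b hF.1).
  - by case: (sqi_ac L0 (trace_ac L0 b hG)).
  - by case: (L2_sqi mD b hG.1).
have H1V := h2V.2; have H1P := h2P.2; have H1th := h2th.1.
have [_ [_ [_ [_ alE]]]] := hp.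
rewrite /energy (integral_abs2_density sf sV sP sg sth) (integral_abs2_memory s1 s2).
rewrite /snap_energy /nf /nVx /ng /nPx /kappa /=.
move: (ip D) tip (wderiv L V) (wderiv L P) H1V H1P {sV sP}.
move=> q tip Vx Px H1V H1P.
rewrite (tip f false f h1f h1f) (tip f true f h1f h1f).
rewrite (tip g false g h1g h1g) (tip g true g h1g h1g).
rewrite (tip th false th H1th H1th) (tip th true th H1th H1th).
rewrite (tip Vx false Vx H1V H1V) (tip Vx true Vx H1V H1V).
rewrite (tip Px false Px H1P H1P) (tip Px true Px H1P H1P).
rewrite (tip Vx false Px H1V H1P) (tip Vx true Px H1V H1P) alE.
exact: energy_split.
Qed.

End Reduction.

(** * Trajectories of snapshots *)


Section Trajectories.
Context {R : realType}.
Local Notation leb := (@lebesgue_measure R).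
Implicit Types (F G : field R) (b : bool) (t h : R).

(** Differentiability in L^2 of a curve of complex fields passes to its real
    and imaginary parts, whatever the representatives. *)
Lemma l2diff_fpart (A : set R) (mA : measurable A) b (u : R -> field R) (w : field R)
    (U : R -> R -> R) (U' : R -> R) (X : R -> \bar R) t : 0 <= t ->
  (forall s, 0 <= s -> L2 A (u s)) -> L2 A w ->
  (forall s, 0 <= s -> sqi A (U s)) -> sqi A U' ->
  (forall s, 0 <= s -> ae_eq leb A (U s) (fpart b (u s))) ->
  ae_eq leb A U' (fpart b w) ->
  (forall h, 0 <= t + h ->
    (L2sq A (fun x => h^-1 *: (u (t + h) x - u t x) - w x)%R <= X h)%E) ->
  X h @[h --> increments t] --> 0%E -> l2diff A U U' t.
Proof.
move=> t0 su sw sU sU' eU eU' le hX; rewrite /l2diff.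
have key : (ip A (dq_err U U' t h) (dq_err U U' t h))%:E @[h --> increments t] --> 0%:E.
  apply: (@squeeze_cvge _ _ _ _ (cst 0%E) _ _ _ _ _ hX); last exact: cvg_cst.
  near=> h; rewrite lee_fin ip_ge0 /=.
  have [h0 th] : h != 0 /\ 0 <= t + h by near: h; exact: near_increments.
  apply: (le_trans _ (le h th)).
  set q := (fun x => h^-1 *: _ - _).
  have sq d : sqi A (fpart d q).
    rewrite (_ : fpart d q = fun x =>
      h^-1 * (fpart d (u (t + h)) x - fpart d (u t) x) - fpart d w x).
      apply: sqiB => //; last exact: L2_sqi.
      by apply: sqiZ => //; apply: sqiB => //; apply: L2_sqi => //; exact: su.
    by apply/funext => x; rewrite /q /fpart partB partZ partB.
  have e : ae_eq leb A (dq_err U U' t h) (fpart b q).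
    have := eU _ th; have := eU _ t0; move: eU'; apply: filterS3.
    move=> x E1 E2 E3 Ax; rewrite /dq_err /q /fpart partB partZ partB.
    by rewrite (E1 Ax) (E2 Ax) (E3 Ax).
  rewrite (_ : ip _ _ _ = ip A (fpart b q) (fpart b q)).
    by apply: L2sq_part => //; exact: sqi_L2.
  have [m1 _] := sqi_dq_err mA t0 th sU sU'; have [m2 _] := sq b.
  exact: ip_ae.
by move/fine_cvgP: key => [].
Unshelve. all: by end_near. Qed.

Variable L : R.
Hypothesis L0 : 0 < L.
Local Notation D := (dom L).
Let mD : measurable D := measurable_dom L.

Lemma wd_lin2 (r s : R) (f f' g g' : R -> R) : wd L f f' -> wd L g g' ->
  wd L (fun x => r * f x + s * g x) (fun x => r * f' x + s * g' x).
Proof.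
move=> [sf sf' hf] [sg sg' hg]; split; [exact: sqi_lin2|exact: sqi_lin2|].
move=> phi tphi; have ap := test_function_ac tphi.
have sp := sqi_ac L0 ap; have [sp' _] := ap.
by rewrite !ip_lin2r// hf// hg//; ring.
Qed.

Lemma wd_ae (f f1 g : R -> R) : sqi D f1 -> ae_eq leb D f f1 -> wd L f g -> wd L f1 g.
Proof.
move=> s1 e [sf sg H]; split => // phi tphi; rewrite -(H phi tphi).
have [[m' _] _] := test_function_ac tphi.
have [m1 _] := s1; have [m _] := sf.
by apply: ip_ae => //; [exact: ae_eq_refl|exact: ae_eq_sym].
Qed.

(** The weak derivative of a difference quotient. *)
Lemma L2sq_wderiv_quotient F G W h : H1 L F -> H1 L G -> H1 L W ->
  L2sq D (fun x => h^-1 *: (wderiv L F x - wderiv L G x) - wderiv L W x) =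
  L2sq D (wderiv L (h^-1 *: (F - G) - W)).
Proof.
move=> hF hG hW.
set q := (fun x => _); set Q : field R := _ - _.
have H b : wd L (fpart b Q) (fpart b q).
  have := wd_lin2 1 (-1) (wd_lin2 (h^-1) (- h^-1) (H1_wd b hF) (H1_wd b hG))
    (H1_wd b hW).
  rewrite (_ : (fun x => 1 * (h^-1 * fpart b F x + _) + _) = fpart b Q); last first.
    by apply/funext => x; rewrite /fpart /Q partB partZ partB; ring.
  rewrite (_ : (fun x => 1 * _ + _) = fpart b q)//.
  by apply/funext => x; rewrite /fpart /q partB partZ partB; ring.
have [hQ e] := wd_H1 L0 H.
have [lq _] : L2 D q /\ True by split => //; apply: sqi_L2 => // b; case: (H b).
by apply: L2sq_ae => //; [case: (H1_wderiv hQ)|exact: (ae_eq_sym e)].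
Qed.

Lemma wderiv_ae F G b : H1 L F -> H1 L G -> F = G %[ae leb in D] ->
  ae_eq leb D (fpart b (wderiv L F)) (fpart b (wderiv L G)).
Proof.
move=> hF hG e; apply: (wd_unique L0 _ (H1_wd b hG)).
apply: (wd_ae _ (fpart_ae b e) (H1_wd b hF)).
exact: L2_sqi hG.1.
Qed.

End Trajectories.

Fact le_addel (R : realType) (x y z : \bar R) : (x <= y -> 0 <= z -> x <= y + z)%E.
Proof. by move=> xy z0; rewrite -[leLHS]adde0 leeD. Qed.

Fact le_adder (R : realType) (x y z : \bar R) : (x <= z -> 0 <= y -> x <= y + z)%E.
Proof. by move=> xz y0; rewrite -[leLHS]add0e leeD. Qed.

Section Evolution.
Context {R : realType}.
Local Notation leb := (@lebesgue_measure R).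
Variable p : params R.
Hypothesis hp : admissible p.
Local Notation L := (len p).
Local Notation D := (dom L).

Let L0 : 0 < L. Proof. by case: hp => _ [[]]. Qed.
Let mD : measurable D := measurable_dom L.
Let mT : measurable [set: R] := measurableT.

(* the components of a state *)
Local Notation cV u := (u.1.1.1.1.1.1).
Local Notation cf u := (u.1.1.1.1.1.2).
Local Notation c1 u := (u.1.1.1.1.2).
Local Notation cP u := (u.1.1.1.2).
Local Notation cg u := (u.1.1.2).
Local Notation c2 u := (u.1.2).
Local Notation cth u := (u.2).

Lemma snapE b (u w : state R) : snap p b u w =
  let r F := fpart b (trace L F) in
  Snapshot
    (r (cV u)) (r (wderiv L (cV u))) (fpart b (wderiv L (wderiv L (cV u))))
    (r (cf u)) (fpart b (wderiv L (cf u))) (fpart b (cf w))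
    (r (cP u)) (r (wderiv L (cP u))) (fpart b (wderiv L (wderiv L (cP u))))
    (r (cg u)) (fpart b (wderiv L (cg u))) (fpart b (cg w))
    (r (cth u)) (r (wderiv L (cth u))) (fpart b (wderiv L (wderiv L (cth u))))
    (fpart b (cth w))
    (fpart b (c1 u)) (fpart b (c1 w)) (fpart b (c2 u)) (fpart b (c2 w)).
Proof.
by case: u => [[[[[[? ?] ?] ?] ?] ?] ?]; case: w => [[[[[[? ?] ?] ?] ?] ?] ?].
Qed.

(** Each component is bounded by the norm of H_1; V and P also with their
    weak derivatives. *)
Lemma Hsq_component (u : state R) :
  [/\ (L2sq D (cV u) <= Hsq p u)%E, (L2sq D (wderiv L (cV u)) <= Hsq p u)%E,
      (L2sq D (cf u) <= Hsq p u)%E & (L2sq setT (c1 u) <= Hsq p u)%E] /\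
  [/\ (L2sq D (cP u) <= Hsq p u)%E, (L2sq D (wderiv L (cP u)) <= Hsq p u)%E,
      (L2sq D (cg u) <= Hsq p u)%E, (L2sq setT (c2 u) <= Hsq p u)%E &
      (L2sq D (cth u) <= Hsq p u)%E].
Proof.
case: u => [[[[[[V f] phi1] P] g] phi2] th]; rewrite /Hsq /H1sq /=.
have := L2sq_ge0 D V; have := L2sq_ge0 D (wderiv L V); have := L2sq_ge0 D f.
have := L2sq_ge0 setT phi1; have := L2sq_ge0 D P; have := L2sq_ge0 D (wderiv L P).
have := L2sq_ge0 D g; have := L2sq_ge0 setT phi2; have := L2sq_ge0 D th.
move: (L2sq D V) (L2sq D (wderiv L V)) (L2sq D f) (L2sq setT phi1) (L2sq D P)
  (L2sq D (wderiv L P)) (L2sq D g) (L2sq setT phi2) (L2sq D th).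
move=> x1 x2 x3 x4 x5 x6 x7 x8 x9 h9 h8 h7 h6 h5 h4 h3 h2 h1.
have h12 := adde_ge0 h1 h2; have h123 := adde_ge0 h12 h3.
have h1234 := adde_ge0 h123 h4; have h56 := adde_ge0 h5 h6.
have h16 := adde_ge0 h1234 h56; have h17 := adde_ge0 h16 h7; have h18 := adde_ge0 h17 h8.
have g2 x : (x <= x1 + x2 -> x <= x1 + x2 + x3 + x4 + (x5 + x6) + x7 + x8 + x9)%E.
  by move=> xle; do 6 apply: le_addel => //.
have g56 x : (x <= x5 + x6 -> x <= x1 + x2 + x3 + x4 + (x5 + x6) + x7 + x8 + x9)%E.
  by move=> xle; do 3 apply: le_addel => //; exact: le_adder.
split; split.
- by apply: g2; exact: le_addel.
- by apply: g2; exact: le_adder.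
- by do 5 apply: le_addel => //; exact: le_adder.
- by do 4 apply: le_addel => //; exact: le_adder.
- by apply: g56; exact: le_addel.
- by apply: g56; exact: le_adder.
- by do 2 apply: le_addel => //; exact: le_adder.
- by apply: le_addel => //; exact: le_adder.
- exact: le_adder.
Qed.

Lemma inH_components (u : state R) : inH p u ->
  [/\ H1 L (cV u), L2 D (cf u) & L2 setT (c1 u)] /\
  [/\ H1 L (cP u), L2 D (cg u), L2 setT (c2 u) & L2 D (cth u)].
Proof.
by case: u => [[[[[[V f] phi1] P] g] phi2] th] [[[? _] ? ?] [[[? _] ? ?] ?]].
Qed.

Lemma inD_components (u : state R) : inD p u ->
  [/\ H2 L (cV u), H2 L (cP u), H1 L (cf u), H1 L (cg u) & H1 L (cth u)].
Proof.
case: u => [[[[[[V f] phi1] P] g] phi2] th] [_ [[h2V h2P [h1f _] [h1g _]] [[h2th _ _] _]]].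
exact: And5 h2V h2P h1f h1g h2th.1.
Qed.

Lemma velocities_components (u w : state R) : velocities p u w ->
  cV w = cf u %[ae leb in D] /\ cP w = cg u %[ae leb in D].
Proof.
by case: u => [[[[[[? ?] ?] ?] ?] ?] ?]; case: w => [[[[[[? ?] ?] ?] ?] ?] ?].
Qed.

(** The derivative in H_1 of a solution: as V_t = f, the space derivative of
    V is differentiable in L^2 with derivative f_x, and likewise for P. *)
Lemma evolves_snap b (U W : R -> state R) :
  (forall t, 0 <= t -> inD p (U t)) -> C1_in_H p U W ->
  (forall t, 0 <= t -> velocities p (U t) (W t)) ->
  evolves p (fun t => snap p b (U t) (W t)).
Proof.
move=> hD hC hv.
have hU t (t0 : 0 <= t) := inD_components (hD t t0).
have kU t (t0 : 0 <= t) : inH p (U t) by case: (hC t t0).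
have kW t (t0 : 0 <= t) : inH p (W t) by case: (hC t t0).
have strace F : H1 L F -> sqi D (fpart b (trace L F)).
  by move=> hF; apply: (sqi_ac L0); exact: trace_ac.
pose Q t h := h^-1 *: (U (t + h) - U t) - W t.
have lim t (t0 : 0 <= t) : Hsq p (Q t h) @[h --> increments t] --> 0%E.
  by case: (hC t t0).
split=> t t0; have [[hWV lWf lW1] [hWP lWg lW2 lWth]] := inH_components (kW t t0);
  have [h2V h2P h1f h1g h1th] := hU t t0;
  have [eV eP] := velocities_components (hv t t0).
- apply: (@l2diff_fpart _ _ mD b (fun s => cV (U s)) (cV (W t)) _ _ _ _ t0
    _ _ _ _ _ _ _ (lim t t0)).
  + by move=> s s0; have [x y _ _ _] := hU s s0; case: x => [[]].
  + by case: hWV.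
  + by move=> s s0; rewrite snapE; apply: strace; have [x y _ _ _] := hU s s0; exact: x.1.
  + by rewrite snapE; exact: strace.
  + move=> s s0; rewrite snapE; apply: trace_ae => //.
    by have [x y _ _ _] := hU s s0; exact: x.1.
  + rewrite snapE; apply: (ae_eq_trans (trace_ae L0 b h1f)).
    exact: ae_eq_sym (fpart_ae b eV).
  + by move=> h _; have [[x1 x2 x3 x4] [x5 x6 x7 x8 x9]] := Hsq_component (Q t h); exact: x1.
- apply: (@l2diff_fpart _ _ mD b (fun s => wderiv L (cV (U s))) (wderiv L (cV (W t)))
    _ _ _ _ t0 _ _ _ _ _ _ _ (lim t t0)).
  + by move=> s s0; have [x y _ _ _] := hU s s0; case: x => _ [].
  + by case: (H1_wderiv hWV).
  + by move=> s s0; rewrite snapE; apply: strace; have [x y _ _ _] := hU s s0; exact: x.2.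
  + by rewrite snapE; apply: L2_sqi => //; case: (H1_wderiv h1f).
  + move=> s s0; rewrite snapE; apply: trace_ae => //.
    by have [x y _ _ _] := hU s s0; exact: x.2.
  + by rewrite snapE; apply: wderiv_ae => //; exact: ae_eq_sym.
  + move=> h th; have [[x1 x2 x3 x4] [x5 x6 x7 x8 x9]] := Hsq_component (Q t h).
    have H1th : H1 L (cV (U (t + h))) by have [x y _ _ _] := hU _ th; exact: x.1.
    have E : cV (Q t h) = h^-1 *: (cV (U (t + h)) - cV (U t)) - cV (W t) by [].
    apply: le_trans x2; rewrite E.
    by rewrite -(L2sq_wderiv_quotient L0 h H1th h2V.1 hWV).
- apply: (@l2diff_fpart _ _ mD b (fun s => cf (U s)) (cf (W t)) _ _ _ _ t0
    _ _ _ _ _ _ _ (lim t t0)).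
  + by move=> s s0; have [_ _ x y z] := hU s s0; exact: x.1.
  + exact: lWf.
  + by move=> s s0; rewrite snapE; apply: strace; have [_ _ x y z] := hU s s0; exact: x.
  + by rewrite snapE; exact: L2_sqi.
  + move=> s s0; rewrite snapE; apply: trace_ae => //.
    by have [_ _ x y z] := hU s s0; exact: x.
  + by rewrite snapE; exact: ae_eq_refl.
  + by move=> h _; have [[x1 x2 x3 x4] [x5 x6 x7 x8 x9]] := Hsq_component (Q t h); exact: x3.
- apply: (@l2diff_fpart _ _ mD b (fun s => cP (U s)) (cP (W t)) _ _ _ _ t0
    _ _ _ _ _ _ _ (lim t t0)).
  + by move=> s s0; have [x y _ _ _] := hU s s0; case: y => [[]].
  + by case: hWP.
  + by move=> s s0; rewrite snapE; apply: strace; have [x y _ _ _] := hU s s0; exact: y.1.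
  + by rewrite snapE; exact: strace.
  + move=> s s0; rewrite snapE; apply: trace_ae => //.
    by have [x y _ _ _] := hU s s0; exact: y.1.
  + rewrite snapE; apply: (ae_eq_trans (trace_ae L0 b h1g)).
    exact: ae_eq_sym (fpart_ae b eP).
  + by move=> h _; have [[x1 x2 x3 x4] [x5 x6 x7 x8 x9]] := Hsq_component (Q t h); exact: x5.
- apply: (@l2diff_fpart _ _ mD b (fun s => wderiv L (cP (U s))) (wderiv L (cP (W t)))
    _ _ _ _ t0 _ _ _ _ _ _ _ (lim t t0)).
  + by move=> s s0; have [x y _ _ _] := hU s s0; case: y => _ [].
  + by case: (H1_wderiv hWP).
  + by move=> s s0; rewrite snapE; apply: strace; have [x y _ _ _] := hU s s0; exact: y.2.
  + by rewrite snapE; apply: L2_sqi => //; case: (H1_wderiv h1g).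
  + move=> s s0; rewrite snapE; apply: trace_ae => //.
    by have [x y _ _ _] := hU s s0; exact: y.2.
  + by rewrite snapE; apply: wderiv_ae => //; exact: ae_eq_sym.
  + move=> h th; have [[x1 x2 x3 x4] [x5 x6 x7 x8 x9]] := Hsq_component (Q t h).
    have H1th : H1 L (cP (U (t + h))) by have [x y _ _ _] := hU _ th; exact: y.1.
    have E : cP (Q t h) = h^-1 *: (cP (U (t + h)) - cP (U t)) - cP (W t) by [].
    apply: le_trans x6; rewrite E.
    by rewrite -(L2sq_wderiv_quotient L0 h H1th h2P.1 hWP).
- apply: (@l2diff_fpart _ _ mD b (fun s => cg (U s)) (cg (W t)) _ _ _ _ t0
    _ _ _ _ _ _ _ (lim t t0)).
  + by move=> s s0; have [_ _ x y z] := hU s s0; exact: y.1.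
  + exact: lWg.
  + by move=> s s0; rewrite snapE; apply: strace; have [_ _ x y z] := hU s s0; exact: y.
  + by rewrite snapE; exact: L2_sqi.
  + move=> s s0; rewrite snapE; apply: trace_ae => //.
    by have [_ _ x y z] := hU s s0; exact: y.
  + by rewrite snapE; exact: ae_eq_refl.
  + by move=> h _; have [[x1 x2 x3 x4] [x5 x6 x7 x8 x9]] := Hsq_component (Q t h); exact: x7.
- apply: (@l2diff_fpart _ _ mD b (fun s => cth (U s)) (cth (W t)) _ _ _ _ t0
    _ _ _ _ _ _ _ (lim t t0)).
  + by move=> s s0; have [_ _ x y z] := hU s s0; exact: z.1.
  + exact: lWth.
  + by move=> s s0; rewrite snapE; apply: strace; have [_ _ x y z] := hU s s0; exact: z.
  + by rewrite snapE; exact: L2_sqi.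
  + move=> s s0; rewrite snapE; apply: trace_ae => //.
    by have [_ _ x y z] := hU s s0; exact: z.
  + by rewrite snapE; exact: ae_eq_refl.
  + by move=> h _; have [[x1 x2 x3 x4] [x5 x6 x7 x8 x9]] := Hsq_component (Q t h); exact: x9.
- apply: (@l2diff_fpart _ _ mT b (fun s => c1 (U s)) (c1 (W t)) _ _ _ _ t0
    _ _ _ _ _ _ _ (lim t t0)).
  + by move=> s s0; have [[_ _ x] [_ _ y _]] := inH_components (kU s s0); exact: x.
  + exact: lW1.
  + move=> s s0; rewrite snapE; apply: L2_sqi => //.
    by have [[_ _ x] [_ _ y _]] := inH_components (kU s s0); exact: x.
  + by rewrite snapE; exact: L2_sqi.
  + by move=> s s0; rewrite snapE; exact: ae_eq_refl.
  + by rewrite snapE; exact: ae_eq_refl.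
  + by move=> h _; have [[x1 x2 x3 x4] [x5 x6 x7 x8 x9]] := Hsq_component (Q t h); exact: x4.
- apply: (@l2diff_fpart _ _ mT b (fun s => c2 (U s)) (c2 (W t)) _ _ _ _ t0
    _ _ _ _ _ _ _ (lim t t0)).
  + by move=> s s0; have [[_ _ x] [_ _ y _]] := inH_components (kU s s0); exact: y.
  + exact: lW2.
  + move=> s s0; rewrite snapE; apply: L2_sqi => //.
    by have [[_ _ x] [_ _ y _]] := inH_components (kU s s0); exact: y.
  + by rewrite snapE; exact: L2_sqi.
  + by move=> s s0; rewrite snapE; exact: ae_eq_refl.
  + by rewrite snapE; exact: ae_eq_refl.
  + by move=> h _; have [[x1 x2 x3 x4] [x5 x6 x7 x8 x9]] := Hsq_component (Q t h); exact: x8.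
Qed.

End Evolution.

(** * Exponential stability *)

Theorem theorem6p1 (R : realType) (p : params R) (hp : admissible p) :
  exists M omega : R, [/\ 0 < M, 0 < omega &
    forall U : R -> state R, is_solution p U ->
    forall t : R, 0 <= t ->
      energy p (U t) <= M * energy p (U 0) * expR (- omega * t)].
Proof.
have [M [w [M0 w0 decay]]] := snapshot_decay hp.
exists M, w; split => // U [hD [W [hC hv he]]] t t0.
have iD s (s0 : 0 <= s) : inD p (U s) by case: (hD s s0).
have iW s (s0 : 0 <= s) : inH p (W s) by case: (hC s s0).
have part_decay b : snap_energy p (snap p b (U t) (W t)) <=
    M * snap_energy p (snap p b (U 0) (W 0)) * expR (- w * t).
  apply: (decay (fun s => snap p b (U s) (W s))) => //.
  - by move=> s s0; exact: regular_snap (iD s s0) (iW s s0).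
  - by move=> s s0; exact: solves_snap (iD s (ltW s0)) (he s s0).
  - exact: evolves_snap.
rewrite (energy_snap hp (W t) (iD t t0)) (energy_snap hp (W 0) (iD 0 (lexx 0))).
by rewrite mulrDr mulrDl lerD.
Qed.
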